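(* Let $c_0\ge2$ be any constant and $\varepsilon_0=\exp(-c_0d)$. There is an algorithm running in time $(\rho d/\varepsilon_0^3)^{O(d)}\mathrm{poly}(1/w_{\min})$ that, given samples from a $\rho$-bounded mixture of $k$ spherical Gaussians $\mathcal{G}=\{(w_j,\mu_j,\sigma_j):j\in[k]\}$ in $\mathbb{R}^d$ satisfying $$\|\mu_i-\mu_j\|_2\ge4c_0\big(\sqrt d+\sqrt{\log(\rho_w\rho_\sigma)}\big)(\sigma_i+\sigma_j)\quad\text{for all }i\ne j,$$ finds with high probability $\{(\tilde\mu_j,\tilde\sigma_j,\tilde w_j):j\in[k]\}$ such that for all $j\in[k]$: $\|\tilde\mu_j-\mu_j\|_2\le\varepsilon_0\sigma_j\sqrt d$, $|\tilde\sigma_j-\sigma_j|\le\varepsilon_0\sigma_j$, and $|\tilde w_j-w_j|\le\varepsilon_0w_j$.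
   Context: A mixture $\{(w_j,\mu_j,\sigma_j)\}_{j\in[k]}$ of spherical Gaussians in $\mathbb{R}^d$ has p.d.f. $\sum_jw_j\sigma_j^{-d}\exp(-\pi\|x-\mu_j\|_2^2/\sigma_j^2)$. It is $\rho$-bounded if $\|\mu_j\|_2\le\rho$ and $1/\rho\le\sigma_j\le\rho$ for all $j$. $w_{\min}=\min_jw_j$, $\rho_w=\max_jw_j/\min_jw_j$, $\rho_\sigma=\max_j\sigma_j/\min_j\sigma_j$. ''With high probability'' means with probability at least $1-(d+k)^{-\Omega(1)}$. *)

(* Defs.v *)
From HB Require Import structures.
From mathcomp Require Import all_boot all_order all_algebra all_fingroup.
From mathcomp Require Import all_classical all_reals all_analysis.
From mathcomp Require Import measurable_realfun.

Set Implicit Arguments.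
Unset Strict Implicit.
Unset Printing Implicit Defensive.

Import Order.TTheory GRing.Theory Num.Theory.
Import numFieldNormedType.Exports.

Local Open Scope classical_set_scope.
Local Open Scope ring_scope.

(* The norm MathComp-Analysis puts on 'rV[R]_d is the sup norm. *)
Definition l2norm (R : realType) (d : nat) (v : 'rV[R]_d) : R :=
  Num.sqrt (\sum_(i < d) v 0 i ^+ 2).

(* Points of R^d at which densities are evaluated are d.-tuples, as these carry
   the product Borel sigma-algebra in the library. *)
Definition rV_of_tuple (R : realType) (d : nat) (x : d.-tuple R) : 'rV[R]_d :=
  \row_(i < d) tnth x i.

Record mixture (R : realType) (d k : nat) := Mixture {
  weight : 'I_k -> R ;
  mean : 'I_k -> 'rV[R]_d ;
  std : 'I_k -> R ;
  weight_gt0 : forall j, 0 < weight j ;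
  weight_sum1 : \sum_(j < k) weight j = 1 ;
  std_gt0 : forall j, 0 < std j
}.

Definition mixture_pdf (R : realType) (d k : nat) (G : mixture R d k)
    (x : d.-tuple R) : R :=
  \sum_(j < k) weight G j * std G j ^- d *
    expR (- pi * l2norm (rV_of_tuple x - mean G j) ^+ 2 / std G j ^+ 2).

Definition rho_bounded (R : realType) (d k : nat) (rho : R)
    (G : mixture R d k) : Prop :=
  forall j, l2norm (mean G j) <= rho /\ rho^-1 <= std G j <= rho.

(* For 0 < k and positive f the default values of these two iterated
   operators are absorbed, so they are the maximum and the minimum of f. *)
Definition fmax (R : realType) (k : nat) (f : 'I_k -> R) : R :=
  \big[Num.max/0]_(j < k) f j.
Definition fmin (R : realType) (k : nat) (f : 'I_k -> R) : R :=
  \big[Num.min/fmax f]_(j < k) f j.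

Definition wmin (R : realType) (d k : nat) (G : mixture R d k) : R :=
  fmin (weight G).
Definition rho_w (R : realType) (d k : nat) (G : mixture R d k) : R :=
  fmax (weight G) / fmin (weight G).
Definition rho_sigma (R : realType) (d k : nat) (G : mixture R d k) : R :=
  fmax (std G) / fmin (std G).

Definition well_separated (R : realType) (d k : nat) (c0 : R)
    (G : mixture R d k) : Prop :=
  forall i j : 'I_k, i != j ->
    4 * c0 * (Num.sqrt d%:R + Num.sqrt (ln (rho_w G * rho_sigma G)))
      * (std G i + std G j)
    <= l2norm (mean G i - mean G j).

(* d-dimensional Lebesgue measure, as an iterated product measure; on R^0 it
   is the unit mass at the empty tuple. *)
Fixpoint lebesgue_tuple (R : realType) (d : nat) :
    set (d.-tuple R) -> \bar R :=
  match d return set (d.-tuple R) -> \bar R with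
  | 0%N => dirac [tuple]
  | n.+1 => pushforward
      (product_measure1 (@lebesgue_measure R) (@lebesgue_tuple R n))
      (fun p : R * n.-tuple R => [tuple of p.1 :: p.2])
  end.

Lemma lebesgue_tuple0 (R : realType) d : @lebesgue_tuple R d set0 = 0%E.
Proof.
elim: d => [|d ih]; first by rewrite /= diracE in_set0.
rewrite /= /pushforward /product_measure1 integral0_eq// => x _ /=.
by rewrite preimage_set0 xsection0 ih.
Qed.

Lemma lebesgue_tuple_box (R : realType) d (A : 'I_d -> set R) :
  (forall i, measurable (A i)) ->
  lebesgue_tuple [set x : d.-tuple R | forall i, A i (tnth x i)] =
  (\prod_(i < d) lebesgue_measure (A i))%E.
Proof.
elim: d A => [|d ih] A mA.
  by rewrite big_ord0 /= diracE mem_set//= => -[].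
rewrite big_ord_recl /= /pushforward /product_measure1.
rewrite -(ih (fun i => A (lift ord0 i)))//.
set B := [set _ | _]; set B' := [set x : d.-tuple R | _].
transitivity (\int[@lebesgue_measure R]_x ((\1_(A ord0) x)%:E * lebesgue_tuple B'))%E.
  apply: eq_integral.
  move=> x _ /=; rewrite indicE.
  have [xA|xA] /= := boolP (x \in A ord0).
    rewrite mul1e; congr lebesgue_tuple; apply/seteqP; split=> t.
      by rewrite /xsection/= inE => /= h i; have := h (lift ord0 i); rewrite tnthS.
    rewrite /xsection/= inE => /= h i.
    case: (unliftP ord0 i) => [j|] ->; first by rewrite tnthS; exact: h.
    by rewrite tnth0; rewrite inE in xA.
  rewrite mul0e -(lebesgue_tuple0 R d); congr lebesgue_tuple; apply/seteqP; split=> t //.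
  rewrite /xsection/= inE => /= h; move: xA => /negP; rewrite inE; apply.
  by have := h ord0; rewrite tnth0.
rewrite ge0_integralZr ?integral_indic ?setIT//.
all: try by rewrite (ih (fun i => A (lift ord0 i)))//; apply: prode_ge0 => i _.
  exact: mA.
apply/measurable_realfun.measurable_EFinP. apply: measurable_indic; exact: mA.
Qed.

Definition mutually_independent (R : realType) (dO dT : measure_display)
    (Omega : measurableType dO) (T : measurableType dT)
    (P : probability Omega R) (X : nat -> {RV P >-> T}) : Prop :=
  forall (J : seq nat) (A : nat -> set T), uniq J ->
    (forall i, measurable (A i)) ->
    P (\bigcap_(i in [set` J]) (X i @^-1` A i)) =
    (\prod_(i <- J) P (X i @^-1` A i))%E.

Definition iid_samples (R : realType) (d k : nat) (G : mixture R d k)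
    (dO : measure_display) (Omega : measurableType dO)
    (P : probability Omega R) (X : nat -> {RV P >-> d.-tuple R}) : Prop :=
  mutually_independent X /\
  forall (i : nat) (A : set (d.-tuple R)), measurable A ->
    P (X i @^-1` A) = (\int[@lebesgue_tuple R d]_(x in A) (mixture_pdf G x)%:E)%E.

(* A deterministic machine in the style of Blum-Shub-Smale and of
   Preparata-Shamos, presented as a while language.  It has one unbounded
   memory of natural numbers and one of real numbers, both with indirect
   addressing, and reads its random data from an infinite tape of reals.  Reals
   are only combined by field operations and comparisons: there is no
   conversion from reals to naturals (no rounding), and no transcendental
   primitive.  A program is a finite syntactic object that may, as usual in the
   BSS model, mention finitely many real constants; division by zero follows
   the convention 0^-1 = 0. *)

Inductive nexp : Type :=
| NLit of nat
| NMem of nexp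
| NAdd of nexp & nexp
| NSub of nexp & nexp
| NMul of nexp & nexp.

Inductive rexp (R : realType) : Type :=
| RLit of R
| RMem of nexp
| ROfNat of nexp
| RAdd of rexp R & rexp R
| ROpp of rexp R
| RMul of rexp R & rexp R
| RInv of rexp R.

Inductive bexp (R : realType) : Type :=
| BNLe of nexp & nexp
| BRLe of rexp R & rexp R
| BNot of bexp R
| BAnd of bexp R & bexp R.

(* In NSet a e and RSet a e the value of e is stored at the address a; Read a
   stores the next real of the tape at the address a of the real memory. *)
Inductive prog (R : realType) : Type :=
| Skip
| NSet of nexp & nexp
| RSet of nexp & rexp R
| Read of nexp
| Seq of prog R & prog R
| If of bexp R & prog R & prog R
| While of bexp R & prog R.

Record state (R : realType) := State {
  nmem : nat -> nat ;
  rmem : nat -> R ;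
  pos : nat (* number of reals already read from the tape *)
}.

Definition upd (T : Type) (m : nat -> T) (a : nat) (v : T) : nat -> T :=
  fun i => if i == a then v else m i.

Section Semantics.
Variable R : realType.
Implicit Types (s : state R) (b : bexp R) (p : prog R).

Fixpoint neval s (e : nexp) : nat :=
  match e with
  | NLit n => n
  | NMem a => nmem s (neval s a)
  | NAdd e1 e2 => neval s e1 + neval s e2
  | NSub e1 e2 => neval s e1 - neval s e2
  | NMul e1 e2 => neval s e1 * neval s e2
  end%N.

Fixpoint reval s (e : rexp R) : R :=
  match e with
  | RLit r => r
  | RMem a => rmem s (neval s a)
  | ROfNat n => (neval s n)%:R
  | RAdd e1 e2 => reval s e1 + reval s e2
  | ROpp e1 => - reval s e1
  | RMul e1 e2 => reval s e1 * reval s e2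
  | RInv e1 => (reval s e1)^-1
  end.

Fixpoint beval s b : bool :=
  match b with
  | BNLe e1 e2 => (neval s e1 <= neval s e2)%N
  | BRLe e1 e2 => reval s e1 <= reval s e2
  | BNot b1 => ~~ beval s b1
  | BAnd b1 b2 => beval s b1 && beval s b2
  end.

(* exec tape p s t s' : started in state s, p halts in state s' after exactly t
   steps.  Assignments, reads and tests cost one step each; the expressions of
   a program have bounded size, so this is its number of elementary operations
   up to a constant factor that depends on the program only. *)
Inductive exec (tape : nat -> R) : prog R -> state R -> nat -> state R -> Prop :=
| exec_skip s : exec tape (Skip R) s 1 s
| exec_nset a e s : exec tape (NSet R a e) s 1
    (State (upd (nmem s) (neval s a) (neval s e)) (rmem s) (pos s))
| exec_rset a e s : exec tape (RSet a e) s 1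
    (State (nmem s) (upd (rmem s) (neval s a) (reval s e)) (pos s))
| exec_read a s : exec tape (Read R a) s 1
    (State (nmem s) (upd (rmem s) (neval s a) (tape (pos s))) (pos s).+1)
| exec_seq p1 p2 s1 s2 s3 t1 t2 :
    exec tape p1 s1 t1 s2 -> exec tape p2 s2 t2 s3 ->
    exec tape (Seq p1 p2) s1 (t1 + t2) s3
| exec_if b p1 p2 s s' t :
    exec tape (if beval s b then p1 else p2) s t s' ->
    exec tape (If b p1 p2) s t.+1 s'
| exec_while_false b p s : beval s b = false ->
    exec tape (While b p) s 1 s
| exec_while_true b p s1 s2 s3 t1 t2 : beval s1 b = true ->
    exec tape p s1 t1 s2 -> exec tape (While b p) s2 t2 s3 ->
    exec tape (While b p) s1 (t1 + t2).+1 s3.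

Lemma exec_det tape p s t1 s1 t2 s2 :
  exec tape p s t1 s1 -> exec tape p s t2 s2 -> t1 = t2 /\ s1 = s2.
Proof.
move=> h; move: t2 s2.
elim: h => {p s t1 s1}
  [s|a e s|a e s|a s|p1 p2 s1 s2 s3 t1 t2 _ ih1 _ ih2|b p1 p2 s s' t _ ih
  |b p s bF|b p s1 s2 s3 t1 t2 bT _ ih1 _ ih2] t' s'' h; inversion h; subst=> //.
- have [-> e] := ih1 _ _ ltac:(eassumption); subst.
  by have [-> ->] := ih2 _ _ ltac:(eassumption).
- by have [-> ->] := ih _ _ ltac:(eassumption).
- by congruence.
- by congruence.
- have [-> e] := ih1 _ _ ltac:(eassumption); subst.
  by have [-> ->] := ih2 _ _ ltac:(eassumption).
Qed.

End Semantics.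

(* The inputs handed to the learner besides the samples: the dimension d and
   the number k of components in the natural memory, the bound rho on the
   parameters and the lower bound w0 on the weights in the real memory. *)
Definition init_state (R : realType) (d k : nat) (rho w0 : R) : state R :=
  State (fun i => nth 0%N [:: d; k] i) (fun i => nth 0 [:: rho; w0] i) 0%N.

(* The coordinates of the samples x 0, x 1, ... one after the other. *)
Definition sample_tape (R : realType) (d : nat) (x : nat -> d.-tuple R) :
    nat -> R :=
  fun n => nth 0 (x (n %/ d)%N) (n %% d)%N.

(* On halting, the real memory contains the k estimates one after the other
   from address 0 on, each as d coordinates of a mean, then a standard
   deviation, then a weight. *)
Definition out_mean (R : realType) (d : nat) (s : state R) (j : nat) :
    'rV[R]_d :=
  \row_(i < d) rmem s (j * d.+2 + i)%N.
Definition out_std (R : realType) (d : nat) (s : state R) (j : nat) : R :=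
  rmem s (j * d.+2 + d)%N.
Definition out_weight (R : realType) (d : nat) (s : state R) (j : nat) : R :=
  rmem s (j * d.+2 + d.+1)%N.

(* The estimates form an unordered set, whence the permutation. *)
Definition accurate (R : realType) (d k : nat) (eps0 : R) (G : mixture R d k)
    (s : state R) : Prop :=
  exists sg : 'S_k, forall j : 'I_k,
    [/\ l2norm (out_mean d s (sg j) - mean G j)
          <= eps0 * std G j * Num.sqrt d%:R,
        `|out_std d s (sg j) - std G j| <= eps0 * std G j &
        `|out_weight d s (sg j) - weight G j| <= eps0 * weight G j].

(* Main.v *)
(* The learner builds a histogram of the samples on a grid of width 1/M and reads
   the mixture off it.  By Chebyshev's inequality and a union bound, with high
   probability every cell frequency is within a tiny [tau] of its probability.
   Separation makes the other components negligible near the mean of a component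
   j (a packing argument sums their tails), so that there the frequencies follow
   a single Gaussian profile up to a relative error [accuracy], while at distance
   more than sqrt d * sigma_j from every mean mu_j the mixture is discretely
   subharmonic.  Hence a populated cell with a clearly negative discrete
   Laplacian lies in the core of one component, and maximizing the frequency plus
   a small paraboloid over a box around mu_j shows that every core contains such a
   cell.  From it one reads off sigma_j by comparing f(x + c) f(x - c) with
   exp(-2 pi) f(x)^2, moves coordinatewise to the mean by comparing f(x + c) with
   f(x - c), and gets w_j from the height of the profile.  Cells of a core found
   before are recognized by their distance to the recorded mean. *)

From HB Require Import structures.
Require Import Defs.
From mathcomp Require Import all_boot all_order all_algebra all_fingroup.
From mathcomp Require Import all_classical all_reals all_analysis.
From mathcomp Require Import measurable_realfun ring lra zify.

Set Implicit Arguments.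
Unset Strict Implicit.
Unset Printing Implicit Defensive.

Import Order.TTheory GRing.Theory Num.Theory.
Import numFieldNormedType.Exports.

Local Open Scope classical_set_scope.
Local Open Scope ring_scope.


(** * A language of counting loops and its compilation *)

(** The time bound must hold for every outcome, also off the good event, on a machine without
    rounding. Hence counting loops, whose limits are computed from [d], [rho] and [w0] before any
    sample is read: halting, and a bound polynomial in the largest limit, can then be read off the
    syntax. All constants are powers of one integer b = nR d K0^d, with nR >= rho and K0 >= exp(c0),
    and of nW >= 1/w0. As b <= (rho d/eps0^3)^2, exponents linear in d are affordable, and the
    choice M = b^20 is generous. The internal precision is eps0/(64 d), since the weight is
    recovered through the d-th power of a width, which multiplies relative errors by d. The profile
    exp(-pi r^2/s^2) is subharmonic from r^2 = d s^2/(2 pi) on; cores with r^2 <= d s^2 leave room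
    for discretization. The separation is used in the form 16 c0^2 (d + log(rho_w rho_sigma)) (s_i +
    s_j)^2: the logarithm pays for the ratio of weights and the number of scales of the widths, the
    term d for all that is exponential in the dimension. Neither controls k, so the tails cannot be
    summed by counting components; hence the packing. *)

Inductive ne : Type :=
| ELit of nat
| EReg of nat
| EHeap of ne
| EAdd of ne & ne
| ESub of ne & ne
| EMul of ne & ne.

Inductive re (R : realType) : Type :=
| XLit of R
| XMem of ne
| XNat of ne
| XAdd of re R & re R
| XOpp of re R
| XMul of re R & re R
| XInv of re R.

Inductive be (R : realType) : Type :=
| CNLe of ne & ne
| CRLe of re R & re R
| CNot of be R
| CAnd of be R & be R.

(* A counting loop [FFor r lim p] runs [p] with the counter [r] ranging over the
   naturals below the register [lim].  Registers and heap are separate, so that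
   heap writes cannot touch counters and limits. *)
Inductive fp (R : realType) : Type :=
| FSkip
| FReg of nat & ne
| FHeap of ne & ne
| FReal of ne & re R
| FRead of ne
| FSeq of fp R & fp R
| FIf of be R & fp R & fp R
| FFor of nat & nat & fp R.

Arguments FSkip {R}. Arguments FReg {R}. Arguments FHeap {R}. Arguments FRead {R}.
Arguments XMem {R}. Arguments XNat {R}. Arguments CNLe {R}.

Record fstate (R : realType) := FState {
  rg : nat -> nat ; hp : nat -> nat ; rl : nat -> R ; ps : nat }.

Definition nregs : nat := 40.
Arguments nregs : simpl never.

Section ForLanguage.
Variable R : realType.
Implicit Types (s : fstate R) (p q : fp R) (st : state R).

Definition setr s r v := FState (upd (rg s) r v) (hp s) (rl s) (ps s).

Fixpoint nev s (e : ne) : nat :=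
  match e with
  | ELit n => n
  | EReg r => rg s r
  | EHeap a => hp s (nev s a)
  | EAdd a b => nev s a + nev s b
  | ESub a b => nev s a - nev s b
  | EMul a b => nev s a * nev s b
  end%N.

Fixpoint rev s (e : re R) : R :=
  match e with
  | XLit r => r
  | XMem a => rl s (nev s a)
  | XNat a => (nev s a)%:R
  | XAdd a b => rev s a + rev s b
  | XOpp a => - rev s a
  | XMul a b => rev s a * rev s b
  | XInv a => (rev s a)^-1
  end.

Fixpoint bev s (b : be R) : bool :=
  match b with
  | CNLe a b => (nev s a <= nev s b)%N
  | CRLe a b => rev s a <= rev s b
  | CNot b => ~~ bev s b
  | CAnd b c => bev s b && bev s c
  end.

(** The limit of a loop is read once, on entry, and the counter is left equal to it, as after the
    compiled while loop. *)
Fixpoint den (tape : nat -> R) p s : fstate R :=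
  match p with
  | FSkip => s
  | FReg r e => setr s r (nev s e)
  | FHeap a e => FState (rg s) (upd (hp s) (nev s a) (nev s e)) (rl s) (ps s)
  | FReal a e => FState (rg s) (hp s) (upd (rl s) (nev s a) (rev s e)) (ps s)
  | FRead a => FState (rg s) (hp s) (upd (rl s) (nev s a) (tape (ps s))) (ps s).+1
  | FSeq p q => den tape q (den tape p s)
  | FIf b p q => if bev s b then den tape p s else den tape q s
  | FFor r lim p =>
      setr (iteri (rg s lim) (fun i s => den tape p (setr s r i)) s) r (rg s lim)
  end.

Fixpoint ne_wf (e : ne) : bool :=
  match e with
  | ELit _ => true
  | EReg r => (r < nregs)%N
  | EHeap a => ne_wf a
  | EAdd a b | ESub a b | EMul a b => ne_wf a && ne_wf b
  end.

Fixpoint re_wf (e : re R) : bool :=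
  match e with
  | XLit _ => true
  | XMem a | XNat a => ne_wf a
  | XAdd a b | XMul a b => re_wf a && re_wf b
  | XOpp a | XInv a => re_wf a
  end.

Fixpoint be_wf (b : be R) : bool :=
  match b with
  | CNLe a b => ne_wf a && ne_wf b
  | CRLe a b => re_wf a && re_wf b
  | CNot b => be_wf b
  | CAnd b c => be_wf b && be_wf c
  end.

Fixpoint writes p : seq nat :=
  match p with
  | FReg r _ => [:: r]
  | FSeq p q | FIf _ p q => writes p ++ writes q
  | FFor r _ p => r :: writes p
  | _ => [::]
  end.

Fixpoint limits p : seq nat :=
  match p with
  | FSeq p q | FIf _ p q => limits p ++ limits q
  | FFor _ l p => l :: limits p
  | _ => [::]
  end.

Fixpoint fp_wf p : bool :=
  match p with
  | FSkip => true
  | FReg r e => (r < nregs)%N && ne_wf e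
  | FHeap a e => ne_wf a && ne_wf e
  | FReal a e => ne_wf a && re_wf e
  | FRead a => ne_wf a
  | FSeq p q => fp_wf p && fp_wf q
  | FIf b p q => [&& be_wf b, fp_wf p & fp_wf q]
  | FFor r l p =>
      [&& (r < nregs)%N, (l < nregs)%N, r \notin writes p & fp_wf p]
  end.

Fixpoint cne (e : ne) : nexp :=
  match e with
  | ELit n => NLit n
  | EReg r => NMem (NLit r)
  | EHeap a => NMem (NAdd (NLit nregs) (cne a))
  | EAdd a b => NAdd (cne a) (cne b)
  | ESub a b => NSub (cne a) (cne b)
  | EMul a b => NMul (cne a) (cne b)
  end.

Fixpoint cre (e : re R) : rexp R :=
  match e with
  | XLit r => RLit r
  | XMem a => RMem R (cne a)
  | XNat a => ROfNat R (cne a)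
  | XAdd a b => RAdd (cre a) (cre b)
  | XOpp a => ROpp (cre a)
  | XMul a b => RMul (cre a) (cre b)
  | XInv a => RInv (cre a)
  end.

Fixpoint cbe (b : be R) : bexp R :=
  match b with
  | CNLe a b => BNLe R (cne a) (cne b)
  | CRLe a b => BRLe (cre a) (cre b)
  | CNot b => BNot (cbe b)
  | CAnd b c => BAnd (cbe b) (cbe c)
  end.

Fixpoint compile p : prog R :=
  match p with
  | FSkip => Skip R
  | FReg r e => NSet R (NLit r) (cne e)
  | FHeap a e => NSet R (NAdd (NLit nregs) (cne a)) (cne e)
  | FReal a e => RSet (cne a) (cre e)
  | FRead a => Read R (cne a)
  | FSeq p q => Seq (compile p) (compile q)
  | FIf b p q => If (cbe b) (compile p) (compile q)
  | FFor r l p =>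
      Seq (NSet R (NLit r) (NLit 0))
        (While (BNot (BNLe R (NMem (NLit l)) (NMem (NLit r))))
          (Seq (compile p)
            (NSet R (NLit r) (NAdd (NMem (NLit r)) (NLit 1)))))
  end.

(** [L] stands for a common bound of all loop limits. A round costs two steps besides its body, for
    test and increment; a loop two more, for the initialization and the last test. *)
Fixpoint cost (L : nat) p : nat :=
  match p with
  | FSeq p q => cost L p + cost L q
  | FIf _ p q => (cost L p + cost L q).+1
  | FFor _ _ p => L * (cost L p + 2) + 2
  | _ => 1
  end%N.

Definition sim s st : Prop :=
  [/\ forall r, (r < nregs)%N -> nmem st r = rg s r,
      forall a, nmem st (nregs + a)%N = hp s a,
      rmem st = rl s & pos st = ps s].

Lemma updE (T : Type) (m : nat -> T) a v i :
  upd m a v i = if i == a then v else m i.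
Proof. by []. Qed.

Lemma nev_sim s st e : sim s st -> ne_wf e -> neval st (cne e) = nev s e.
Proof.
case=> hr hh _ _; elim: e => //=.
- by move=> e ih /ih ->.
- by move=> a iha b ihb /andP[/iha -> /ihb ->].
- by move=> a iha b ihb /andP[/iha -> /ihb ->].
- by move=> a iha b ihb /andP[/iha -> /ihb ->].
Qed.

Lemma rev_sim s st e : sim s st -> re_wf e -> reval st (cre e) = rev s e.
Proof.
move=> h; have [_ _ hm _] := h; elim: e => //=.
- by move=> a wa; rewrite hm (nev_sim h).
- by move=> a wa; rewrite (nev_sim h).
- by move=> a iha b ihb /andP[/iha -> /ihb ->].
- by move=> a iha /iha ->.
- by move=> a iha b ihb /andP[/iha -> /ihb ->].
- by move=> a iha /iha ->.
Qed.

Lemma bev_sim s st b : sim s st -> be_wf b -> beval st (cbe b) = bev s b.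
Proof.
move=> h; elim: b => //=.
- by move=> a b /andP[wa wb]; rewrite !(nev_sim h).
- by move=> a b /andP[wa wb]; rewrite !(rev_sim h).
- by move=> b ih /ih ->.
- by move=> a iha b ihb /andP[/iha -> /ihb ->].
Qed.

Lemma sim_setr s st r v : (r < nregs)%N -> sim s st ->
  sim (setr s r v) (State (upd (nmem st) r v) (rmem st) (pos st)).
Proof.
move=> hr [h1 h2 h3 h4]; split => //= i.
  by move=> hi; rewrite !updE; case: eqP => // _; exact: h1.
by rewrite updE; case: eqP => [e|_]; [move: hr; rewrite -e ltnNge leq_addr|].
Qed.

Lemma iteri_ind (T : Type) (Q : nat -> T -> Prop) n (f : nat -> T -> T) x :
  Q 0%N x -> (forall i y, (i < n)%N -> Q i y -> Q i.+1 (f i y)) -> Q n (iteri n f x).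
Proof.
move=> h0 hS; have : forall m, (m <= n)%N -> Q m (iteri m f x).
  by elim=> // m ih hm /=; apply: hS => //; exact/ih/ltnW.
exact.
Qed.

Lemma den_writes tape p s r : r \notin writes p -> rg (den tape p s) r = rg s r.
Proof.
elim: p s => //=.
- by move=> r' e s; rewrite inE /= updE => /negbTE ->.
- by move=> p ihp q ihq s; rewrite mem_cat negb_or => /andP[/ihp h /ihq ->].
- by move=> b p ihp q ihq s; rewrite mem_cat negb_or => /andP[/ihp h /ihq h']; case: ifP.
- move=> r' l p ih s; rewrite inE negb_or => /andP[/negbTE rr' hr].
  rewrite updE rr'; elim/iteri_ind: _ => // i y _ <-.
  by rewrite ih //= updE rr'.
Qed.

(** The compiled loop reads its limit anew in every round. Therefore a register that limits some
    loop of [p] may not be written anywhere in [p]; all limits then keep their initial values, which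
    [L] bounds. *)
Lemma compile_exec tape L p s st : fp_wf p -> sim s st ->
  (forall r, r \in limits p -> r \notin writes p /\ (rg s r <= L)%N) ->
  exists t st', [/\ exec tape (compile p) st t st', (t <= cost L p)%N &
    sim (den tape p s) st'].
Proof.
elim: p s st => /=.
- by move=> s st _ h _; exists 1%N, st; split=> //; constructor.
- move=> r e s st /andP[hr we] h _.
  eexists 1%N, _; split; [exact: exec_nset|by []|].
  by rewrite /= (nev_sim h) //; exact: sim_setr.
- move=> a e s st /andP[wa we] h _; eexists 1%N, _; split; [exact: exec_nset|by []|].
  rewrite /= !(nev_sim h) //; case: h => h1 h2 h3 h4; split => //= i.
    move=> hi; rewrite updE; case: eqP => [e'|_]; last exact: h1.
    by move: hi; rewrite e' ltnNge leq_addr.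
  by rewrite !updE eqn_add2l h2.
- move=> a e s st /andP[wa we] h _; eexists 1%N, _; split; [exact: exec_rset|by []|].
  rewrite /= (nev_sim h) // (rev_sim h) //; case: h => h1 h2 h3 h4; split => //=.
  by rewrite h3.
- move=> a s st wa h _; eexists 1%N, _; split; [exact: exec_read|by []|].
  rewrite /= (nev_sim h) //; case: h => h1 h2 h3 h4; split => //=.
    by rewrite h3 h4.
  by rewrite h4.
- move=> p ihp q ihq s st /andP[wp wq] h hl.
  have [|t1 [st1 [e1 l1 h1]]] := ihp s st wp h.
    move=> r hr; have [] := hl r; first by rewrite mem_cat hr.
    by rewrite mem_cat negb_or => /andP[].
  have [|t2 [st2 [e2 l2 h2]]] := ihq _ st1 wq h1.
    move=> r hr; have [] := hl r; first by rewrite mem_cat hr orbT.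
    by rewrite mem_cat negb_or => /andP[hp' hq'] hL; rewrite den_writes.
  by exists (t1 + t2)%N, st2; split=> //; [econstructor; eassumption|exact: leq_add].
- move=> b p ihp q ihq s st /and3P[wb wp wq] h hl.
  have hp : forall r, r \in limits p -> r \notin writes p /\ (rg s r <= L)%N.
    move=> r hr; have [] := hl r; first by rewrite mem_cat hr.
    by rewrite mem_cat negb_or => /andP[].
  have hq : forall r, r \in limits q -> r \notin writes q /\ (rg s r <= L)%N.
    move=> r hr; have [] := hl r; first by rewrite mem_cat hr orbT.
    by rewrite mem_cat negb_or => /andP[].
  have [t1 [st1 [e1 l1 h1]]] := ihp s st wp h hp.
  have [t2 [st2 [e2 l2 h2]]] := ihq s st wq h hq.
  case: ifP => hb.
    exists t1.+1, st1; split=> //; last by rewrite ltnS (leq_trans l1) // leq_addr.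
    by constructor; rewrite (bev_sim h) // hb.
  exists t2.+1, st2; split=> //; last by rewrite ltnS (leq_trans l2) // leq_addl.
  by constructor; rewrite (bev_sim h) // hb.
- move=> r l p ih s st /and4P[hr hlm rp wp] h hl.
  set n := rg s l; set f := (fun (i : nat) (s0 : fstate R) => den tape p (setr s0 r i)).
  have [] := hl l; first by rewrite inE eqxx.
  rewrite inE negb_or => /andP[lr lp] nL.
  pose st0 := State (upd (nmem st) r 0%N) (rmem st) (pos st).
  (* Induction on the number [m] of rounds still to run; after [i] rounds the machine simulates the
     partial iteration with the counter at [i]. *)
  suff hW : forall m i st1, (m + i = n)%N ->
      sim (setr (iteri i f s) r i) st1 ->
      exists t st', [/\ exec tape (While (BNot (BNLe R (NMem (NLit l)) (NMem (NLit r))))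
          (Seq (compile p) (NSet R (NLit r) (NAdd (NMem (NLit r)) (NLit 1))))) st1 t st',
        (t <= m * (cost L p + 2) + 1)%N & sim (setr (iteri n f s) r n) st'].
    have [|t [st' [e1 t1 s1]]] := hW n 0%N st0 (addn0 n); first exact: sim_setr.
    exists (1 + t)%N, st'; split=> //.
      by econstructor; [exact: exec_nset|].
    rewrite addnC addn1 addn2 ltnS -addn1; apply: (leq_trans t1).
    by rewrite leq_add2r leq_mul2r nL orbT.
  have fl : forall i, rg (iteri i f s) l = n.
    elim=> //= i ihi; rewrite /f den_writes //= updE (negbTE lr); exact: ihi.
  elim=> [|m ihm] i st1 hmi h1.
    exists 1%N, st1; split=> //; last by rewrite -hmi add0n.
    apply: exec_while_false; have [k1 _ _ _] := h1.
    rewrite /= !k1 //= !updE eqxx (negbTE lr) fl -hmi add0n leqnn //.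
  have [|t1 [st2 [e1 l1 h2]]] := ih _ st1 wp h1.
    move=> r' hr'; have [] := hl r'; first by rewrite inE hr' orbT.
    rewrite inE negb_or => /andP[r'r r'p] r'L; split=> //.
    rewrite /= updE (negbTE r'r); elim/iteri_ind: _ => // j y _ hy.
    by rewrite /f den_writes //= updE (negbTE r'r).
  have kr : rg (iteri i.+1 f s) r = i by rewrite /= /f den_writes //= updE eqxx.
  pose st3 := State (upd (nmem st2) r i.+1) (rmem st2) (pos st2).
  have h3 : sim (setr (iteri i.+1 f s) r i.+1) st3 by exact: sim_setr.
  have [|t2 [st4 [e2 l2 h4]]] := ihm i.+1 st3 _ h3; first by rewrite addnS -addSn.
  exists (((t1 + 1) + t2).+1)%N, st4; split=> //.
    apply: exec_while_true e2.
      have [k1 _ _ _] := h1.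
      rewrite /= !k1 //= !updE eqxx (negbTE lr) fl -hmi -ltnNge addSn ltnS leq_addl //.
    apply: exec_seq e1 _; rewrite /st3.
    have [k2 _ _ _] := h2.
    have -> : i.+1 = neval st2 (NAdd (NMem (NLit r)) (NLit 1)).
      by rewrite /= k2 // -[den _ _ _]/(iteri i.+1 f s) kr addn1.
    exact: exec_nset.
  by rewrite mulSn; move: l1 l2; lia.
Qed.

(** Exponents of subprograms are added rather than compared, which is crude but harmless: [A] and
    [D] depend on the program only. *)
Lemma cost_poly p : exists A D, forall L, (0 < L)%N -> (cost L p <= A * L ^ D)%N.
Proof.
elim: p => /=; try by [exists 1%N, 0%N => L _; rewrite expn0|
  move=> *; exists 1%N, 0%N => L _; rewrite expn0].
- move=> p [A [D hp]] q [A' [D' hq]]; exists (A + A')%N, (D + D')%N => L L0.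
  rewrite mulnDl; apply: leq_add; [apply: leq_trans (hp L L0) _|apply: leq_trans (hq L L0) _].
    by rewrite expnD mulnA leq_pmulr // expn_gt0 L0.
  by rewrite expnD mulnCA leq_pmull // expn_gt0 L0.
- move=> b p [A [D hp]] q [A' [D' hq]]; exists (A + A').+1, (D + D')%N => L L0.
  have L0' k : (0 < L ^ k)%N by rewrite expn_gt0 L0.
  rewrite mulSn mulnDl -addn1 addnC leq_add //; apply: leq_add.
    by apply: leq_trans (hp L L0) _; rewrite expnD mulnA leq_pmulr.
  by apply: leq_trans (hq L L0) _; rewrite expnD mulnCA leq_pmull.
- move=> r l p [A [D hp]]; exists (A + 4)%N, D.+1 => L L0.
  have L0' k : (0 < L ^ k)%N by rewrite expn_gt0 L0.
  have : (L * cost L p <= A * L ^ D.+1)%N by rewrite expnS mulnCA leq_mul2l hp // orbT.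
  have : (L <= L ^ D.+1)%N by rewrite expnS leq_pmulr.
  by have := L0' D.+1; rewrite mulnDr mulnDl; lia.
Qed.

Fixpoint pure p : bool :=
  match p with
  | FHeap _ _ | FReal _ _ | FRead _ => false
  | FSeq p q | FIf _ p q => pure p && pure q
  | FFor _ _ p => pure p
  | _ => true
  end.

Fixpoint heap_free p : bool :=
  match p with
  | FHeap _ _ => false
  | FSeq p q | FIf _ p q => heap_free p && heap_free q
  | FFor _ _ p => heap_free p
  | _ => true
  end.

Definition frame p s s' : Prop :=
  [/\ forall r, r \notin writes p -> rg s' r = rg s r,
      heap_free p -> hp s' = hp s & pure p -> rl s' = rl s].

Lemma frame_den tape p s : frame p s (den tape p s).
Proof.
split; first by move=> r; exact: den_writes.
- elim: p s => //=.
  + by move=> p ihp q ihq s /andP[/ihp hp' /ihq ->].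
  + by move=> b p ihp q ihq s /andP[/ihp hp' /ihq hq]; case: ifP.
  + by move=> r l p ih s /ih h; elim/iteri_ind: _ => // i y _ h1; rewrite h.
- elim: p s => //=.
  + by move=> p ihp q ihq s /andP[/ihp hp' /ihq ->].
  + by move=> b p ihp q ihq s /andP[/ihp hp' /ihq hq]; case: ifP.
  + by move=> r l p ih s /ih h; elim/iteri_ind: _ => // i y _ h1; rewrite h.
Qed.

Lemma den_ps tape p s : pure p -> ps (den tape p s) = ps s.
Proof.
elim: p s => //=.
- by move=> p ihp q ihq s /andP[/ihp hp' /ihq ->].
- by move=> b p ihp q ihq s /andP[/ihp hp' /ihq hq]; case: ifP.
- by move=> r l p ih s /ih h; elim/iteri_ind: _ => // i y _ h1; rewrite h.
Qed.

(** The loop rule used throughout: [Q i] holds before round [i], and [frame] supplies everything the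
    loop does not write, so that invariants need to mention only what changes. *)
Lemma den_for tape r lim p s (Q : nat -> fstate R -> Prop) (S : fstate R -> Prop) :
  Q 0%N s ->
  (forall i s', (i < rg s lim)%N -> frame (FFor r lim p) s s' -> Q i s' ->
    Q i.+1 (den tape p (setr s' r i))) ->
  (forall s', frame (FFor r lim p) s s' -> Q (rg s lim) s' ->
    S (setr s' r (rg s lim))) ->
  S (den tape (FFor r lim p) s).
Proof.
move=> h0 hS.
have [] : frame (FFor r lim p) s
    (iteri (rg s lim) (fun i s => den tape p (setr s r i)) s) /\
    Q (rg s lim) (iteri (rg s lim) (fun i s => den tape p (setr s r i)) s).
  apply: (iteri_ind (Q := fun i s' => frame (FFor r lim p) s s' /\ Q i s')).
    by split.
  move=> i y hi [[f1 f2 f3] qy]; split; last by apply: hS.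
  have [g1 g2 g3] := frame_den tape p (setr y r i); split=> /=.
  - move=> r'; rewrite inE negb_or => /andP[rr' hr']; rewrite g1 //= updE (negbTE rr').
    by apply: f1; rewrite inE negb_or rr'.
  - by move=> hf; rewrite g2 //; exact: f2.
  - by move=> hf; rewrite g3 //; exact: f3.
by move=> f q h; exact: h.
Qed.

Lemma den_seq tape p q s : den tape (FSeq p q) s = den tape q (den tape p s).
Proof. by []. Qed.

Lemma den_reg tape r e s : den tape (FReg r e) s = setr s r (nev s e).
Proof. by []. Qed.

Lemma den_if tape b p q s :
  den tape (FIf b p q) s = if bev s b then den tape p s else den tape q s.
Proof. by []. Qed.

End ForLanguage.

(** * The learner *)

Section Learner.
Variable R : realType.
Variable tape : nat -> R.
Variable E2 : R.
Implicit Types (s : fstate R) (F : nat -> nat).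

(* The grid has B cells of width 1/M per coordinate and T2 = B^d cells in all; a
   cell is numbered by its base-B digits, and N samples are read.  FL and Q are
   the constants of the acceptance test [passes], and J counts the slots filled. *)
Notation rD := 0%N. Notation rB := 2%N. Notation rN := 3%N. Notation rT2 := 4%N.
Notation rM := 5%N. Notation rFL := 8%N. Notation rQ := 9%N.
Notation rg_ := 10%N. Notation ri := 11%N. Notation rt := 12%N. Notation rj := 13%N.
Notation ridx := 14%N. Notation rpw := 15%N. Notation rc := 16%N. Notation rJ := 17%N.
Notation rok := 18%N. Notation rr := 19%N. Notation rq := 20%N. Notation racc := 21%N.
Notation rs := 22%N. Notation rx := 23%N. Notation rdg := 24%N.

Definition half_exp : re R := XLit 2^-1.
Definition slot (a : ne) : ne := EAdd (EMul (EReg rJ) (EAdd (EReg rD) (ELit 2))) a.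
Definition invM : re R := XInv (XNat (EReg rM)).
Definition shiftM : re R := XOpp (XMul (XNat (EReg rM)) half_exp).

(** Natural expressions have no division; the quotient is found by scanning for the largest multiple
    of the divisor not exceeding the dividend. *)
Definition quot_prog : fp R :=
  FSeq (FReg rq (ELit 0))
  (FFor rt rT2 (FIf (CNLe (EMul (EAdd (EReg rt) (ELit 1)) (EReg rB)) (EReg rr))
     (FReg rq (EAdd (EReg rt) (ELit 1))) FSkip)).

Lemma den_quot s : (rg s rr < rg s rT2)%N -> (0 < rg s rB)%N ->
  rg (den tape quot_prog s) rq = (rg s rr %/ rg s rB)%N.
Proof.
move=> hr hB; rewrite /quot_prog den_seq den_reg.
apply: (@den_for _ tape _ _ _ _ (fun i s' => rg s' rq = minn i (rg s rr %/ rg s rB)) (fun s' => rg s' rq = _)).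
- by rewrite /= min0n.
- move=> i s' hi [fr _ _] h1.
  have e1 : rg s' rr = rg s rr by rewrite fr.
  have e2 : rg s' rB = rg s rB by rewrite fr.
  rewrite /= ?updE /= e1 e2 -leq_divRL //.
  by case: leqP => h /=; rewrite ?updE /= ?h1; lia.
- move=> s' _ h; rewrite /= ?updE /= h; apply/minn_idPr.
  by rewrite (leq_trans (leq_div _ _)) // ltnW.
Qed.

Definition digit (B x i : nat) : nat := (x %/ B ^ i %% B)%N.
(** With M^2 cells of width 1/M the grid covers the interval from -M/2 to M/2 in each coordinate. *)
Definition center (M c : nat) : R := (c%:R + 2^-1) * M%:R^-1 - M%:R * 2^-1.
(** The neighbours c - 1 and c + 1 must avoid the cells 0 and B - 1 as well, which collect
    everything off the grid. *)
Definition interior (B c : nat) : bool := (2 <= c)%N && (c + 3 <= B)%N.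

Definition decode_body : fp R :=
  FSeq quot_prog
  (FSeq (FReg rdg (ESub (EReg rr) (EMul (EReg rq) (EReg rB))))
  (FSeq (FIf (CAnd (CNLe (ELit 2) (EReg rdg)) (CNLe (EAdd (EReg rdg) (ELit 3)) (EReg rB)))
           FSkip (FReg rok (ELit 0)))
  (FSeq (FReal (slot (EReg ri))
           (XAdd (XMul (XAdd (XNat (EReg rdg)) half_exp) invM) shiftM))
        (FReg rr (EReg rq))))).
Definition decode_prog : fp R := FFor ri rD decode_body.

Lemma den_decode s (x := rg s rr) (B := rg s rB) (d := rg s rD)
    (a0 := (rg s rJ * (d + 2))%N) (s' := den tape decode_prog s) :
  (x < rg s rT2)%N -> (0 < B)%N ->
  [/\ rg s' rok = if \big[andb/true]_(i < d) interior B (digit B x i) then rg s rok else 0%N,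
      forall i, (i < d)%N -> rl s' (a0 + i)%N = center (rg s rM) (digit B x i) &
      forall a, (a < a0)%N || (a0 + d <= a)%N -> rl s' a = rl s a].
Proof.
move=> hx hB; rewrite {}/s'.
pose Q (i : nat) s' := [/\ rg s' rok = if \big[andb/true]_(j < i) interior B (digit B x j) then rg s rok else 0%N,
      forall j, (j < i)%N -> rl s' (a0 + j)%N = center (rg s rM) (digit B x j),
      forall a, (a < a0)%N || (a0 + d <= a)%N -> rl s' a = rl s a &
      rg s' rr = (x %/ B ^ i)%N].
apply: (@den_for _ tape _ _ _ _ Q (fun s' => [/\ rg s' rok = _ , forall i, (i < d)%N -> rl s' (a0 + i)%N = _
  & forall a, (a < a0)%N || (a0 + d <= a)%N -> rl s' a = rl s a])).
- by split=> //; rewrite ?big_ord0 // expn0 divn1.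
- move=> i s' hi [fr fh _] [h1 h2 h3 h4].
  have c1 : rg s' rB = B by rewrite fr.
  have c2 : rg s' rT2 = rg s rT2 by rewrite fr.
  have c3 : rg s' rJ = rg s rJ by rewrite fr.
  have c4 : rg s' rD = rg s rD by rewrite fr.
  have c5 : rg s' rM = rg s rM by rewrite fr.
  rewrite /decode_body den_seq; set s1 := den tape quot_prog _.
  have q1 : rg s1 rq = (x %/ B ^ i %/ B)%N.
    rewrite /s1 den_quot /= ?updE /= ?h4 ?c1 // c2.
    by rewrite (leq_ltn_trans (leq_div _ _)).
  have [fr1 _ fl1] := frame_den tape quot_prog (setr s' ri i).
  rewrite -/s1 in fr1 fl1.
  have k1 : rg s1 rr = (x %/ B ^ i)%N by rewrite fr1 //= ?updE.
  have k2 : rg s1 rB = B by rewrite fr1 //= ?updE.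
  have k3 : rg s1 rJ = rg s rJ by rewrite fr1 //= ?updE.
  have k4 : rg s1 rD = d by rewrite fr1 //= ?updE.
  have k5 : rg s1 rM = rg s rM by rewrite fr1 //= ?updE.
  have k6 : rg s1 ri = i by rewrite fr1 //= ?updE.
  have k7 : rg s1 rok = rg s' rok by rewrite fr1 //= ?updE.
  have k8 : rl s1 = rl s' by rewrite fl1.
  have dg : (x %/ B ^ i - x %/ B ^ i %/ B * B)%N = digit B x i.
    by rewrite /digit; have := divn_eq (x %/ B ^ i) B; lia.
  rewrite !den_seq; clearbody s1; set s2 := den tape (FReg rdg _) s1; rewrite den_if.
  have -> : (if bev s2 (CAnd (CNLe (ELit 2) (EReg rdg)) (CNLe (EAdd (EReg rdg) (ELit 3)) (EReg rB)))
     then den tape FSkip s2 else den tape (FReg rok (ELit 0)) s2) =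
     setr (setr s1 rdg (digit B x i)) rok (if interior B (digit B x i) then rg s1 rok else 0%N).
    rewrite /s2 /= ?updE /= k1 q1 k2 dg -/(interior _ _).
    case: (interior B _) => //; congr FState; apply: funext => r; rewrite ?updE.
    by case: (r =P rok) => // ->.
  set s3 := setr _ rok _.
  rewrite /= ?updE /= ; split => /=.
  + by rewrite ?updE /= big_ord_recr /= k7 h1; case: (\big[andb/true]_(j < i) _); case: ifP.
  + move=> j; rewrite ltnS leq_eqVlt ?updE k3 k4 k6 => /orP[/eqP ->|ji].
      by rewrite eqxx k5.
    by rewrite eqn_add2l (ltn_eqF ji) k8; exact: h2.
  + move=> a ha; rewrite ?updE k3 k4 k6 k8; case: eqP => [ea|_]; last exact: h3.
    by move: ha hi; rewrite ea /a0 /d; lia.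
  + by rewrite ?updE /= q1 expnS mulnC divnMA.
- move=> s' _ [h1 h2 h3 _]; split => //=; rewrite ?updE /= h1 //.
Qed.

Definition lap_prog : fp R :=
  FSeq (FReg racc (ELit 0)) (FSeq (FReg rpw (ELit 1))
  (FFor ri rD (FSeq (FReg racc (EAdd (EReg racc)
     (EAdd (EHeap (EAdd (EReg rg_) (EReg rpw))) (EHeap (ESub (EReg rg_) (EReg rpw))))))
     (FReg rpw (EMul (EReg rpw) (EReg rB)))))).

Definition lapsum (d B : nat) F g : nat :=
  (\sum_(i < d) (F (g + B ^ i) + F (g - B ^ i)))%N.

Lemma den_lap s : rg (den tape lap_prog s) racc = lapsum (rg s rD) (rg s rB) (hp s) (rg s rg_).
Proof.
rewrite /lap_prog !den_seq !den_reg.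
apply: (@den_for _ tape _ _ _ _ (fun i s' => rg s' racc = lapsum i (rg s rB) (hp s) (rg s rg_) /\
  rg s' rpw = (rg s rB ^ i)%N) (fun s' => rg s' racc = _)).
- by rewrite /= ?updE /= /lapsum big_ord0.
- move=> i s' hi [fr fh _] [h1 h2].
  have c1 : rg s' rB = rg s rB by rewrite fr.
  have c2 : rg s' rg_ = rg s rg_ by rewrite fr.
  have c3 : hp s' = hp s by rewrite fh.
  rewrite /= ?updE /= ?updE /= h1 h2 c1 c2 c3 /lapsum big_ord_recr /=; split => //.
  by rewrite expnS mulnC.
- by move=> s' _ [h _]; rewrite /= ?updE /= h.
Qed.

(** The first free slot is scratch space: it holds the centre of the current candidate, and squared
    distances are summed in its weight entry, which acceptance overwrites. *)
Definition acc_addr : ne := slot (EAdd (EReg rD) (ELit 1)).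
Definition sqdiff : re R :=
  let y := XAdd (XMem (slot (EReg ri)))
     (XOpp (XMem (EAdd (EMul (EReg rj) (EAdd (EReg rD) (ELit 2))) (EReg ri)))) in
  XMul y y.
Definition std_j : re R := XMem (EAdd (EMul (EReg rj) (EAdd (EReg rD) (ELit 2))) (EReg rD)).
Definition dist_prog : fp R :=
  FFor ri rD (FReal acc_addr (XAdd (XMem acc_addr) sqdiff)).

(** The loop runs to [rT2] under a guard instead of to [rJ]: the learner increments [rJ], and a
    register that is written cannot limit a loop. *)
Definition dup_prog : fp R :=
  FFor rj rT2 (FIf (CNLe (EAdd (EReg rj) (ELit 1)) (EReg rJ))
    (FSeq (FReal acc_addr (XNat (ELit 0))) (FSeq dist_prog
       (FIf (CRLe (XMem acc_addr)
          (XMul (XNat (EMul (ELit 4) (EReg rD))) (XMul std_j std_j)))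
         (FReg rok (ELit 0)) FSkip)))
    FSkip).

(** The factor 4 separates two cases: a cell in the core of the recorded component is at squared
    distance little more than 2 d sigma^2 by a crude triangle inequality, a cell in another core at
    far more than 4 d sigma^2. *)
Definition near_slot (rm : nat -> R) (d J j : nat) : bool :=
  \sum_(i < d) (rm (J * (d + 2) + i)%N - rm (j * (d + 2) + i)%N) ^+ 2 <=
    (4 * d)%:R * rm (j * (d + 2) + d)%N ^+ 2.

Lemma den_dist s (d := rg s rD) (a := (rg s rJ * (d + 2) + (d + 1))%N)
    (s' := den tape dist_prog s) : (rg s rj < rg s rJ)%N ->
  rl s' a = rl s a +
    \sum_(i < d) (rl s (rg s rJ * (d + 2) + i)%N - rl s (rg s rj * (d + 2) + i)%N) ^+ 2 /\
  forall b, b != a -> rl s' b = rl s b.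
Proof.
move=> jJ; rewrite {}/s'.
apply: (@den_for _ tape _ _ _ _ (fun i s' => rl s' a = rl s a +
    \sum_(i' < i) (rl s (rg s rJ * (d + 2) + i')%N - rl s (rg s rj * (d + 2) + i')%N) ^+ 2 /\
    forall b, b != a -> rl s' b = rl s b)
    (fun s' => rl s' a = _ /\ forall b, b != a -> rl s' b = rl s b)).
- by rewrite big_ord0 addr0.
- move=> i s' hi [fr _ _] [h1 h2].
  have c1 : rg s' rD = d by rewrite fr.
  have c2 : rg s' rJ = rg s rJ by rewrite fr.
  have c3 : rg s' rj = rg s rj by rewrite fr.
  rewrite /= ?updE /= c1 c2 c3 -/a; split.
    rewrite ?updE eqxx h1 big_ord_recr /= -expr2 addrA; congr (_ + (_ - _) ^+ 2); apply: h2.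
      by rewrite eqn_add2l; move: hi; rewrite -/d; lia.
    have : (rg s rj * (d + 2) + (d + 2) <= rg s rJ * (d + 2))%N.
      by rewrite addnC -mulSn leq_mul2r jJ orbT.
    by move: hi; rewrite /a -/d; lia.
  by move=> b ba; rewrite ?updE (negbTE ba) h2.
- by move=> s' _ [h1 h2].
Qed.

Lemma den_dup s (d := rg s rD) (J := rg s rJ) (s' := den tape dup_prog s) :
  (J <= rg s rT2)%N ->
  rg s' rok = (if \big[andb/true]_(j < J) ~~ near_slot (rl s) d J j then rg s rok else 0%N) /\
  forall b, b != (J * (d + 2) + (d + 1))%N -> rl s' b = rl s b.
Proof.
move=> hJ; rewrite {}/s'; set a := (_ + _)%N.
apply: (@den_for _ tape _ _ _ _ (fun i s' => rg s' rok =
   (if \big[andb/true]_(j < minn i J) ~~ near_slot (rl s) d J j then rg s rok else 0%N) /\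
   forall b, b != a -> rl s' b = rl s b)
    (fun s' => rg s' rok = _ /\ forall b, b != a -> rl s' b = rl s b)).
- by rewrite min0n big_ord0.
- move=> i s' hi [fr _ _] [h1 h2]; rewrite den_if.
  have c1 : rg s' rD = d by rewrite fr.
  have c2 : rg s' rJ = J by rewrite fr.
  have -> : bev (setr s' rj i) (CNLe (EAdd (EReg rj) (ELit 1)) (EReg rJ)) = (i < J)%N.
    by rewrite /= ?updE /= c2 addn1.
  have [iJ|iJ] := ltnP i J; last first.
    rewrite /= ?updE /= h1; split => //; congr (if _ then _ else _).
    by rewrite (minn_idPr (leqW iJ)) (minn_idPr iJ).
  rewrite !den_seq; set s1 := den tape (FReal _ _) _.
  have e1 : rg s1 rD = d by rewrite /= ?updE.
  have e2 : rg s1 rJ = J by rewrite /= ?updE.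
  have e3 : rg s1 rj = i by rewrite /= ?updE.
  have := @den_dist s1; rewrite e1 e2 e3 -/a => /(_ iJ) [g1 g2].
  have [fr1 _ _] := frame_den tape dist_prog s1.
  have a1 : rl s1 a = 0 by rewrite /= ?updE /= c1 c2 eqxx.
  have a2 b : b != a -> rl s1 b = rl s b.
    by move=> ba; rewrite /= ?updE /= c1 c2 (negbTE ba) h2.
  have sumE : rl (den tape dist_prog s1) a =
      \sum_(i' < d) (rl s (J * (d + 2) + i')%N - rl s (i * (d + 2) + i')%N) ^+ 2.
    rewrite g1 a1 add0r; apply: eq_bigr => i' _; congr ((_ - _) ^+ 2); apply: a2.
      by rewrite eqn_add2l; have := ltn_ord i'; lia.
    have : (i * (d + 2) + (d + 2) <= J * (d + 2))%N.
      by rewrite addnC -mulSn leq_mul2r iJ orbT.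
    by have := ltn_ord i'; rewrite /a; lia.
  have stdE : rl (den tape dist_prog s1) (i * (d + 2) + d)%N = rl s (i * (d + 2) + d)%N.
    have ia : (i * (d + 2) + d)%N != a.
      have : (i * (d + 2) + (d + 2) <= J * (d + 2))%N.
        by rewrite addnC -mulSn leq_mul2r iJ orbT.
      by rewrite /a; lia.
    by rewrite g2 // a2.
  rewrite -[den tape dist_prog _]/(den tape dist_prog s1).
  set s2 := den tape dist_prog s1 in g1 g2 fr1 sumE stdE *.
  have k1 : rg s2 rD = d by rewrite fr1.
  have k2 : rg s2 rJ = J by rewrite fr1.
  have k3 : rg s2 rj = i by rewrite fr1.
  have k4 : rg s2 rok = rg s' rok by rewrite fr1 //= ?updE.
  clearbody s2; rewrite /=.
  rewrite k1 k2 k3 -/a sumE stdE -expr2 -/(near_slot _ _ _ _).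
  have -> : minn i.+1 J = (minn i J).+1 by rewrite (minn_idPl iJ) (minn_idPl (ltnW iJ)).
  rewrite big_ord_recr /= (minn_idPl (ltnW iJ)).
  have h1' := h1; rewrite (minn_idPl (ltnW iJ)) in h1'.
  case: ifP => nr /=.
    by rewrite ?updE /= andbF; split => // b ba; rewrite g2 // a2.
  by rewrite k4 h1' andbT; split => // b ba; rewrite g2 // a2.
- move=> s' _ [h1 h2]; rewrite /= ?updE /= h1 (minn_idPr hJ) //.
Qed.

Definition srch_cond F g c : bool :=
  ((F (g + c) * F (g - c))%N%:R : R) <= E2 * (F g * F g)%N%:R.

(* For a profile f of width s, f(x + c) f(x - c) = exp(-2 pi c^2/s^2) f(x)^2, so
   with E2 = exp(-2 pi) the search stops at c = s. *)
Definition srch (B : nat) F g : nat :=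
  iteri B (fun t c => if srch_cond F g (B - t) then (B - t)%N else c) 0%N.

Definition search_prog : fp R :=
  FSeq (FReg rs (ELit 0))
  (FFor rt rB (FSeq (FReg rc (ESub (EReg rB) (EReg rt)))
    (FIf (CRLe (XNat (EMul (EHeap (EAdd (EReg rg_) (EReg rc))) (EHeap (ESub (EReg rg_) (EReg rc)))))
               (XMul (XLit E2) (XNat (EMul (EHeap (EReg rg_)) (EHeap (EReg rg_))))))
      (FReg rs (EReg rc)) FSkip))).

Lemma den_search s : rg (den tape search_prog s) rs = srch (rg s rB) (hp s) (rg s rg_).
Proof.
rewrite /search_prog den_seq den_reg.
apply: (@den_for _ tape _ _ _ _ (fun i s' => rg s' rs =
  iteri i (fun t c => if srch_cond (hp s) (rg s rg_) (rg s rB - t) then (rg s rB - t)%N else c) 0%N)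
  (fun s' => rg s' rs = _)) => //.
move=> i s' hi [fr fh _] h1.
have c1 : rg s' rB = rg s rB by rewrite fr.
have c2 : rg s' rg_ = rg s rg_ by rewrite fr.
have c3 : hp s' = hp s by rewrite fh.
rewrite /= ?updE /= ?updE /= c1 c2 c3 -/(srch_cond _ _ _).
by case: ifP => _; rewrite /= ?updE /= ?c1.
Qed.

Definition move_step F (c w x : nat) : nat :=
  if (F (x - c * w) < F (x + c * w))%N then (x + w)%N
  else if (F (x + c * w) < F (x - c * w))%N then (x - w)%N else x.

(** B unit steps cross the whole grid in a coordinate, so that no stopping test is needed. *)
Definition refine (d B : nat) F (c g : nat) : nat :=
  iteri d (fun i x => iteri B (fun _ x => move_step F c (B ^ i) x) x) g.

Definition step_prog : fp R :=
  let hi_ := EHeap (EAdd (EReg rx) (EMul (EReg rs) (EReg rpw))) in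
  let lo_ := EHeap (ESub (EReg rx) (EMul (EReg rs) (EReg rpw))) in
  FIf (CNot (CNLe hi_ lo_)) (FReg rx (EAdd (EReg rx) (EReg rpw)))
   (FIf (CNot (CNLe lo_ hi_)) (FReg rx (ESub (EReg rx) (EReg rpw))) FSkip).

Definition refine_prog : fp R :=
  FSeq (FReg rx (EReg rg_)) (FSeq (FReg rpw (ELit 1))
  (FFor ri rD (FSeq (FFor rt rB step_prog) (FReg rpw (EMul (EReg rpw) (EReg rB)))))).

Lemma den_refine s : rg (den tape refine_prog s) rx =
  refine (rg s rD) (rg s rB) (hp s) (rg s rs) (rg s rg_).
Proof.
rewrite /refine_prog !den_seq !den_reg.
apply: (@den_for _ tape _ _ _ _ (fun i s' => rg s' rx =
   iteri i (fun i x => iteri (rg s rB) (fun _ x => move_step (hp s) (rg s rs) (rg s rB ^ i) x) x) (rg s rg_)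
   /\ rg s' rpw = (rg s rB ^ i)%N)
  (fun s' => rg s' rx = _)) => //.
- move=> i s' hi [fr fh _] [h1 h2].
  have c1 : rg s' rB = rg s rB by rewrite fr.
  have c2 : rg s' rs = rg s rs by rewrite fr.
  have c3 : hp s' = hp s by rewrite fh.
  rewrite den_seq den_reg.
  suff H : rg (den tape (FFor rt rB step_prog) (setr s' ri i)) rx =
      iteri (rg s rB) (fun _ x => move_step (hp s) (rg s rs) (rg s rB ^ i) x) (rg s' rx).
    have [fr1 _ _] := frame_den tape (FFor rt rB step_prog) (setr s' ri i).
    set s2 := den tape (FFor rt rB step_prog) _ in H fr1 *; clearbody s2.
    by rewrite /= ?updE /= H h1 !fr1 //= ?updE /= h2 c1 expnS mulnC.
  apply: (@den_for _ tape _ _ _ _ (fun k s3 => rg s3 rx = iteri k (fun _ x => move_step (hp s) (rg s rs) (rg s rB ^ i) x) (rg s' rx))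
     (fun s3 => rg s3 rx = _)) => //.
  + move=> k s2 hk [gr gh _] e.
    have d1 : rg s2 rs = rg s rs by rewrite gr //= ?updE.
    have d2 : rg s2 rpw = (rg s rB ^ i)%N by rewrite gr //= ?updE.
    have d3 : hp s2 = hp s by rewrite gh.
    rewrite /= ?updE /= d1 d2 d3 -!ltnNge e.
    set y := iteri _ _ _; rewrite [RHS]/move_step.
    by case: ifP => _ /=; [|case: ifP => _ /=]; rewrite ?updE /= ?e ?d2.
  + by move=> s3 _ h; move: h; rewrite /= ?updE /= => ->; rewrite fr.
- by move=> s' _ [h _]; rewrite /= ?updE /= h.
Qed.

Definition pass_test : be R :=
  CAnd (CNLe (EAdd (EMul (EReg racc) (EReg rQ)) (EHeap (EReg rg_)))
             (EMul (EMul (EMul (ELit 2) (EReg rD)) (EHeap (EReg rg_))) (EReg rQ)))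
       (CNLe (EReg rN) (EMul (EHeap (EReg rg_)) (EReg rFL))).

(** The height of the profile at the mean is about w h^d/sigma^d with h = 1/M, and sigma is about c
    h; the estimate of w is therefore the frequency of the refined cell times c^d. *)
Definition accept_prog : fp R :=
  FSeq search_prog (FSeq refine_prog (FSeq (FReg rr (EReg rx)) (FSeq decode_prog
  (FSeq (FReal (slot (EReg rD)) (XMul (XNat (EReg rs)) invM))
  (FSeq (FReg racc (ELit 1))
  (FSeq (FFor ri rD (FReg racc (EMul (EReg racc) (EReg rs))))
  (FSeq (FReal acc_addr (XMul (XNat (EMul (EHeap (EReg rx)) (EReg racc))) (XInv (XNat (EReg rN)))))
        (FReg rJ (EAdd (EReg rJ) (ELit 1)))))))))).

Definition candidate_prog : fp R :=
  FSeq (FReg rok (ELit 1))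
  (FSeq (FReg rr (EReg rg_)) (FSeq decode_prog (FSeq lap_prog
  (FSeq (FIf pass_test FSkip (FReg rok (ELit 0)))
  (FSeq dup_prog
  (FIf (CNLe (ELit 1) (EReg rok)) accept_prog FSkip)))))).

(* The second condition asks for a discrete Laplacian of at most -F(g)/Q, the
   third one for a fraction at least 1/FL of the samples. *)
Definition passes (d B Q FL N : nat) F g : bool :=
  [&& \big[andb/true]_(i < d) interior B (digit B g i),
      (lapsum d B F g * Q + F g <= 2 * d * F g * Q)%N & (N <= F g * FL)%N].

(** The registers left alone while a candidate is treated, up to the final increment of [rJ].
    Membership in this list turns the side conditions on writes into finite computations. *)
Definition keep : seq nat := [:: 0; 2; 3; 4; 5; 8; 9; 10; 17]%N.

Lemma den_accept s (d := rg s rD) (B := rg s rB) (a0 := (rg s rJ * (d + 2))%N)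
    (c := srch B (hp s) (rg s rg_)) (x := refine d B (hp s) c (rg s rg_))
    (s' := den tape accept_prog s) : (0 < B)%N -> (x < rg s rT2)%N ->
  [/\ rg s' rJ = (rg s rJ).+1,
      forall i, (i < d)%N -> rl s' (a0 + i)%N = center (rg s rM) (digit B x i),
      rl s' (a0 + d)%N = c%:R / (rg s rM)%:R,
      rl s' (a0 + (d + 1))%N = (hp s x * c ^ d)%:R / (rg s rN)%:R &
      forall a, (a < a0)%N -> rl s' a = rl s a].
Proof.
move=> hB hx.
rewrite {}/s' /accept_prog 8!den_seq.
have := den_search s; have := frame_den tape search_prog s.
set s1 := den tape search_prog s => -[fr1 fh1 fl1] e1; clearbody s1.
have := den_refine s1; have := frame_den tape refine_prog s1.
set s2 := den tape refine_prog s1 => -[fr2 fh2 fl2] e2; clearbody s2.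
have {}e2 : rg s2 rx = x by rewrite e2 e1 fh1 // !fr1.
set s3 := den tape (FReg _ _) s2.
have := @den_decode s3.
have e3 : rg s3 rr = x by rewrite /s3 /= ?updE /= e2.
have k3 r : r \in rok :: keep -> rg s3 r = rg s r.
  move=> hr; have n3 : r != rr by move: r hr; apply/allP.
  rewrite /s3 /= ?updE (negbTE n3) fr2; last by move: r hr {n3}; apply/allP.
  by rewrite fr1 //; move: r hr {n3}; apply/allP.
rewrite e3 !k3 // -/B -/d -/a0 => /(_ hx hB) [_ g1 g2].
have := frame_den tape decode_prog s3.
set s4 := den tape decode_prog s3 in g1 g2 * => -[fr4 fh4 _].
have hp4 : hp s4 = hp s by rewrite fh4 // /s3 /= fh2 // fh1.
have rs4 : rg s4 rs = c by rewrite fr4 // /s3 /= ?updE /= fr2 // e1.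
have rx4 : rg s4 rx = x by rewrite fr4 // /s3 /= ?updE /= e2.
have k4 r : r \in keep -> rg s4 r = rg s r.
  by move=> hr; rewrite fr4 ?k3 // ?inE ?hr ?orbT //; move: r hr; apply/allP.
have l4 a : (a < a0)%N || (a0 + d <= a)%N -> rl s4 a = rl s a.
  by move=> ha; rewrite g2 // /s3 /= fl2 // fl1.
clearbody s4; set s5 := den tape (FReal _ _) s4; set s6 := den tape (FReg _ _) s5.
have p6 : rg (den tape (FFor ri rD (FReg racc (EMul (EReg racc) (EReg rs)))) s6) racc = (c ^ d)%N.
  apply: (@den_for _ tape _ _ _ _ (fun i s7 => rg s7 racc = (c ^ i)%N) (fun s7 => rg s7 racc = _)).
  - by rewrite /= ?updE.
  - move=> i s7 hi [fr7 _ _] h.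
    have e7 : rg s7 rs = c by rewrite fr7 //= ?updE /= rs4.
    by rewrite /= ?updE /= h e7 expnS mulnC.
  - by move=> s7 _ h; move: h; rewrite /= ?updE /= k4.
have := frame_den tape (FFor ri rD (FReg racc (EMul (EReg racc) (EReg rs)))) s6.
set s7 := den tape (FFor _ _ _) s6 in p6 * => -[fr7 fh7 fl7].
have k7 r : r \in rx :: rs :: keep -> rg s7 r = rg s4 r.
  move=> hr; have n1 : r != racc by move: r hr; apply/allP.
  rewrite fr7; first by rewrite /= ?updE (negbTE n1).
  by move: r hr {n1}; apply/allP.
have h7 : hp s7 = hp s by rewrite fh7.
have l7 : rl s7 = upd (rl s4) (a0 + d)%N (c%:R / (rg s rM)%:R).
  by rewrite fl7 //= rs4 !k4.
clearbody s7; rewrite /= p6 h7 !k7 // rx4 !k4 // l7 -/d -/a0 ?updE /=; split.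
- by rewrite addn1.
- move=> i hi; rewrite ?updE !eqn_add2l; case: eqP => [|_]; first by lia.
  by case: eqP => [|_]; [lia|exact: g1].
- by rewrite ?updE !eqn_add2l eqxx; case: eqP => //; lia.
- by rewrite ?updE eqxx.
- move=> a ha; rewrite ?updE; case: eqP => [|_]; first by lia.
  by case: eqP => [|_]; [lia|apply: l4; rewrite ha].
Qed.

Definition consts : seq nat := [:: 0; 2; 3; 4; 5; 8; 9]%N.

(** [rm] is the real memory with the centre of the candidate in the free slot. The bound on [x] is
    asked for accepted candidates only, since from an arbitrary cell the refinement could leave the
    grid. *)
Lemma den_candidate s (d := rg s rD) (B := rg s rB) (J := rg s rJ) (F := hp s)
    (g := rg s rg_) (c := srch B F g) (x := refine d B F c g) (a0 := (J * (d + 2))%N)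
    (rm := fun a => if (a0 <= a < a0 + d)%N then center (rg s rM) (digit B g (a - a0)) else rl s a)
    (acc := passes d B (rg s rQ) (rg s rFL) (rg s rN) F g &&
        \big[andb/true]_(j < J) ~~ near_slot rm d J j)
    (s' := den tape candidate_prog s) :
  (0 < B)%N -> (g < rg s rT2)%N -> (J <= rg s rT2)%N -> (acc -> (x < rg s rT2)%N) ->
  [/\ hp s' = hp s, forall r, r \in consts -> rg s' r = rg s r,
      rg s' rJ = (if acc then J.+1 else J),
      forall a, (a < a0)%N -> rl s' a = rl s a &
      acc -> [/\ forall i, (i < d)%N -> rl s' (a0 + i)%N = center (rg s rM) (digit B x i),
      rl s' (a0 + d)%N = c%:R / (rg s rM)%:R &
      rl s' (a0 + (d + 1))%N = (F x * c ^ d)%:R / (rg s rN)%:R]].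
Proof.
move=> hB hg hJ hx.
have := frame_den tape candidate_prog s; rewrite -/s' => -[fr fh _].
suff [h1 h2 h3] : [/\ rg s' rJ = (if acc then J.+1 else J),
      forall a, (a < a0)%N -> rl s' a = rl s a &
      acc -> [/\ forall i, (i < d)%N -> rl s' (a0 + i)%N = center (rg s rM) (digit B x i),
      rl s' (a0 + d)%N = c%:R / (rg s rM)%:R &
      rl s' (a0 + (d + 1))%N = (F x * c ^ d)%:R / (rg s rN)%:R]].
  by split=> //; [rewrite fh|move=> r hr; apply: fr; move: r hr; apply/allP].
clear fr fh; rewrite {}/s' /candidate_prog 6!den_seq.
set s2 := den tape (FReg rr _) _.
have k2 r : r \in keep -> rg s2 r = rg s r.
  move=> hr; have n1 : r != rr by move: r hr; apply/allP.
  have n2 : r != rok by move: r hr {n1}; apply/allP.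
  by rewrite /= ?updE (negbTE n1) (negbTE n2).
have e2 : rg s2 rr = g by [].
have e2' : rg s2 rok = 1%N by [].
have h2 : hp s2 = F by [].
have l2 : rl s2 = rl s by [].
clearbody s2.
have := den_decode (s := s2); have := frame_den tape decode_prog s2.
rewrite e2 e2' !k2 // -/d -/B -/J -/a0; set s3 := den tape decode_prog s2.
move=> -[fr3 fh3 _] /(_ hg hB) [ok3 l3 l3'].
have k3 r : r \in keep -> rg s3 r = rg s r.
  by move=> hr; rewrite fr3 ?k2 //; move: r hr; apply/allP.
have h3 : hp s3 = F by rewrite fh3.
clearbody s3.
have := frame_den tape lap_prog s3; have := den_lap s3.
set s4 := den tape lap_prog s3; rewrite !k3 // h3 -/d -/B -/g => acc4 [fr4 fh4 fl4].
have k4 r : r \in keep -> rg s4 r = rg s r.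
  by move=> hr; rewrite fr4 ?k3 //; move: r hr; apply/allP.
have h4 : hp s4 = F by rewrite fh4.
have l4 : rl s4 = rl s3 by rewrite fl4.
have ok4 : rg s4 rok = rg s3 rok by rewrite fr4.
clearbody s4; set s5 := den tape (FIf pass_test _ _) s4.
have : s5 = setr s4 rok (if passes d B (rg s rQ) (rg s rFL) (rg s rN) F g then 1%N else 0%N).
  have -> : s5 = if bev s4 pass_test then s4 else setr s4 rok 0 by [].
  have -> : bev s4 pass_test = (lapsum d B F g * rg s rQ + F g <= 2 * d * F g * rg s rQ)%N && (rg s rN <= F g * rg s rFL)%N.
    by rewrite /= acc4 !k4 // h4.
  have ok4' : rg s4 rok = if \big[andb/true]_(i < d) interior B (digit B g i) then 1%N else 0%N.
    by rewrite ok4.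
  rewrite /passes; case: (\big[andb/true]_(i < d) _) ok4' => /= ok4'; case: ifP => _ //;
    case: s4 ok4' {acc4 fr4 fh4 fl4 k4 h4 l4 ok4 s5} => rg4 hp4 rl4 ps4 /= ok4';
    congr FState; apply: funext => r; rewrite ?updE; case: (r =P rok) => // ->; by rewrite ok4'.
move=> s5E; clearbody s5.
have k5 r : r \in keep -> rg s5 r = rg s r.
  move=> hr; rewrite s5E /= ?updE k4 //; case: eqP => // e.
  by move: hr; rewrite e.
have h5 : hp s5 = F by rewrite s5E.
have l5 a : (a < a0 + d)%N -> rl s5 a = rm a.
  move=> ha; rewrite s5E /= l4 /rm ha andbT; case: leqP => ha0.
    by rewrite -{1}(subnKC ha0) l3 // ltn_subLR.
  by rewrite l3' ?ha0 // l2.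
have ok5 : rg s5 rok = if passes d B (rg s rQ) (rg s rFL) (rg s rN) F g then 1%N else 0%N.
  by rewrite s5E /= ?updE.
clear s5E.
have := den_dup (s := s5); have := frame_den tape dup_prog s5.
set s6 := den tape dup_prog s5; rewrite (k5 rD) // (k5 rJ) // (k5 rT2) // -/d -/J => -[fr6 fh6 _] /(_ hJ) [ok6 l6].
have k6 r : r \in keep -> rg s6 r = rg s r.
  by move=> hr; rewrite fr6 ?k5 //; move: r hr; apply/allP.
have h6 : hp s6 = F by rewrite fh6.
clearbody s6.
have accE : rg s6 rok = if acc then 1%N else 0%N.
  have nearE : \big[andb/true]_(j < J) ~~ near_slot (rl s5) d J j =
      \big[andb/true]_(j < J) ~~ near_slot rm d J j.
    apply: eq_bigr => j _; congr (~~ (_ <= _ * _ ^+ 2)).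
      apply: eq_bigr => i _; congr ((_ - _) ^+ 2); apply: l5.
        by rewrite /a0 ltn_add2l.
      have : (j * (d + 2) + (d + 2) <= J * (d + 2))%N.
        by rewrite addnC -mulSn leq_mul2r ltn_ord orbT.
      by have := ltn_ord i; rewrite /a0; lia.
    apply: l5; have : (j * (d + 2) + (d + 2) <= J * (d + 2))%N.
      by rewrite addnC -mulSn leq_mul2r ltn_ord orbT.
    by rewrite /a0; lia.
  by rewrite ok6 ok5 nearE /acc; case: passes; case: (\big[andb/true]_(j < J) _).
have l6' a : (a < a0)%N -> rl s6 a = rl s a.
  move=> ha; rewrite l6; last by rewrite /a0 in ha; lia.
  by rewrite l5; [rewrite /rm leqNgt ha|rewrite ltn_addr].
rewrite den_if; set b := bev _ _.
have {b} -> : b = acc by rewrite /b /= accE; case: (acc).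
case: ifP => ha; last by split=> //; rewrite k6.
have := @den_accept s6; rewrite !k6 // h6 -/d -/B -/g -/c -/x -/J => /(_ hB (hx ha)).
case=> g1 g2 g3 g4 g5; split => //.
by move=> a ha0; rewrite g5 // l6'.
Qed.

Definition learn_prog : fp R := FSeq (FReg rJ (ELit 0)) (FFor rg_ rT2 candidate_prog).

(** Values left of the grid get the default 0 and values right of it get B - 1, so the counts of
    these two extreme digits carry no usable information. *)
Definition digit_of (B M : nat) (y : R) : nat :=
  iteri B (fun t c => if t%:R * M%:R^-1 - M%:R * 2^-1 <= y then t else c) 0%N.

Definition bin_prog : fp R :=
  FSeq (FReg rc (ELit 0))
  (FFor rt rB (FIf (CRLe (XAdd (XMul (XNat (EReg rt)) invM) shiftM) (XMem (ELit 2)))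
    (FReg rc (EReg rt)) FSkip)).

Lemma den_bin s : rg (den tape bin_prog s) rc = digit_of (rg s rB) (rg s rM) (rl s 2%N).
Proof.
rewrite /bin_prog den_seq den_reg.
apply: (@den_for _ tape _ _ _ _ (fun i s' => rg s' rc = digit_of i (rg s rM) (rl s 2%N))
  (fun s' => rg s' rc = _)) => //.
move=> i s' hi [fr _ fl] h.
have e1 : rg s' rM = rg s rM by rewrite fr.
have e2 : rl s' = rl s by rewrite fl.
rewrite /= ?updE /= e1 e2; case: ifP => _; rewrite /= ?updE //=.
Qed.

Definition sample_body : fp R :=
  FSeq (FReg ridx (ELit 0)) (FSeq (FReg rpw (ELit 1))
  (FSeq (FFor ri rD (FSeq (FRead (ELit 2)) (FSeq bin_prog
     (FSeq (FReg ridx (EAdd (EReg ridx) (EMul (EReg rc) (EReg rpw))))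
           (FReg rpw (EMul (EReg rpw) (EReg rB)))))))
  (FHeap (EReg ridx) (EAdd (EHeap (EReg ridx)) (ELit 1))))).

Definition cell_index (d B M n : nat) : nat :=
  (\sum_(i < d) digit_of B M (tape (n * d + i)) * B ^ i)%N.

Lemma den_sample s n (d := rg s rD) (s' := den tape sample_body s)
    (z := cell_index d (rg s rB) (rg s rM) n) :
  ps s = (n * d)%N ->
  ps s' = (n.+1 * d)%N /\ hp s' = upd (hp s) z (hp s z).+1.
Proof.
move=> hps; rewrite {}/s' /sample_body 3!den_seq 2!den_reg.
set s1 := setr _ _ _; set P := FFor _ _ _.
have [h1 h2] : ps (den tape P s1) = (n * d + d)%N /\ rg (den tape P s1) ridx = z.
  apply: (@den_for _ tape _ _ _ _ (fun i s' => [/\ ps s' = (n * d + i)%N,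
     rg s' ridx = (\sum_(j < i) digit_of (rg s rB) (rg s rM) (tape (n * d + j)) * rg s rB ^ j)%N &
     rg s' rpw = (rg s rB ^ i)%N])
    (fun s' => ps s' = _ /\ rg s' ridx = z)).
  - by rewrite /= ?updE /= big_ord0 addn0.
  - move=> i s2 hi [fr _ _] [e1 e2 e3].
    have d1 : rg s2 rB = rg s rB by rewrite fr //= ?updE.
    have d2 : rg s2 rM = rg s rM by rewrite fr //= ?updE.
    rewrite 3!den_seq; set s3 := den tape (FRead _) _.
    have := den_bin s3; have := frame_den tape bin_prog s3; have := den_ps tape s3 (p := bin_prog) isT.
    set s4 := den tape bin_prog s3 => p4 [fr4 _ _].
    have -> : rg s3 rB = rg s rB by rewrite /= ?updE.
    have -> : rg s3 rM = rg s rM by rewrite /= ?updE.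
    have -> : rl s3 2%N = tape (n * d + i)%N by rewrite /= ?updE /= e1.
    move=> c4.
    have f1 : rg s4 rB = rg s rB by rewrite fr4 //= ?updE.
    have f2 : rg s4 ridx = rg s2 ridx by rewrite fr4 //= ?updE.
    have f3 : rg s4 rpw = rg s2 rpw by rewrite fr4 //= ?updE.
    have f4 : ps s4 = (ps s2).+1 by rewrite p4.
    clearbody s4; rewrite /= ?updE /= ?updE /= f1 f2 f3 f4 e1 e2 e3 c4 addnS; split => //.
      by rewrite big_ord_recr.
    by rewrite expnS mulnC.
  - by move=> s2 _ [-> e2 _]; rewrite /= ?updE /= e2; split.
have := frame_den tape P s1; set s2 := den tape P s1 in h1 h2 * => -[_ fh _].
have h3 : hp s2 = hp s by rewrite fh.
by clearbody s2; rewrite /= h1 h2 h3 addn1 mulSn addnC.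
Qed.

Definition sample_prog : fp R := FFor rg_ rN sample_body.

Lemma den_samples s (N := rg s rN) (d := rg s rD) (B := rg s rB) (M := rg s rM)
    (s' := den tape sample_prog s) :
  ps s = 0%N -> (forall a, hp s a = 0%N) ->
  forall g, hp s' g = (\sum_(n < N) (cell_index d B M n == g))%N.
Proof.
move=> hps hh; rewrite {}/s'.
apply: (@den_for _ tape _ _ _ _ (fun i s' => ps s' = (i * d)%N /\
    forall g, hp s' g = (\sum_(n < i) (cell_index d B M n == g))%N)
    (fun s' => forall g, hp s' g = _)).
- by split => [|g]; rewrite ?hps ?mul0n // big_ord0 hh.
- move=> n s2 hn [fr _ _] [h1 h2].
  have e1 : rg s2 rD = d by rewrite fr.
  have e2 : rg s2 rB = B by rewrite fr.
  have e3 : rg s2 rM = M by rewrite fr.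
  have := @den_sample (setr s2 rg_ n) n.
  have -> : rg (setr s2 rg_ n) rD = d by rewrite -e1.
  have -> : rg (setr s2 rg_ n) rB = B by rewrite -e2.
  have -> : rg (setr s2 rg_ n) rM = M by rewrite -e3.
  move=> /(_ h1) [-> ->]; split => // g.
  rewrite updE big_ord_recr /= h2 eq_sym; case: eqP => [->|_]; last by rewrite addn0 h2.
  by rewrite addn1.
- by move=> s2 _ [_ h2].
Qed.

End Learner.

(** * Computation of the constants, the complete program and its running time *)

Section Prelude.
Variable R : realType.
Variables (K0 : nat) (E2 : R).
Implicit Types (st : state R) (s : fstate R).

(** Without conversion from reals to naturals, integers above [rho] and 1/[w0] can only be found by
    counting up to a comparison. These are the only while loops that do not come from a counting
    loop. *)
Definition count_up (r : nat) (test : bexp R) : prog R :=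
  Seq (NSet R (NLit r) (NLit 0))
    (While (BNot test) (NSet R (NLit r) (NAdd (NMem (NLit r)) (NLit 1)))).

Lemma count_up_exec tape r test st (a : pred nat) n :
  (forall m, beval (State (upd (nmem st) r m) (rmem st) (pos st)) test = a m) ->
  a n -> (forall m, (m < n)%N -> ~~ a m) ->
  exec tape (count_up r test) st (1 + (n * 2 + 1))
    (State (upd (nmem st) r n) (rmem st) (pos st)).
Proof.
move=> ha an hn; apply: exec_seq; first exact: exec_nset.
rewrite [neval _ (NLit r)]/= [neval _ (NLit 0)]/=.
have : forall m i, (m + i = n)%N -> exec tape
  (While (BNot test) (NSet R (NLit r) (NAdd (NMem (NLit r)) (NLit 1))))
  (State (upd (nmem st) r i) (rmem st) (pos st)) (m * 2 + 1)
  (State (upd (nmem st) r n) (rmem st) (pos st)).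
  elim=> [|m ih] i him.
    by rewrite -him add0n; apply: exec_while_false; rewrite /= ha -[i]add0n him an.
  have -> : (m.+1 * 2 + 1)%N = (1 + (m * 2 + 1)).+1 by lia.
  have := ih i.+1; rewrite addnS -addSn => /(_ him) h.
  apply: (exec_while_true _ _ h); first by rewrite /= ha hn //; lia.
  have -> : upd (nmem st) r i.+1 = upd (upd (nmem st) r i) r (i + 1)%N.
    by apply: funext => j; rewrite !updE; case: eqP => // _; rewrite addn1.
  have := exec_nset tape (NLit r) (NAdd (NMem (NLit r)) (NLit 1))
    (State (upd (nmem st) r i) (rmem st) (pos st)).
  by rewrite /= !updE eqxx.
by move=> /(_ n 0%N); apply; rewrite addn0.
Qed.

Definition epow (e : ne) (n : nat) : ne := iter n (EMul e) (ELit 1).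

Arguments epow : simpl never.

Lemma nev_epow s e n : nev s (epow e n) = (nev s e ^ n)%N.
Proof. by elim: n => //= n; rewrite /epow /= -/(epow e n) => ->; rewrite expnS. Qed.

(* Registers: 25 holds the integer bound on [rho], 26 the power of [K0], 6 the
   number [T]; the others are the constants of the main program. *)
Definition const_prog : fp R :=
  FSeq (FReg 26 (ELit 1))
  (FSeq (FFor 11 0 (FReg 26 (EMul (EReg 26) (ELit K0))))
  (FSeq (FReg 5 (epow (EMul (EMul (EReg 25) (EReg 0)) (EReg 26)) 20))
  (FSeq (FReg 6 (ELit 1))
  (FSeq (FFor 11 0 (FReg 6 (EMul (EReg 6) (EReg 5))))
  (FSeq (FReg 2 (epow (EReg 5) 2))
  (FSeq (FReg 4 (epow (EReg 6) 2))
  (FSeq (FReg 8 (EMul (EMul (EReg 7) (epow (EReg 6) 2)) (EReg 5)))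
  (FSeq (FReg 9 (epow (EReg 5) 3))
        (FReg 3 (EMul (epow (EReg 7) 3) (epow (EReg 6) 20))))))))))).

Lemma den_const tape s (d := rg s 0%N) (nR := rg s 25%N) (nW := rg s 7%N)
    (M := ((nR * d * K0 ^ d) ^ 20)%N) (s' := den tape const_prog s) :
  [/\ rg s' 0%N = d, rg s' 2%N = (M ^ 2)%N, rg s' 3%N = (nW ^ 3 * (M ^ d) ^ 20)%N,
      rg s' 4%N = ((M ^ d) ^ 2)%N & rg s' 5%N = M] /\
  [/\ rg s' 8%N = (nW * (M ^ d) ^ 2 * M)%N, rg s' 9%N = (M ^ 3)%N,
      hp s' = hp s, rl s' = rl s & ps s' = ps s].
Proof.
rewrite {}/s' /const_prog 9!den_seq.
set s1 := den tape (FReg 26 _) s.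
set P2 := FFor 11 0 (FReg 26 _); set s2 := den tape P2 s1.
have e2 : rg s2 26%N = (K0 ^ d)%N.
  apply: (@den_for _ tape _ _ _ _ (fun i s' => rg s' 26%N = (K0 ^ i)%N) (fun s' => rg s' 26%N = _)) => //.
    by move=> i s' hi _ h; rewrite /= ?updE /= h expnS mulnC.
have := frame_den tape P2 s1; have := den_ps tape s1 (p := P2) isT.
rewrite -/s2 => p2 [fr2 fh2 fl2].
have k0 : rg s2 0%N = d by rewrite fr2 // /s1 den_reg /= ?updE.
have k7 : rg s2 7%N = nW by rewrite fr2 // /s1 den_reg /= ?updE.
have k25 : rg s2 25%N = nR by rewrite fr2 // /s1 den_reg /= ?updE.
have h2 : hp s2 = hp s by rewrite fh2.
have l2 : rl s2 = rl s by rewrite fl2.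
have {p2} p2 : ps s2 = ps s by rewrite p2.
clearbody s2; clear fr2 fh2 fl2.
set s3 := den tape (FReg 5 _) s2.
have e3 : s3 = setr s2 5%N M by rewrite /s3 den_reg nev_epow /= k0 k25 e2.
set s4 := den tape (FReg 6 _) s3.
have [d4 m4 w4] : [/\ rg s4 0%N = d, rg s4 5%N = M & rg s4 7%N = nW].
  by rewrite /s4 e3 den_reg /= ?updE /=.
have o4 : rg s4 6%N = 1%N by [].
have [h4 l4 p4] : [/\ hp s4 = hp s, rl s4 = rl s & ps s4 = ps s].
  by rewrite /s4 e3 den_reg /= ?updE /=.
clearbody s4.
set P5 := FFor 11 0 (FReg 6 _); set s5 := den tape P5 s4.
have e5 : rg s5 6%N = (M ^ d)%N.
  apply: (@den_for _ tape _ _ _ _ (fun i s' => rg s' 6%N = (M ^ i)%N) (fun s' => rg s' 6%N = _)) => //.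
    move=> i s' hi [fr _ _] h; have m5 : rg s' 5%N = M by rewrite fr.
    by rewrite /= ?updE /= h m5 expnS mulnC.
  by move=> s' _ h; rewrite /= ?updE /= h d4.
have := frame_den tape P5 s4; have := den_ps tape s4 (p := P5) isT.
rewrite -/s5 => p5 [fr5 fh5 fl5].
have m0 : rg s5 0%N = d by rewrite fr5.
have m5 : rg s5 5%N = M by rewrite fr5.
have m7 : rg s5 7%N = nW by rewrite fr5.
have h5 : hp s5 = hp s by rewrite fh5.
have l5 : rl s5 = rl s by rewrite fl5.
have {p5} p5 : ps s5 = ps s by rewrite p5.
clearbody s5.
have -> : den tape (FReg 2 (epow (EReg 5) 2)) s5 = setr s5 2%N (M ^ 2)%N.
  by rewrite den_reg nev_epow -m5.
have -> : forall v, den tape (FReg 4 (epow (EReg 6) 2)) (setr s5 2%N v) =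
    setr (setr s5 2%N v) 4%N ((M ^ d) ^ 2)%N.
  by move=> v; rewrite den_reg nev_epow -e5.
set s6 := setr (setr s5 _ _) _ _.
have q5 : rg s6 5%N = M by rewrite -m5.
have q6 : rg s6 6%N = (M ^ d)%N by rewrite -e5.
have q7 : rg s6 7%N = nW by rewrite -m7.
have q0 : rg s6 0%N = d by rewrite -m0.
have q2 : rg s6 2%N = (M ^ 2)%N by [].
have q4 : rg s6 4%N = ((M ^ d) ^ 2)%N by [].
have [r1 r2 r3] : [/\ hp s6 = hp s, rl s6 = rl s & ps s6 = ps s] by [].
clearbody s6.
set s7 := den tape (FReg 8 _) s6.
have {s7} -> : s7 = setr s6 8%N (nW * (M ^ d) ^ 2 * M)%N.
  rewrite /s7 den_reg; congr setr.
  have -> : forall a b c, nev s6 (EMul (EMul a b) c) = (nev s6 a * nev s6 b * nev s6 c)%N by [].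
  by rewrite nev_epow -q7 -q6 -q5.
set s7 := setr s6 _ _.
have -> : den tape (FReg 9 (epow (EReg 5) 3)) s7 = setr s7 9%N (M ^ 3)%N.
  by rewrite den_reg nev_epow -q5.
set s8 := setr s7 _ _; set s9 := den tape _ s8.
have {s9} -> : s9 = setr s8 3%N (nW ^ 3 * (M ^ d) ^ 20)%N.
  rewrite /s9 den_reg; congr setr.
  have -> : forall a b, nev s8 (EMul a b) = (nev s8 a * nev s8 b)%N by [].
  by rewrite !nev_epow -q7 -q6.
by split; split; [exact: q0|exact: q2|by []|exact: q4|exact: q5|by []|by []|exact: r1|exact: r2|exact: r3].
Qed.

Definition main_prog : fp R := FSeq (sample_prog R) (learn_prog E2).

(** [const_prog] is compiled apart from [main_prog] because it writes the registers 2, 3 and 4,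
    which limit the loops of the latter. *)
Definition learner : prog R :=
  Seq (count_up 25 (BRLe (RMem R (NLit 0)) (ROfNat R (NMem (NLit 25)))))
  (Seq (count_up 7 (BRLe (RLit 1) (RMul (ROfNat R (NMem (NLit 7))) (RMem R (NLit 1)))))
  (Seq (compile const_prog) (compile main_prog))).

(** One power of N bounds the whole time, since N dominates all loop limits as well as nR and nW,
    the lengths of the two counting phases. [A] and [D] are fixed before the inputs and the tape. *)
Lemma learner_exec : exists A D, forall tape d k (rho w0 : R) nR nW
    (M := ((nR * d * K0 ^ d) ^ 20)%N) (N := (nW ^ 3 * (M ^ d) ^ 20)%N),
  (0 < d)%N -> (0 < K0)%N -> (0 < nR)%N -> (0 < nW)%N ->
  rho <= nR%:R -> (forall m, (m < nR)%N -> m%:R < rho) ->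
  1 <= nW%:R * w0 -> (forall m, (m < nW)%N -> m%:R * w0 < 1) ->
  exists t st s1, [/\ exec tape learner (init_state d k rho w0) t st,
    (t <= A * N ^ D)%N, rmem st = rl (den tape main_prog s1) &
    [/\ [/\ rg s1 0%N = d, rg s1 2%N = (M ^ 2)%N, rg s1 3%N = N,
      rg s1 4%N = ((M ^ d) ^ 2)%N & rg s1 5%N = M],
      rg s1 8%N = (nW * (M ^ d) ^ 2 * M)%N, rg s1 9%N = (M ^ 3)%N,
      (forall a, hp s1 a = 0%N) & ps s1 = 0%N]].
Proof.
have [A1 [D1 c1]] := cost_poly const_prog.
have [A2 [D2 c2]] := cost_poly main_prog.
exists (A1 + A2 + 10)%N, (D1 + D2).+1 => tape d k rho w0 nR nW M N d0 K0' nR0 nW0 hR hRm hW hWm.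
set st0 := init_state d k rho w0.
have x1 := @count_up_exec tape 25 (BRLe (RMem R (NLit 0)) (ROfNat R (NMem (NLit 25)))) st0
  (fun m => rho <= m%:R) nR (fun m => erefl _) hR.
have {}x1 := x1 (fun m hm => ltac:(rewrite -ltNge; exact: hRm)).
set st1 := State _ _ _ in x1.
have x2 := @count_up_exec tape 7 (BRLe (RLit 1) (RMul (ROfNat R (NMem (NLit 7))) (RMem R (NLit 1)))) st1
  (fun m => 1 <= m%:R * w0) nW (fun m => erefl _) hW.
have {}x2 := x2 (fun m hm => ltac:(rewrite -ltNge; exact: hWm)).
set st2 := State _ _ _ in x2.
(* The machine state read as a state of the loop language; its heap is zero, as only addresses below
   [nregs] have been written so far. *)
pose s0 := FState (nmem st2) (fun a => nmem st2 (nregs + a)%N) (rmem st2) (pos st2).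
have sim0 : sim s0 st2 by split.
have [t3 [st3 [x3 l3 sim3]]] := compile_exec tape (L := d) (p := const_prog) isT sim0
  ltac:(by move=> r; rewrite !inE => /orP[/eqP ->|/eqP ->]).
set s1 := den tape const_prog s0 in sim3.
have [[q0 q2 q3 q4 q5] [q8 q9 h1 l1 p1]] := den_const tape s0.
have a0 : rg s0 0%N = d by [].
have a25 : rg s0 25%N = nR by [].
have a7 : rg s0 7%N = nW by [].
rewrite -/s1 a0 a25 a7 -/M in q0 q2 q3 q4 q5 q8 q9 h1 l1 p1.
have M0 : (0 < M)%N by rewrite expn_gt0 !muln_gt0 nR0 d0 expn_gt0 K0'.
have Md0 : (0 < M ^ d)%N by rewrite expn_gt0 M0.
have N0 : (0 < N)%N by rewrite /N muln_gt0 expn_gt0 nW0 /= expn_gt0 Md0.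
have MdN : ((M ^ d) ^ 20 <= N)%N by rewrite leq_pmull // expn_gt0 nW0.
have le1 : (M <= M ^ d)%N by rewrite -{1}(expn1 M) leq_pexp2l.
have leE a b : (0 < a <= b)%N -> ((M ^ d) ^ a <= (M ^ d) ^ b)%N by move=> /andP[_ ?]; exact: leq_pexp2l.
have T2N : ((M ^ d) ^ 2 <= N)%N by apply: leq_trans MdN; exact: leE.
have BN : (M ^ 2 <= N)%N by apply: leq_trans T2N; rewrite leq_exp2r.
have nRM : (nR * d * K0 ^ d <= M)%N.
  by rewrite -{1}(expn1 (_ * _ * _)) leq_pexp2l // !muln_gt0 nR0 d0 expn_gt0 K0'.
have [nRN dN] : (nR <= M)%N /\ (d <= M)%N.
  have K1 : (0 < K0 ^ d)%N by rewrite expn_gt0 K0'.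
  by split; apply: leq_trans nRM; [rewrite -mulnA leq_pmulr // muln_gt0 d0 K1|rewrite (mulnC nR) -mulnA leq_pmulr // muln_gt0 nR0 K1].
have MN : (M <= N)%N by apply: leq_trans BN; rewrite leq_pmulr // muln1.
have nWN : (nW <= N)%N.
  apply: (@leq_trans (nW ^ 3)); last by rewrite leq_pmulr // expn_gt0 Md0.
  by rewrite (expnS nW 2) leq_pmulr // expn_gt0 nW0.
have [t4 [st4 [x4 l4 sim4]]] := compile_exec tape (L := N) (p := main_prog) isT sim3
  ltac:(by move=> r hr; split; [move: r hr; apply/allP|
    have : r \in [:: 3; 0; 2; 4]%N by [move: r hr; apply/allP];
    rewrite !inE => /or4P[] /eqP ->; rewrite ?q0 ?q2 ?q3 ?q4 //; apply: leq_trans MN]).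
eexists _, st4, s1; split.
- apply: exec_seq x1 _; apply: exec_seq x2 _; exact: exec_seq x3 x4.
- have f1 : (t3 <= A1 * d ^ D1)%N by apply: leq_trans l3 _; exact: c1.
  have f2 : (t4 <= A2 * N ^ D2)%N by apply: leq_trans l4 _; exact: c2.
  have ND a : (a <= D1 + D2)%N -> (N ^ a <= N ^ (D1 + D2).+1)%N by move=> ?; apply: leq_pexp2l => //; lia.
  have f3 : (d ^ D1 <= N ^ (D1 + D2).+1)%N.
    by apply: leq_trans (ND D1 _); [case: D1 {c1 f1 ND} => // D; rewrite leq_exp2r // (leq_trans dN)|lia].
  have f4 := ND D2 (leq_addl _ _).
  have f5 : (N <= N ^ (D1 + D2).+1)%N by rewrite expnS leq_pmulr // expn_gt0 N0.
  have f6 : (A1 * d ^ D1 <= A1 * N ^ (D1 + D2).+1)%N by rewrite leq_mul2l f3 orbT.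
  have f7 : (A2 * N ^ D2 <= A2 * N ^ (D1 + D2).+1)%N by rewrite leq_mul2l f4 orbT.
  rewrite !mulnDl; move: (N ^ _)%N f5 f6 f7 => X f5 f6 f7.
  have g1 : (nR <= X)%N by apply: leq_trans nRN _; apply: leq_trans MN f5.
  have g2 := leq_trans nWN f5; have g3 := leq_trans N0 f5.
  have g4 := leq_trans f1 f6; have g5 := leq_trans f2 f7.
  clear -g1 g2 g3 g4 g5; lia.
- by case: sim4.
- by split => // a; rewrite h1 /s0 /st2 /st1 /st0.
Qed.

End Prelude.

(** * Probabilities of grid cells and concentration of the histogram *)

Section SigmaFinite.
Context {d} {T : measurableType d} {R : realType}.
Variables (mu : {measure set T -> \bar R}) (h : sigma_finite setT mu).

(** A named copy of [mu], on which the sigma-finiteness given as a hypothesis can be declared as an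
    instance. *)
Definition sigma_finite_copy : set T -> \bar R := mu.

HB.instance Definition _ := Measure.on sigma_finite_copy.
HB.instance Definition _ := Measure_isSigmaFinite.Build _ _ _ sigma_finite_copy h.

Lemma sigma_finite_measureP :
  exists nu : {sigma_finite_measure set T -> \bar R}, mu = nu :> (set T -> \bar R).
Proof. by exists sigma_finite_copy. Qed.

End SigmaFinite.

(** * Integrals of products over boxes of R^d *)

Section LebesgueTuple.
Variable R : realType.

Definition cons_tuple n (p : R * n.-tuple R) : n.+1.-tuple R := [tuple of p.1 :: p.2].

Lemma measurable_cons_tuple n : measurable_fun setT (@cons_tuple n).
Proof. exact: measurable_cons. Qed.

Lemma measurable_box n (A : 'I_n -> set R) : (forall i, measurable (A i)) ->
  measurable [set x : n.-tuple R | forall i, A i (tnth x i)].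
Proof.
move=> mA; rewrite (_ : [set x | _] = \bigcap_(i in [set: 'I_n]) ((fun x => tnth x i) @^-1` A i)).
  apply: fin_bigcap_measurable => // i _.
  by rewrite -[X in measurable X]setTI; apply: measurable_tnth.
apply/seteqP; split => [x h i _|x h i]; [exact: (h i)|exact: (h i I)].
Qed.

Lemma sigma_finite_lebesgue_tuple d : sigma_finite setT (@lebesgue_tuple R d).
Proof.
exists (fun n => [set x | forall i, `[- n%:R, n%:R]%classic (tnth x i)]).
  apply/esym/seteqP; split => // x _.
  exists (Num.truncn (\sum_(i < d) `|tnth x i|)).+1 => //= i.
  rewrite in_itv /= -ler_norml.
  apply: (@le_trans _ _ (\sum_(i < d) `|tnth x i|)).
    by rewrite (bigD1 i) //= lerDl sumr_ge0.
  by apply/ltW/truncnS_gt.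
move=> n; split; first by apply: (measurable_box (A := fun=> `[- n%:R, n%:R]%classic)).
rewrite (lebesgue_tuple_box (A := fun=> `[- n%:R, n%:R]%classic)) //.
rewrite (eq_bigr (fun=> (n%:R + n%:R)%:E)); last first.
  move=> i _; rewrite lebesgue_measure_itv /= lte_fin.
  case: ltP => [_|]; first by rewrite -EFinB opprK.
  by have := ler0n R n => h1 h2; congr EFin; lra.
by rewrite prodEFin ltry.
Qed.

(** [lebesgue_tuple] is a bare set function; this equation rewrites statements about it into
    statements about a bundled measure, to which Tonelli's theorem applies. *)
Lemma lebesgue_tuple_measureP d :
  exists nu : {sigma_finite_measure set (d.-tuple R) -> \bar R},
    @lebesgue_tuple R d = nu :> (set (d.-tuple R) -> \bar R).
Proof.
elim: d => [|d [nu e]].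
  have [nu e] := sigma_finite_measureP (mu := dirac ([tuple] : 0.-tuple R) : {measure set (0.-tuple R) -> \bar R})
    (sigma_finite_lebesgue_tuple 0).
  by exists nu; rewrite -e.
pose m := pushforward (product_measure1 (@lebesgue_measure R) nu) (@cons_tuple d).
have e' : @lebesgue_tuple R d.+1 = m by rewrite /= e.
pose mm : {measure set (d.+1.-tuple R) -> \bar R} :=
  measure_function_pushforward__canonical__measure_function_Measure (product_measure1 (@lebesgue_measure R) nu) (@measurable_cons_tuple d).
have h := sigma_finite_lebesgue_tuple d.+1; rewrite e' in h.
have [nu' e2] := sigma_finite_measureP (mu := mm) h.
by exists nu'; rewrite e' -e2.
Qed.

Lemma measurable_prod_tnth d (g : 'I_d -> R -> R) :
  (forall i, measurable_fun setT (g i)) ->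
  measurable_fun setT (fun x : d.-tuple R => \prod_(i < d) g i (tnth x i)).
Proof.
move=> mg; apply: measurable_prod => i _.
by apply: measurableT_comp => //; exact: measurable_tnth.
Qed.

Lemma integral_lebesgue_tuple_prod d (g : 'I_d -> R -> R) :
  (forall i, measurable_fun setT (g i)) -> (forall i x, 0 <= g i x) ->
  (\int[@lebesgue_tuple R d]_x (\prod_(i < d) g i (tnth x i))%:E =
   \prod_(i < d) \int[@lebesgue_measure R]_y (g i y)%:E)%E.
Proof.
elim: d g => [|d ih] g mg g0.
  rewrite big_ord0 (eq_integral (cst 1%E)); last by move=> x _; rewrite big_ord0.
  rewrite /= integral_cst //.
  by rewrite mul1e /= diracT.
have [nu e] := lebesgue_tuple_measureP d.
have mF := @measurable_prod_tnth d.+1 g mg.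
rewrite big_ord_recl -(ih (fun i => g (lift ord0 i))) //= e.
have -> : pushforward (product_measure1 (@lebesgue_measure R) nu)
   (fun p : R * d.-tuple R => [tuple of p.1 :: p.2]) =
   pushforward (product_measure1 (@lebesgue_measure R) nu) (@cons_tuple d) by [].
rewrite ge0_integral_pushforward //=; last 3 first.
- exact: measurable_cons_tuple.
- exact/measurable_EFinP.
- by move=> y _; rewrite lee_fin prodr_ge0.
rewrite preimage_setT fubini_tonelli1 //=; last 2 first.
- by apply/measurable_EFinP; exact: (measurableT_comp mF (@measurable_cons_tuple d)).
- by move=> x; rewrite lee_fin prodr_ge0.
rewrite /fubini_F /=.
transitivity (\int[@lebesgue_measure R]_x ((g ord0 x)%:E * \int[nu]_y (\prod_(i < d) g (lift ord0 i) (tnth y i))%:E)%E)%E.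
  apply: eq_integral => x _.
  rewrite -ge0_integralZl //=; last 3 first.
  - by apply/measurable_EFinP; exact: (@measurable_prod_tnth d (fun i => g (lift ord0 i)) (fun i => mg _)).
  - by move=> y _; rewrite lee_fin prodr_ge0.
  - by rewrite lee_fin.
  apply: eq_integral => y _; rewrite -EFinM big_ord_recl; congr ((_ * _)%:E).
  by apply: eq_bigr => i _; rewrite tnthS.
rewrite ge0_integralZr //=.
- by apply/measurable_EFinP; apply: mg.
- by move=> x _; rewrite lee_fin.
- by apply: integral_ge0 => y _; rewrite lee_fin prodr_ge0.
Qed.

Lemma integral_box_prod d (A : 'I_d -> set R) (f : 'I_d -> R -> R) :
  (forall i, measurable (A i)) ->
  (forall i, measurable_fun setT (f i)) -> (forall i x, 0 <= f i x) ->
  (\int[@lebesgue_tuple R d]_(x in [set x | forall i, A i (tnth x i)])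
     (\prod_(i < d) f i (tnth x i))%:E =
   \prod_(i < d) \int[@lebesgue_measure R]_(y in A i) (f i y)%:E)%E.
Proof.
move=> mA mf f0.
have [nu e] := lebesgue_tuple_measureP d; rewrite e integral_mkcond /=.
transitivity (\int[nu]_x (\prod_(i < d) (f i (tnth x i) * \1_(A i) (tnth x i)))%:E)%E.
  apply: eq_integral => x _; rewrite patchE; case: ifPn => [|/negP] hx.
    congr EFin; apply: eq_bigr => i _.
    by rewrite indicE mem_set ?mulr1 //; move: hx; rewrite inE; apply.
  have : ~ forall i, A i (tnth x i) by move=> h; apply: hx; rewrite inE.
  move=> /existsNP[i Ai]; rewrite (bigD1 i) //= indicE memNset //.
  by rewrite mulr0 mul0r.
rewrite -e (@integral_lebesgue_tuple_prod d (fun i y => f i y * \1_(A i) y)).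
- apply: eq_bigr => i _; rewrite [RHS]integral_mkcond; apply: eq_integral => y _.
  by rewrite patchE indicE; case: ifP => _; rewrite ?mulr1 ?mulr0.
- by move=> i; apply: measurable_funM => //; apply: measurable_indic.
- by move=> i x; rewrite mulr_ge0.
Qed.

End LebesgueTuple.

(** * One-dimensional Gaussians, masses of intervals and of boxes *)

Section Gauss.
Variable R : realType.
Implicit Types (a b h m s y : R) (f : R -> R).

Definition gauss1 m s y : R := s^-1 * expR (- pi * (y - m) ^+ 2 / s ^+ 2).

Lemma gauss1_ge0 m s y : 0 < s -> 0 <= gauss1 m s y.
Proof. by move=> s0; rewrite mulr_ge0 ?expR_ge0 // invr_ge0 ltW. Qed.

Lemma gauss1_le m s y : 0 < s -> gauss1 m s y <= s^-1.
Proof.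
move=> s0; rewrite -[leRHS]mulr1 ler_pM2l ?invr_gt0 // expR_le1.
rewrite -mulrA mulNr oppr_le0 mulr_ge0 ?pi_ge0 // mulr_ge0 ?sqr_ge0 //.
by rewrite invr_ge0 sqr_ge0.
Qed.

Lemma measurable_gauss1 m s : measurable_fun setT (gauss1 m s).
Proof.
apply: measurable_funM => //; apply: measurableT_comp => //.
apply: measurable_funM => //; apply: measurable_funM => //.
by apply: measurable_funX; apply: measurable_funB.
Qed.

Definition imass f a b : R :=
  fine (\int[@lebesgue_measure R]_(y in `[a, b[) (f y)%:E)%E.

Lemma lebesgue_measure_shift h (A : set R) : measurable A ->
  pushforward (@lebesgue_measure R) ((fun y => y + h) : _ -> measurableTypeR R) A =
  lebesgue_measure A.
Proof.
have mh : measurable_fun setT ((fun y => y + h) : R -> measurableTypeR R).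
  by apply: measurable_funD.
move=> mA; apply/esym.
apply: (lebesgue_measure_unique (mu := pushforward (@lebesgue_measure R) ((fun y => y + h) : _ -> measurableTypeR R))) => //.
move=> _ [[a b]] _ <-; rewrite /pushforward /=.
transitivity (@lebesgue_measure R `]a - h, b - h]%classic); last first.
  by congr lebesgue_measure; apply/seteqP; split => y /=; rewrite !in_itv /=; lra.
rewrite !lebesgue_measure_itv /= !lte_fin; congr (if _ then _ else _).
  by rewrite ltrD2r.
by rewrite -!EFinB; congr EFin; lra.
Qed.

Lemma integral_shift h a b (f : R -> R) : measurable_fun setT f -> (forall y, 0 <= f y) ->
  (\int[@lebesgue_measure R]_(y in `[(a + h)%R, (b + h)%R[) (f y)%:E =
   \int[@lebesgue_measure R]_(y in `[a, b[) (f (y + h))%:E)%E.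
Proof.
move=> mf f0.
pose phi : measurableTypeR R -> measurableTypeR R := fun y => y + h.
have mh : measurable_fun setT phi by apply: measurable_funD.
transitivity (\int[pushforward (@lebesgue_measure R) phi]_(y in `[(a + h)%R, (b + h)%R[) (f y)%:E)%E.
  by apply: eq_measure_integral => //= B mB _; exact/esym/lebesgue_measure_shift.
rewrite ge0_integral_pushforward //=.
- by congr integral; apply/seteqP; split => y /=; rewrite !in_itv /= /phi; lra.
- by apply/measurable_EFinP; apply: measurable_funTS.
- by move=> y _; rewrite lee_fin.
Qed.

Section Mass.
Variables (f : R -> R) (K : R).
Hypotheses (mf : measurable_fun setT f) (f0 : forall y, 0 <= f y) (fK : forall y, f y <= K).

Let mfE D : measurable_fun D (EFin \o f).
Proof. by apply/measurable_EFinP; apply: measurable_funTS. Qed.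

Lemma integral_cst_itv a b k : a <= b ->
  (\int[@lebesgue_measure R]_(y in `[a, b[) k%:E = (k * (b - a))%:E)%E.
Proof.
move=> ab; rewrite integral_cst //= lebesgue_measure_itv /= lte_fin EFinM.
case: ltP => [_|ba]; first by rewrite -EFinB.
by have -> : b = a; [lra|rewrite subrr].
Qed.

Lemma imassE a b : a <= b ->
  (\int[@lebesgue_measure R]_(y in `[a, b[) (f y)%:E = (imass f a b)%:E)%E.
Proof.
move=> ab; rewrite /imass fineK // ge0_fin_numE; last first.
  by apply: integral_ge0 => y _; rewrite lee_fin.
apply: (@le_lt_trans _ _ (K * (b - a))%:E); last by rewrite ltry.
rewrite -integral_cst_itv //; apply: ge0_le_integral => //=.
- by move=> y _; rewrite lee_fin.
- exact: mfE.
- by move=> y _; rewrite lee_fin.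
Qed.

Lemma imass_le a b k : a <= b -> (forall y, a <= y < b -> f y <= k) ->
  imass f a b <= k * (b - a).
Proof.
(* On an empty interval [h] does not force [k] to be nonnegative. *)
move=> ab h; have [<-|ne] := eqVneq a b.
  by rewrite /imass set_itvco0 ?integral_set0 //= subrr mulr0.
have k0 : 0 <= k by apply: le_trans (f0 a) (h a _); rewrite lexx lt_neqAle ne.
rewrite -lee_fin -imassE // -integral_cst_itv //; apply: ge0_le_integral => //=.
all: try exact: mfE.
all: try by move=> y _; rewrite lee_fin.
all: by move=> y; rewrite in_itv /= lee_fin; exact: h.
Qed.

Lemma imass_ge a b k : a <= b -> 0 <= k -> (forall y, a <= y < b -> k <= f y) ->
  k * (b - a) <= imass f a b.
Proof.
move=> ab k0 h.
rewrite -lee_fin -imassE // -integral_cst_itv //; apply: ge0_le_integral => //=.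
all: try exact: mfE.
all: by move=> y; rewrite in_itv /= lee_fin; exact: h.
Qed.

(** A pointwise inequality for second differences passes to masses, because translating the interval
    amounts to translating the function. *)
Lemma imass_lap a b h k : a <= b -> 0 <= k ->
  (forall y, a <= y < b -> k * f y <= f (y + h) + f (y - h)) ->
  k * imass f a b <= imass f (a + h) (b + h) + imass f (a - h) (b - h).
Proof.
move=> ab k0 H; rewrite -lee_fin EFinM EFinD -!imassE ?lerD2r //.
rewrite !integral_shift //.
have mh c : measurable_fun `[a, b[%classic (fun y => (f (y + c))%:E).
  by apply/measurable_EFinP; apply: measurable_funTS; apply: measurableT_comp => //; apply: measurable_funD.
rewrite -ge0_integralZl //=; last by move=> y _; rewrite lee_fin.
rewrite -ge0_integralD //=.
- apply: ge0_le_integral => //=.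
  all: try exact: emeasurable_funD.
  all: try (apply: measurable_funeM; exact: mfE).
  all: try by move=> y _; rewrite -EFinM lee_fin mulr_ge0.
  all: try by move=> y; rewrite in_itv /= -EFinM -EFinD lee_fin; exact: H.
all: try exact: mh.
all: try by apply: emeasurable_funD; exact: mh.
all: try exact: mfE.
all: by move=> y _; rewrite lee_fin.
Qed.

End Mass.

Lemma mixture_pdfE d k (G : mixture R d k) (x : d.-tuple R) :
  mixture_pdf G x = \sum_(j < k) weight G j * \prod_(i < d) gauss1 (mean G j 0 i) (std G j) (tnth x i).
Proof.
apply: eq_bigr => j _; rewrite -mulrA; congr (_ * _).
rewrite big_split /= prodr_const card_ord exprVn; congr (_ * _).
rewrite -expR_sum; congr expR.
rewrite /l2norm sqr_sqrtr; last by apply: sumr_ge0 => i _; rewrite sqr_ge0.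
rewrite mulr_sumr mulr_suml; apply: eq_bigr => i _.
by rewrite !mxE.
Qed.

Lemma integral_mixture_box d k (G : mixture R d k) (a b : 'I_d -> R) :
  (forall i, a i <= b i) ->
  (\int[@lebesgue_tuple R d]_(x in [set x | forall i, (`[a i, b i[)%classic (tnth x i)])
     (mixture_pdf G x)%:E =
   (\sum_(j < k) weight G j *
      \prod_(i < d) imass (gauss1 (mean G j 0 i) (std G j)) (a i) (b i))%:E)%E.
Proof.
move=> ab; have [nu e] := lebesgue_tuple_measureP R d.
set D := [set x | _].
have mD : measurable D by apply: (measurable_box (A := fun i => `[a i, b i[%classic)).
have mp j : measurable_fun setT (fun x : d.-tuple R => \prod_(i < d) gauss1 (mean G j 0 i) (std G j) (tnth x i)).
  by apply: (measurable_prod_tnth (g := fun i => gauss1 (mean G j 0 i) (std G j))) => i; exact: measurable_gauss1.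
have p0 j (x : d.-tuple R) : 0 <= \prod_(i < d) gauss1 (mean G j 0 i) (std G j) (tnth x i).
  by apply: prodr_ge0 => i _; apply: gauss1_ge0; exact: std_gt0.
transitivity (\int[nu]_(x in D) \sum_(j < k) (weight G j)%:E *
   (\prod_(i < d) gauss1 (mean G j 0 i) (std G j) (tnth x i))%:E)%E.
  rewrite e; apply: eq_integral => x _; rewrite mixture_pdfE -sumEFin.
  by apply: eq_bigr => j _; rewrite EFinM.
rewrite ge0_integral_sum //=; last 2 first.
- by move=> j; apply: measurable_funeM; apply/measurable_EFinP; apply: measurable_funTS.
- by move=> j x _; rewrite -EFinM lee_fin mulr_ge0 // ltW // weight_gt0.
rewrite -sumEFin; apply: eq_bigr => j _.
rewrite ge0_integralZl //=; last 3 first.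
- by apply/measurable_EFinP; apply: measurable_funTS.
- by move=> x _; rewrite lee_fin.
- by rewrite lee_fin ltW // weight_gt0.
rewrite EFinM; congr (_ * _)%E; rewrite -e.
rewrite (integral_box_prod (A := fun i => `[a i, b i[%classic)
  (f := fun i => gauss1 (mean G j 0 i) (std G j))) //.
- rewrite -prodEFin; apply: eq_bigr => i _.
  rewrite (imassE (K := (std G j)^-1)) //.
  + exact: measurable_gauss1.
  + by move=> y; apply: gauss1_ge0; exact: std_gt0.
  + by move=> y; apply: gauss1_le; exact: std_gt0.
- by move=> i; exact: measurable_gauss1.
- by move=> i y; apply: gauss1_ge0; exact: std_gt0.
Qed.

End Gauss.

(** * Chebyshev's inequality for the number of hits *)

Section Frequency.
Context {d : measure_display} {T : measurableType d} {R : realType}.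
Variables (P : probability T R) (A : nat -> set T) (p : R).
Hypothesis mA : forall n, measurable (A n).
Hypothesis PA : forall n, P (A n) = p%:E.
Hypothesis PAA : forall n m, n != m -> P (A n `&` A m) = (p ^+ 2)%:E.

Let S (N : nat) (w : T) : R := \sum_(n < N) \1_(A n) w.

Lemma measurable_count N : measurable_fun setT (S N).
Proof. by apply: measurable_sum => n; apply: measurable_indic. Qed.

Let S0 N w : 0 <= S N w.
Proof. by apply: sumr_ge0 => n _; rewrite indicE. Qed.

Let sume_cst N (x : R) : (\sum_(i < N) x%:E = (N%:R * x)%:E)%E.
Proof. by rewrite (sumEFin _ _ (fun=> x)) sumr_const card_ord mulr_natl. Qed.

Let int1 (B : set T) : measurable B -> (\int[P]_w (\1_B w : R)%:E = P B)%E.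
Proof. by move=> mB; rewrite integral_indic ?setIT. Qed.

Lemma integral_count N : (\int[P]_w (S N w)%:E = (N%:R * p)%:E)%E.
Proof.
under eq_integral do rewrite /S -sumEFin.
rewrite ge0_integral_sum //=; last by move=> n; apply/measurable_EFinP; apply: measurable_indic.
rewrite (eq_bigr (fun=> p%:E)); last by move=> n _; rewrite int1.
by rewrite sume_cst.
Qed.

(** Pairwise independence suffices: each diagonal term gives p, the others p^2, and the absent
    diagonal terms p^2 are added for simplicity. *)
Lemma integral_count_sqr N :
  (\int[P]_w (S N w ^+ 2)%:E <= (N%:R * p + N%:R ^+ 2 * p ^+ 2)%:E)%E.
Proof.
have p0 : 0 <= p by rewrite -lee_fin -(PA 0) measure_ge0.
have -> : (\int[P]_w (S N w ^+ 2)%:E =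
    \int[P]_w \sum_(n < N) \sum_(m < N) (\1_(A n `&` A m) w)%:E)%E.
  apply: eq_integral => w _; rewrite expr2 /S mulr_suml -sumEFin.
  apply: eq_bigr => n _; rewrite mulr_sumr -sumEFin; apply: eq_bigr => m _.
  by rewrite indicI.
have mI n m : measurable_fun setT (fun w => (\1_(A n `&` A m) w : R)%:E).
  by apply/measurable_EFinP; apply: measurable_indic; apply: measurableI.
rewrite ge0_integral_sum //=; last 2 first.
- by move=> n; apply: emeasurable_sum => m.
- by move=> n w _; apply: sume_ge0 => m _; rewrite lee_fin indicE.
apply: (@le_trans _ _ (\sum_(n < N) (p + N%:R * p ^+ 2)%:E)%E).
  apply: lee_sum => n _; rewrite ge0_integral_sum //=.
  rewrite (bigD1 n) //= EFinD; apply: leeD.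
    by rewrite int1 ?setIid ?PA //; apply: measurableI.
  apply: (@le_trans _ _ (\sum_(m < N) (p ^+ 2)%:E)%E); last first.
    by rewrite sume_cst.
  rewrite [leRHS](bigD1 n) //=; rewrite -[leLHS]add0e; apply: leeD.
    by rewrite lee_fin sqr_ge0.
  apply: lee_sum => m mn.
  by rewrite int1 ?PAA //; [rewrite eq_sym|apply: measurableI].
rewrite sume_cst lee_fin.
by rewrite mulrDr mulrA expr2.
Qed.

Lemma measurable_deviation N c : measurable [set w | c <= `|S N w - N%:R * p|].
Proof.
have mf : measurable_fun setT (fun w => `|S N w - N%:R * p|).
  apply: measurableT_comp => //; apply: measurable_funB => //; exact: measurable_count.
have := mf measurableT `[c, +oo[%classic (measurable_itv _); rewrite setTI.
by congr measurable; apply/seteqP; split => w /=; rewrite in_itv /= andbT.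
Qed.

(** Integration of c^2 1_B + 2 N p S <= S^2 + (N p)^2, the square expanded and rearranged so that
    both sides are sums of nonnegative functions and no extended-real subtraction occurs. *)
Lemma chebyshev_count N c : 0 < c ->
  ((c ^+ 2)%:E * P [set w | (c <= `|S N w - N%:R * p|)%R] <= (N%:R * p)%:E)%E.
Proof.
move=> c0; have p0 : 0 <= p by rewrite -lee_fin -(PA 0) measure_ge0.
set B := [set w | _]; have mB : measurable B := measurable_deviation N c.
set a : R := 2 * (N%:R * p).
have a0 : 0 <= a by rewrite !mulr_ge0.
have h : (\int[P]_w ((c ^+ 2 * \1_B w)%:E + (a * S N w)%:E) <=
   \int[P]_w ((S N w ^+ 2)%:E + ((N%:R * p) ^+ 2)%:E))%E.
  apply: ge0_le_integral => //=.
  all: try by apply: emeasurable_funD; apply/measurable_EFinP;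
    [apply: measurable_funM => //; apply: measurable_indic|apply: measurable_funM => //; exact: measurable_count].
  all: try by apply: emeasurable_funD => //; apply/measurable_EFinP; apply: measurable_funX; exact: measurable_count.
  - by move=> w _; rewrite -EFinD lee_fin addr_ge0 // mulr_ge0 // ?sqr_ge0 // indicE.
  - move=> w _; rewrite -!EFinD lee_fin.
    have E x : (x - N%:R * p) ^+ 2 = x ^+ 2 - a * x + (N%:R * p) ^+ 2 by rewrite /a; ring.
    suff : c ^+ 2 * \1_B w <= (S N w - N%:R * p) ^+ 2 by rewrite E; lra.
    rewrite indicE; case: (boolP (w \in B)) => [|_]; rewrite ?mulr0 ?sqr_ge0 // mulr1.
    rewrite inE /B /= => hw; rewrite -[leRHS]real_normK ?num_real //.
    by rewrite lerXn2r // ?nnegrE // ltW.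
have m1 : measurable_fun setT (fun w => (c ^+ 2 * \1_B w)%:E).
  by apply/measurable_EFinP; apply: measurable_funM => //; apply: measurable_indic.
have m2 : measurable_fun setT (fun w => (a * S N w)%:E).
  by apply/measurable_EFinP; apply: measurable_funM => //; exact: measurable_count.
have m3 : measurable_fun setT (fun w => (S N w ^+ 2)%:E).
  by apply/measurable_EFinP; apply: measurable_funX; exact: measurable_count.
move: h; rewrite ge0_integralD //=; last 2 first.
- by move=> w _; rewrite lee_fin mulr_ge0 ?sqr_ge0 // indicE.
- by move=> w _; rewrite lee_fin mulr_ge0.
rewrite [X in (_ <= X -> _)%E]ge0_integralD //=; last 2 first.
- by move=> w _; rewrite lee_fin sqr_ge0.
- by move=> w _; rewrite lee_fin sqr_ge0.
rewrite integral_cst //= probability_setT mule1.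
have -> : (\int[P]_w (c ^+ 2 * \1_B w)%:E = (c ^+ 2)%:E * P B)%E.
{ under eq_integral do rewrite EFinM.
  rewrite ge0_integralZl //=; first by rewrite int1.
  all: try by apply/measurable_EFinP; apply: measurable_indic.
  all: try by rewrite lee_fin sqr_ge0.
  all: by move=> w _; rewrite lee_fin indicE. }
have -> : (\int[P]_w (a * S N w)%:E = a%:E * (N%:R * p)%:E)%E.
{ under eq_integral do rewrite EFinM.
  rewrite ge0_integralZl //=; first by rewrite integral_count.
  all: try by apply/measurable_EFinP; exact: measurable_count.
  all: by move=> w _; rewrite lee_fin. }
move=> h.
have PB : P B \is a fin_num by apply: fin_num_measure.
have := le_trans h (leeD2r _ (integral_count_sqr N)).
rewrite -(fineK PB) -!EFinM -!EFinD !lee_fin /a; nra.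
Qed.

End Frequency.

(** * Cells as numbers in base B *)

Section Encoding.
Local Open Scope nat_scope.

Definition enc (B d : nat) (z : 'I_d -> nat) : nat := \sum_(i < d) z i * B ^ i.

Lemma encS B d (z : 'I_d.+1 -> nat) :
  enc B z = z ord0 + enc B (fun i => z (lift ord0 i)) * B.
Proof.
rewrite /enc big_ord_recl /= expn0 muln1 big_distrl /=; congr (_ + _).
by apply: eq_bigr => i _; rewrite /bump /= add1n expnS mulnCA [in RHS]mulnC.
Qed.

Lemma enc_lt B d (z : 'I_d -> nat) : (forall i, z i < B) -> enc B z < B ^ d.
Proof.
elim: d z => [|d ih] z hz; first by rewrite /enc big_ord0.
have := ih _ (fun i => hz (lift ord0 i)); rewrite encS expnS => h1.
apply: (@leq_trans (B + enc B (fun i => z (lift ord0 i)) * B)); first by rewrite ltn_add2r.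
by rewrite -mulSn mulnC leq_mul2l h1 orbT.
Qed.

Lemma digit_enc B d (z : 'I_d -> nat) (i : 'I_d) : (forall i, z i < B) ->
  digit B (enc B z) i = z i.
Proof.
elim: d z i => [z []//|d ih] z i hz; have B0 : 0 < B by apply: leq_ltn_trans (hz i).
rewrite encS /digit; case: (unliftP ord0 i) => [j ->|->].
  rewrite /= /bump /= add1n expnS divnMA [(z _ + _)%N]addnC divnMDl // (divn_small (hz _)) addn0.
  exact: (ih _ j (fun i => hz (lift ord0 i))).
by rewrite expn0 divn1 addnC modnMDl modn_small.
Qed.

Lemma enc_digit B d g : g < B ^ d -> enc B (fun i : 'I_d => digit B g i) = g.
Proof.
elim: d g => [|d ih] g hg; first by rewrite /enc big_ord0; move: hg; rewrite expn0; case: g.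
have B0 : 0 < B by rewrite lt0n; apply/negP => /eqP B0; rewrite B0 exp0n in hg.
rewrite encS /digit expn0 divn1.
have -> : enc B (fun i : 'I_d => g %/ B ^ lift ord0 i %% B) = g %/ B.
  rewrite -[RHS]ih; last by rewrite ltn_divLR // mulnC -expnS.
  by apply: eq_bigr => i _; rewrite /digit /= /bump /= add1n expnS divnMA.
by rewrite addnC -divn_eq.
Qed.

Lemma digit_lt B g i : 0 < B -> digit B g i < B.
Proof. by move=> B0; rewrite ltn_mod. Qed.

Lemma enc_inj B d (z z' : 'I_d -> nat) : (forall i, z i < B) -> (forall i, z' i < B) ->
  enc B z = enc B z' -> z =1 z'.
Proof. by move=> h h' e i; rewrite -(digit_enc i h) e digit_enc. Qed.

Lemma enc_shift B d (z : 'I_d -> nat) (i0 : 'I_d) c :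
  enc B (fun i => if i == i0 then z i + c else z i) = enc B z + c * B ^ i0.
Proof.
rewrite /enc (bigD1 i0) //= [in RHS](bigD1 i0) //= eqxx mulnDl -!addnA; congr (_ + _).
rewrite addnC; congr (_ + _); apply: eq_bigr => i /negbTE ->; by [].
Qed.

End Encoding.

(** * The good event: all frequencies close to the cell probabilities *)

Section GoodEvent.
Variable R : realType.

Definition edge (M t : nat) : R := t%:R * M%:R^-1 - M%:R * 2^-1.

Lemma edge_lt M s t : (0 < M)%N -> (edge M s < edge M t) = (s < t)%N.
Proof. by move=> M0; rewrite /edge ltrD2r ltr_pM2r ?invr_gt0 ?ltr0n // ltr_nat. Qed.

Lemma edge_le M s t : (0 < M)%N -> (edge M s <= edge M t) = (s <= t)%N.
Proof. by move=> M0; rewrite !leNgt edge_lt // -leqNgt. Qed.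

Lemma digit_of_lt B M (y : R) : (0 < B)%N -> (digit_of B M y < B)%N.
Proof.
case: B => // B _; elim: B => [|B ih]; first by rewrite /digit_of /=; case: ifP.
by rewrite /digit_of iteriS; case: ifP => // _; apply: leq_trans ih _.
Qed.

Lemma digit_ofP B M (y : R) c : (0 < M)%N -> (0 < c)%N -> (c.+1 < B)%N ->
  digit_of B M y = c <-> edge M c <= y < edge M c.+1.
Proof.
move=> M0 c0 cB.
pose a t := edge M t <= y.
have a_mono s t : (s <= t)%N -> a t -> a s.
  by move=> st; apply: le_trans; rewrite edge_le.
(* Maximality holds without restriction, but a returned 0 may be the default, so the value is known
   to satisfy [a] only when it is positive. *)
have main n : (forall t, (t < n)%N -> a t -> (t <= digit_of n M y)%N) /\
   ((0 < digit_of n M y)%N -> a (digit_of n M y) /\ (digit_of n M y < n)%N).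
  elim: n => [|n [ih1 ih2]]; first by split.
  rewrite /digit_of iteriS -/(digit_of n M y) -/(edge M n) -/(a n).
  case: ifP => an.
    by split => [t|_]; [rewrite ltnS|].
  split => [t|/ih2 [? ?]]; last by split => //; apply: ltnW.
  rewrite ltnS leq_eqVlt => /orP[/eqP ->|tn] at_; first by rewrite an in at_.
  exact: ih1.
have [h1 h2] := main B; split => [e|/andP[ac ac1]].
  have [] := h2; first by rewrite e.
  rewrite e => ac _; apply/andP; split => //; rewrite ltNge; apply/negP => ac1.
  by have := h1 _ cB ac1; rewrite e ltnn.
have cd := h1 c (ltnW cB) ac.
have [ad _] := h2 (leq_trans c0 cd).
apply/eqP; rewrite eqn_leq cd andbT leqNgt; apply/negP => dc.
by have := a_mono _ _ dc ad; rewrite /a leNgt ac1.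
Qed.

Section Event.
Variables (d k : nat) (G : mixture R d k) (dO : measure_display) (Omega : measurableType dO)
  (P : probability Omega R) (X : nat -> {RV P >-> d.-tuple R}).
Hypothesis iid : iid_samples G X.
Variables (B M N : nat).
Hypotheses (M0 : (0 < M)%N) (N0 : (0 < N)%N).

Definition cell_mass (z : 'I_d -> nat) : R :=
  \sum_(j < k) weight G j *
    \prod_(i < d) imass (gauss1 (mean G j 0 i) (std G j)) (edge M (z i)) (edge M (z i).+1).

Definition inner_cell (z : 'I_d -> nat) : Prop := forall i, (0 < z i)%N && ((z i).+1 < B)%N.

Definition cell (z : 'I_d -> nat) : set (d.-tuple R) :=
  [set x | forall i, (`[edge M (z i), edge M (z i).+1[)%classic (tnth x i)].

Definition count (w : Omega) (g : nat) : nat :=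
  (\sum_(n < N) (cell_index (sample_tape (fun i => X i w)) d B M n == g))%N.

Lemma measurable_cell z : measurable (cell z).
Proof. by apply: (measurable_box (A := fun i => `[edge M (z i), edge M (z i).+1[%classic)). Qed.

Lemma prob_cell n z : P (X n @^-1` cell z) = (cell_mass z)%:E.
Proof.
rewrite iid.2; last exact: measurable_cell.
rewrite (integral_mixture_box G (a := fun i => edge M (z i)) (b := fun i => edge M (z i).+1)) //.
by move=> i; rewrite edge_le.
Qed.

Lemma prob_cell2 n m z : n != m ->
  P (X n @^-1` cell z `&` X m @^-1` cell z) = (cell_mass z ^+ 2)%:E.
Proof.
move=> nm; have := iid.1 [:: n; m] (fun=> cell z).
rewrite /= !inE andbT nm => /(_ isT (fun=> measurable_cell z)).
rewrite !big_cons big_nil mule1 !prob_cell -EFinM expr2 => <-; congr (P _).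
apply/seteqP; split => w /=.
  by move=> [h1 h2] i /=; rewrite !inE => /orP[] /eqP ->.
by move=> h; split; apply: h; rewrite /= !inE eqxx ?orbT.
Qed.

Lemma sample_tapeE w n (i : 'I_d) :
  sample_tape (fun i => X i w) (n * d + i) = tnth (X n w) i.
Proof.
have d0 : (0 < d)%N by apply: leq_ltn_trans (ltn_ord i).
by rewrite /sample_tape divnMDl // divn_small // addn0 modnMDl modn_small // (tnth_nth 0).
Qed.

Lemma countE w z : inner_cell z ->
  (count w (enc B z))%:R = \sum_(n < N) \1_(X n @^-1` cell z) w :> R.
Proof.
move=> hz; rewrite /count natr_sum; apply: eq_bigr => n _.
have zB i : (z i < B)%N by have /andP[_] := hz i; apply: ltnW.
rewrite indicE; congr (nat_of_bool _)%:R.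
have -> : cell_index (sample_tape (fun i => X i w)) d B M n =
    enc B (fun i : 'I_d => digit_of B M (tnth (X n w) i)).
  by apply: eq_bigr => i _; rewrite sample_tapeE.
have dl (i : 'I_d) : (digit_of B M (tnth (X n w) i) < B)%N.
  by apply: digit_of_lt; apply: leq_ltn_trans (zB i).
apply/eqP/idP => [e|].
  rewrite inE /= => i /=; have /andP[h1 h2] := hz i.
  by rewrite in_itv /=; apply/(digit_ofP _ M0 h1 h2); apply: (enc_inj dl zB e).
rewrite inE /= => h; apply: eq_bigr => i _; congr (_ * _)%N.
have /andP[h1 h2] := hz i; apply/(digit_ofP _ M0 h1 h2).
by have := h i; rewrite /= in_itv.
Qed.

(** Chebyshev's inequality at deviation N tau bounds the failure of one cell by 1/(N tau^2), as its
    probability is at most 1; the union bound runs over all B^d cell numbers. *)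
Lemma good_event (tau : R) : 0 < tau ->
  exists E : set Omega, [/\ measurable E,
    ((1 - (B ^ d)%:R / (N%:R * tau ^+ 2))%:E <= P E)%E &
    forall w, E w -> forall z, inner_cell z ->
      `|(count w (enc B z))%:R / N%:R - cell_mass z| <= tau].
Proof.
move=> tau0.
pose bad (z : 'I_d -> nat) : set Omega :=
  [set w | N%:R * tau <= `|\sum_(n < N) \1_(X n @^-1` cell z) w - N%:R * cell_mass z|].
have mX z n : measurable (X n @^-1` cell z).
  by rewrite -[X in measurable X]setTI; apply: (measurable_funPT (X n)) => //; exact: measurable_cell.
have mbad z : measurable (bad z) by exact: (@measurable_deviation _ _ R (fun n => X n @^-1` cell z) (cell_mass z) (mX z) N (N%:R * tau)).
have c0 : 0 < N%:R * tau by rewrite mulr_gt0 // ltr0n.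
have Pbad z : (P (bad z) <= (1 / (N%:R * tau ^+ 2))%:E)%E.
  have := @chebyshev_count _ _ _ P (fun n => X n @^-1` cell z) (cell_mass z)
    (mX z) (fun n => prob_cell n z) (fun n m => @prob_cell2 n m z) N _ c0.
  rewrite -/(bad z).
  have p1 : cell_mass z <= 1 by rewrite -lee_fin -(prob_cell 0) probability_le1.
  have fB : P (bad z) \is a fin_num by apply: fin_num_measure.
  rewrite -(fineK fB) -EFinM !lee_fin => h.
  rewrite ler_pdivlMr ?mulr_gt0 ?exprn_gt0 ?ltr0n //.
  have NR : 0 < N%:R :> R by rewrite ltr0n.
  have : N%:R * (fine (P (bad z)) * (N%:R * tau ^+ 2)) <= N%:R * 1.
    have -> : N%:R * (fine (P (bad z)) * (N%:R * tau ^+ 2)) = (N%:R * tau) ^+ 2 * fine (P (bad z)) by ring.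
    by apply: le_trans h _; rewrite ler_pM2l.
  by rewrite ler_pM2l.
pose A g := bad (fun i : 'I_d => digit B g i).
exists (~` \big[setU/set0]_(g < B ^ d) A g); split.
- by apply: measurableC; apply: bigsetU_measurable => g _; exact: mbad.
- rewrite probability_setC; last by apply: bigsetU_measurable => g _; exact: mbad.
  rewrite EFinB; apply: leeB => //.
  apply: (le_trans (Boole_inequality _ _)) => [g _|]; first exact: mbad.
  apply: (@le_trans _ _ (\sum_(g < B ^ d) (1 / (N%:R * tau ^+ 2))%:E)%E).
    by apply: lee_sum => g _; exact: Pbad.
  by rewrite (sumEFin _ _ (fun=> _)) sumr_const card_ord lee_fin mul1r -[_ *+ _]mulr_natl.
- move=> w hw z hz.
  have zB i : (z i < B)%N by have /andP[_] := hz i; apply: ltnW.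
  have hb : ~ bad z w.
    move=> bw; apply: hw; rewrite -bigcup_mkord; exists (enc B z); first exact: enc_lt.
    rewrite /A (_ : (fun i : 'I_d => _) = z) //.
    by apply: funext => i; rewrite digit_enc.
  have NR : 0 < N%:R :> R by rewrite ltr0n.
  move: hb; rewrite /bad /= -countE // => /negP; rewrite -ltNge => hlt.
  have -> : (count w (enc B z))%:R / N%:R - cell_mass z =
      ((count w (enc B z))%:R - N%:R * cell_mass z) / N%:R.
    by rewrite mulrBl [N%:R * _]mulrC mulfK // gt_eqF.
  by rewrite normrM normfV (gtr0_norm NR) ler_pdivrMr // [tau * _]mulrC ltW.
Qed.

End Event.
End GoodEvent.

(** * Ratios of extrema, geometric sums and the squared separation *)

Section Extrema.
Variables (R : realType) (k : nat) (f : 'I_k -> R).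

Lemma fmax_ge j : f j <= fmax f.
Proof. exact: le_bigmax. Qed.

Lemma fmin_le j : fmin f <= f j.
Proof. exact: bigmin_le. Qed.

Lemma fmin_gt0 : (0 < k)%N -> (forall j, 0 < f j) -> 0 < fmin f.
Proof.
move=> k0 f0; apply/bigmin_gtP; split => // .
exact: lt_le_trans (f0 (Ordinal k0)) (fmax_ge _).
Qed.

Lemma fratio_ge i j : (0 < k)%N -> (forall j, 0 < f j) -> f i <= fmax f / fmin f * f j.
Proof.
move=> k0 f0; have m0 := fmin_gt0 k0 f0.
rewrite mulrAC ler_pdivlMr //; apply: ler_pM; rewrite ?fmax_ge ?fmin_le //; exact: ltW.
Qed.

Lemma fratio_ge1 : (0 < k)%N -> (forall j, 0 < f j) -> 1 <= fmax f / fmin f.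
Proof.
move=> k0 f0; have m0 := fmin_gt0 k0 f0.
by rewrite ler_pdivlMr // mul1r (le_trans (fmin_le (Ordinal k0))) // fmax_ge.
Qed.

End Extrema.

Section SumInj.
Variable R : realType.

Lemma sum_inj_le (I : finType) (A : pred I) (J : finType) (h : I -> J) (F : J -> R) :
  {in A &, injective h} -> (forall y, 0 <= F y) ->
  \sum_(i | A i) F (h i) <= \sum_y F y.
Proof.
move=> hinj F0; rewrite -(big_imset F (A := A) (h := h)) //=.
by rewrite [leRHS](bigID (mem (h @: A))) /= lerDl sumr_ge0.
Qed.

Lemma geometric_half_le n : \sum_(m < n) (2^-1 : R) ^+ m <= 2.
Proof.
suff -> : \sum_(m < n) (2^-1 : R) ^+ m = 2 - 2 * (2^-1) ^+ n.
  have : 0 <= (2^-1 : R) ^+ n by rewrite exprn_ge0 // invr_ge0 ler0n.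
  by move=> ?; lra.
elim: n => [|n ih]; first by rewrite big_ord0 expr0; lra.
by rewrite big_ord_recr /= ih exprS; field.
Qed.

Lemma expR_ge_pow2 (x : R) n : n%:R <= x -> 2 ^+ n <= expR x.
Proof.
move=> h; apply: le_trans (_ : expR (n%:R) <= _); last by rewrite ler_expR.
rewrite -[n%:R]mulr1 expRM_natl lerXn2r ?nnegrE ?expR_ge0 //.
by apply: le_trans (expR_ge1Dx 1); lra.
Qed.

Lemma sep_absurd (D s s' t e : R) : 0 < e -> 0 < t -> t <= s -> t <= s' ->
  D <= e * (8 * t) ^+ 2 -> 64 * e * (s + s') ^+ 2 <= D -> False.
Proof.
move=> e0 t0 ts ts' h1 h2.
have h3 : (2 * t) ^+ 2 <= (s + s') ^+ 2 by rewrite lerXn2r ?nnegrE; lra.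
have h4 : e * (2 * t) ^+ 2 <= e * (s + s') ^+ 2 by rewrite ler_pM2l.
have : 0 < e * t ^+ 2 by rewrite mulr_gt0 // exprn_gt0.
move: h1 h2 h4; rewrite !exprMn; lra.
Qed.

Lemma sep_sqr (c d L l sd si sj D : R) : 0 <= c -> 0 <= l -> 0 <= sd ->
  0 < si -> 0 < sj -> sd ^+ 2 = d -> l ^+ 2 = L ->
  4 * c * (sd + l) * (si + sj) <= D ->
  16 * c ^+ 2 * (d + L) * (si + sj) ^+ 2 <= D ^+ 2.
Proof.
move=> hc hl hsd hi hj <- <- h.
have sl : 0 <= sd + l by lra.
have lhs0 : 0 <= 4 * c * (sd + l) * (si + sj).
  apply: mulr_ge0; last lra.
  by apply: mulr_ge0; lra.
apply: le_trans (_ : (4 * c * (sd + l) * (si + sj)) ^+ 2 <= _); last first.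
  by rewrite lerXn2r // nnegrE // (le_trans lhs0).
have -> : (4 * c * (sd + l) * (si + sj)) ^+ 2 =
   16 * c ^+ 2 * (sd ^+ 2 + l ^+ 2) * (si + sj) ^+ 2 + 32 * (c * (si + sj)) ^+ 2 * (sd * l) by ring.
have p1 : 0 <= (c * (si + sj)) ^+ 2 by apply: sqr_ge0.
have p2 : 0 <= sd * l by apply: mulr_ge0.
by rewrite lerDl mulr_ge0 // mulr_ge0.
Qed.

End SumInj.

(** * Negligibility of the other components near a mean *)

Section Domination.
Variables (R : realType) (d k : nat) (G : mixture R d k) (c0 : R).
Hypotheses (hc0 : 2 <= c0) (d0 : (0 < d)%N) (k0 : (0 < k)%N) (sep : well_separated c0 G).
Implicit Types (i j : 'I_k) (x y : 'I_d -> R).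

Definition dist2 x j : R := \sum_(c < d) (x c - mean G j 0 c) ^+ 2.
Definition mean_fun j : 'I_d -> R := fun c => mean G j 0 c.
Definition logratio : R := ln (rho_w G * rho_sigma G).

Lemma dist2_ge0 x j : 0 <= dist2 x j.
Proof. by apply: sumr_ge0 => c _; rewrite sqr_ge0. Qed.

Lemma rho_w_ge1 : 1 <= rho_w G.
Proof. exact: fratio_ge1 (@weight_gt0 _ _ _ G). Qed.

Lemma rho_sigma_ge1 : 1 <= rho_sigma G.
Proof. exact: fratio_ge1 (@std_gt0 _ _ _ G). Qed.

Lemma rho_prod_ge1 : 1 <= rho_w G * rho_sigma G.
Proof. by rewrite mulr_ege1 // ?rho_w_ge1 ?rho_sigma_ge1. Qed.

Lemma logratio_ge0 : 0 <= logratio.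
Proof. by rewrite ln_ge0 // rho_prod_ge1. Qed.

Lemma expR_logratio : expR logratio = rho_w G * rho_sigma G.
Proof. by rewrite lnK // posrE (lt_le_trans _ rho_prod_ge1). Qed.

Lemma separation i j : i != j ->
  16 * c0 ^+ 2 * (d%:R + logratio) * (std G i + std G j) ^+ 2 <= dist2 (mean_fun i) j.
Proof.
move=> ij; have := sep ij; rewrite -/logratio => h.
have -> : dist2 (mean_fun i) j = l2norm (mean G i - mean G j) ^+ 2.
  rewrite /l2norm sqr_sqrtr; last by apply: sumr_ge0 => c _; rewrite sqr_ge0.
  by apply: eq_bigr => c _; rewrite !mxE.
apply: (@sep_sqr _ _ _ _ (Num.sqrt logratio) (Num.sqrt d%:R)) h; rewrite ?sqrtr_ge0 ?sqr_sqrtr ?logratio_ge0 ?std_gt0 //.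
by move: hc0; lra.
Qed.

Lemma separation64 i j : i != j -> 64 * d%:R * (std G i + std G j) ^+ 2 <= dist2 (mean_fun i) j.
Proof.
move=> ij; apply: le_trans (separation ij); apply: ler_wpM2r; first exact: sqr_ge0.
have c4 : 4 <= c0 ^+ 2 by have := sqr_ge0 (c0 - 2); move: hc0; rewrite sqrrB; lra.
have L0 := logratio_ge0; have dd : 0 <= d%:R :> R by [].
by apply: ler_pM => //; lra.
Qed.

(* Distinct means differ in the key formed by the rounded ratio sigma_i/sigma_min,
   the rounded coordinates of (mu_i - mu_j)/(8 sigma_i) and their signs, and the
   tails are dominated by a product of geometric sums over these keys. *)
Lemma packing j :
  \sum_(i | i != j) expR (- (dist2 (mean_fun i) j / (4 * std G i ^+ 2))) <=
    2 * rho_sigma G * 4 ^+ d.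
Proof.
pose smin := fmin (std G).
have smin0 : 0 < smin by apply: fmin_gt0 => // i; exact: std_gt0.
pose n i := Num.truncn (std G i / smin).
have q1 i : 1 <= std G i / smin by rewrite ler_pdivlMr // mul1r fmin_le.
have n0 i : (0 < n i)%N by rewrite truncn_gt0.
have nP i : (n i)%:R * smin <= std G i.
  by rewrite -ler_pdivlMr // truncn_le (le_trans _ (q1 i)).
(* The ratio is at least 1, so truncating it loses at most a factor 2. *)
have nP2 i : std G i <= 2 * (n i)%:R * smin.
  have /andP[_] := truncn_itv (le_trans ler01 (q1 i)); rewrite -/(n i).
  rewrite ltr_pdivrMr // => /ltW h; apply: le_trans h _; rewrite ler_wpM2r ?(ltW smin0) //.
  by rewrite -natrM ler_nat; move: (n0 i); lia.
pose v i c := (mean G i 0 c - mean G j 0 c) / (8 * (n i)%:R * smin).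
pose m i c := Num.truncn `|v i c|.
pose Q := (Num.truncn (rho_sigma G)).+1.
pose Q' := (\max_i \max_c m i c).+1.
pose phi i : 'I_Q * {ffun 'I_d -> 'I_Q' * bool} :=
  (inord (n i), [ffun c => (inord (m i c), v i c < 0)]).
have nQ i : (n i < Q)%N.
  rewrite ltnS le_truncn // ler_pM2r ?invr_gt0 //; exact: fmax_ge.
have mQ i c : (m i c < Q')%N.
  rewrite ltnS; apply: leq_trans (leq_bigmax i); exact: (leq_bigmax (F := fun c => m i c)).
pose F (y : 'I_Q * {ffun 'I_d -> 'I_Q' * bool}) : R := \prod_(c < d) 2^-1 ^+ (y.2 c).1.
have step i : expR (- (dist2 (mean_fun i) j / (4 * std G i ^+ 2))) <= F (phi i).
  have -> : F (phi i) = \prod_(c < d) 2^-1 ^+ m i c.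
    by apply: eq_bigr => c _; rewrite ffunE /= inordK.
  apply: le_trans (_ : expR (- \sum_(c < d) (m i c)%:R) <= _).
    rewrite ler_expR lerN2 ler_pdivlMr ?mulr_gt0 ?exprn_gt0 ?std_gt0 //.
    rewrite mulr_suml; apply: ler_sum => c _.
    have hv : mean_fun i c - mean G j 0 c = v i c * (8 * (n i)%:R * smin).
      by rewrite /v mulfVK // gt_eqF // !mulr_gt0 ?ltr0n.
    rewrite hv exprMn.
    have h1 : (m i c)%:R <= (v i c) ^+ 2.
      have h2 : (m i c)%:R <= `|v i c| by rewrite truncn_le.
      rewrite -real_normK ?num_real //.
      apply: le_trans (_ : (m i c)%:R ^+ 2 <= _); last by rewrite lerXn2r // nnegrE.
      by rewrite -natrX ler_nat; case: (m i c) => // t; rewrite expnS leq_pmulr // expn_gt0.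
    apply: ler_pM => //; first by rewrite mulr_ge0 ?sqr_ge0.
    have : 0 <= std G i by exact/ltW/std_gt0.
    have := nP2 i; move: (std G i : R) => s h2 s0.
    apply: le_trans (_ : 4 * (2 * (n i)%:R * smin) ^+ 2 <= _).
      by rewrite ler_pM2l // lerXn2r // nnegrE // (le_trans s0).
    have : 0 <= ((n i)%:R * smin) ^+ 2 by rewrite sqr_ge0.
    move: ((n i)%:R : R) (smin : R) => a b; nra.
  rewrite -sumrN expR_sum; apply: ler_prod => c _; rewrite expR_ge0 /=.
  rewrite expRN exprVn lef_pV2 ?posrE ?exprn_gt0 ?expR_gt0 //.
  exact: expR_ge_pow2.
apply: le_trans (ler_sum _ (fun i _ => step i)) _.
have F0 u : 0 <= F u by apply: prodr_ge0 => c _; rewrite exprn_ge0 // invr_ge0.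
apply: le_trans (sum_inj_le (h := phi) (F := F) _ F0) _.
  move=> i i' _ _ e; apply/eqP; apply: contraT => ii'.
  have en : n i = n i'.
    by have := congr1 (fun u => nat_of_ord u.1) e; rewrite /= !inordK.
  (* With equal keys the coordinates differ by at most one unit 8 n smin; truncation acts on
     absolute values, hence the sign in the key. The unit is too small for the separation of two
     widths of at least n smin. *)
  have hlt : dist2 (mean_fun i) i' <= d%:R * (8 * (n i)%:R * smin) ^+ 2.
    rewrite /dist2.
    apply: le_trans (_ : \sum_(c < d) (8 * (n i)%:R * smin) ^+ 2 <= _); last first.
      by rewrite sumr_const card_ord -[leLHS]mulr_natl.
    apply: ler_sum => c _.
    have := congr1 (fun u : 'I_Q * {ffun 'I_d -> 'I_Q' * bool} => nat_of_ord (u.2 c).1) e.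
    have := congr1 (fun u : 'I_Q * {ffun 'I_d -> 'I_Q' * bool} => (u.2 c).2) e.
    rewrite /= !ffunE /= !inordK // => es em.
    have w0 : 0 < 8 * (n i)%:R * smin by rewrite !mulr_gt0 ?ltr0n.
    have -> : mean_fun i c - mean G i' 0 c = (v i c - v i' c) * (8 * (n i)%:R * smin).
      by rewrite /v -en -mulrBl mulfVK ?gt_eqF //; rewrite /mean_fun; lra.
    rewrite exprMn -[leRHS]mul1r ler_wpM2r ?sqr_ge0 //.
    have /andP[a1 a2] := truncn_itv (normr_ge0 (v i c)).
    have /andP[b1 b2] := truncn_itv (normr_ge0 (v i' c)).
    rewrite -/(m i c) in a1 a2; rewrite -/(m i' c) -em in b1 b2.
    rewrite -natr1 in a2 b2.
    have : `|v i c - v i' c| <= 1.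
      move: es a1 a2 b1 b2; rewrite ler_norml.
      by case: (ltrP (v i c) 0) => h1; case: (ltrP (v i' c) 0) => h2 // _;
        rewrite ?(ltr0_norm h1) ?(ltr0_norm h2) ?(ger0_norm h1) ?(ger0_norm h2); lra.
    by move=> h; rewrite -real_normK ?num_real // expr_le1.
  exfalso; apply: (sep_absurd (e := d%:R) (t := (n i)%:R * smin) _ _ _ _ _ (separation64 ii')).
  + by rewrite ltr0n.
  + by rewrite mulr_gt0 ?ltr0n.
  + exact: nP.
  + by rewrite en nP.
  + by move: hlt; rewrite mulrA.
(* There are Q rounded ratios, at most 2 [rho_sigma], and each coordinate contributes two signs
   times a geometric sum of at most 2, that is 4. *)
have -> : \sum_u F u = Q%:R * (\sum_(x : 'I_Q' * bool) 2^-1 ^+ x.1) ^+ d.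
  rewrite -(pair_big xpredT xpredT (fun (a : 'I_Q) (f : {ffun 'I_d -> 'I_Q' * bool}) =>
    \prod_(c < d) (2^-1 : R) ^+ (f c).1)) /=.
  rewrite sumr_const card_ord -[LHS]mulr_natl; congr (_ * _).
  rewrite -(bigA_distr_bigA (fun (c : 'I_d) (x : 'I_Q' * bool) => (2^-1 : R) ^+ x.1)).
  by rewrite prodr_const card_ord.
have Q2 : Q%:R <= 2 * rho_sigma G.
  have : (Num.truncn (rho_sigma G))%:R <= rho_sigma G by rewrite truncn_le (le_trans _ rho_sigma_ge1).
  have := rho_sigma_ge1; rewrite /Q -natr1; lra.
apply: ler_pM => //; first by rewrite exprn_ge0 // sumr_ge0 // => x _; rewrite exprn_ge0 // invr_ge0.
rewrite lerXn2r ?nnegrE //; first by rewrite sumr_ge0 // => x _; rewrite exprn_ge0 // invr_ge0.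
rewrite -(pair_big xpredT xpredT (fun (a : 'I_Q') (b : bool) => (2^-1 : R) ^+ a)) /=.
under eq_bigr do rewrite big_bool /=.
rewrite big_split /=; have := geometric_half_le R Q'; lra.
Qed.

(* The three parts of the exponent pay for, respectively, the weights and the
   packing constant, the ratio of the peak heights, and the claimed gain. *)
Lemma domination j (y : 'I_k -> 'I_d -> R) :
  (forall i, i != j -> dist2 (y i) j <= 529 / 100 * d%:R * std G j ^+ 2) ->
  \sum_(i | i != j) weight G i * std G i ^- d * expR (- pi * dist2 (y i) i / std G i ^+ 2) <=
  expR (- (12 * c0 + 21) * d%:R) * (weight G j * std G j ^- d).
Proof.
move=> hy; have L0 := logratio_ge0; have wj := weight_gt0 G j; have sj := std_gt0 G j.
pose K : R := expR (logratio - 12 * c0 ^+ 2 * (d%:R + logratio)) / rho_sigma G.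
have rs0 : 0 < rho_sigma G by rewrite (lt_le_trans _ rho_sigma_ge1).
have step i : i != j -> weight G i * std G i ^- d * expR (- pi * dist2 (y i) i / std G i ^+ 2) <=
   K * (weight G j * std G j ^- d) * expR (- (dist2 (mean_fun i) j / (4 * std G i ^+ 2))).
  move=> ij; have si := std_gt0 G i; have hs := separation ij; have hs64 := separation64 ij.
  have D0 : 0 <= dist2 (y i) i by apply: dist2_ge0.
  have hD : dist2 (mean_fun i) j <= 2 * dist2 (y i) i.
    (* A weighted triangle inequality. By [hy] the last term is at most 15.87 d sigma_j^2, less than
       a quarter of the left side by [hs64], which leaves the factor 2 of [hD]. *)
    have h1 : dist2 (mean_fun i) j <= 3 / 2 * dist2 (y i) i + 3 * dist2 (y i) j.
      rewrite /dist2 !mulr_sumr -big_split /=; apply: ler_sum => c _.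
      have := sqr_ge0 (y i c - mean G i 0 c + 2 * (y i c - mean G j 0 c)).
      by rewrite /mean_fun !expr2; lra.
    have h2 := hy i ij.
    have h3 : d%:R * std G j ^+ 2 <= d%:R * (std G i + std G j) ^+ 2.
      by rewrite ler_wpM2l // lerXn2r ?nnegrE; lra.
    by move: h2 h3 hs64; lra.
  pose r : R := std G j / std G i.
  have r0 : 0 < r by rewrite divr_gt0.
  pose X : R := dist2 (mean_fun i) j / std G i ^+ 2.
  have hX : 12 * c0 ^+ 2 * (d%:R + logratio) + d%:R * r <= 3 / 4 * X.
    have : 16 * c0 ^+ 2 * (d%:R + logratio) * (1 + r) ^+ 2 <= X.
      rewrite ler_pdivlMr ?exprn_gt0 // -[leLHS]mulrA -exprMn.
      by have -> : (1 + r) * std G i = std G i + std G j by rewrite mulrDl mul1r /r mulfVK ?gt_eqF.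
    have c4 : 4 <= c0 ^+ 2 by have := sqr_ge0 (c0 - 2); move: hc0; rewrite sqrrB; lra.
    have t0 : 0 <= c0 ^+ 2 * (d%:R + logratio) by rewrite mulr_ge0 ?sqr_ge0 // addr_ge0.
    have t1 : d%:R <= c0 ^+ 2 * (d%:R + logratio).
      by rewrite -[leLHS]mul1r; apply: ler_pM => //; lra.
    have t2 : 0 <= c0 ^+ 2 * (d%:R + logratio) * r by rewrite mulr_ge0 // ltW.
    have t3 : d%:R * r <= c0 ^+ 2 * (d%:R + logratio) * r by rewrite ler_wpM2r // ltW.
    have t4 : 0 <= c0 ^+ 2 * (d%:R + logratio) * r ^+ 2 by rewrite mulr_ge0 ?sqr_ge0.
    have -> : 16 * c0 ^+ 2 * (d%:R + logratio) * (1 + r) ^+ 2 =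
      16 * (c0 ^+ 2 * (d%:R + logratio)) + 32 * (c0 ^+ 2 * (d%:R + logratio) * r) +
      16 * (c0 ^+ 2 * (d%:R + logratio) * r ^+ 2) by ring.
    by lra.
  have e1 : expR (- pi * dist2 (y i) i / std G i ^+ 2) <=
      expR (- (12 * c0 ^+ 2 * (d%:R + logratio))) * expR (- (d%:R * r)) *
      expR (- (dist2 (mean_fun i) j / (4 * std G i ^+ 2))).
    rewrite -!expRD ler_expR.
    have -> : dist2 (mean_fun i) j / (4 * std G i ^+ 2) = 1 / 4 * X.
      by rewrite /X; field; rewrite gt_eqF.
    have : X <= pi * dist2 (y i) i / std G i ^+ 2.
      rewrite ler_pM2r ?invr_gt0 ?exprn_gt0 //; apply: (le_trans hD).
      by rewrite ler_wpM2r // pi_ge2.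
    by rewrite !mulNr; lra.
  have e2 : std G i ^- d = r ^+ d * std G j ^- d.
    by rewrite /r exprMn exprVn mulrAC mulfV ?mul1r // expf_neq0 // gt_eqF.
  have e3 : r ^+ d * expR (- (d%:R * r)) <= 1.
    rewrite expRN ler_pdivrMr ?expR_gt0 // mul1r expRM_natl lerXn2r ?nnegrE ?expR_ge0 ?(ltW r0) //.
    by apply: le_trans (expR_ge1Dx r); lra.
  have e4 : weight G i <= expR logratio / rho_sigma G * weight G j.
    rewrite expR_logratio mulfK ?gt_eqF //.
    by apply: fratio_ge => // l; exact: weight_gt0.
  have e5 : 0 <= std G j ^- d by rewrite invr_ge0 exprn_ge0 // ltW.
  rewrite e2 /K expRD.
  have := expR_ge0 (- (12 * c0 ^+ 2 * (d%:R + logratio))).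
  have := expR_ge0 (- (dist2 (mean_fun i) j / (4 * std G i ^+ 2))).
  move: e1 e3 e4; move: (expR (- (12 * c0 ^+ 2 * _))) (expR (- (_ / _))) (expR (- (d%:R * r)))
    (expR (- pi * _ / _)) => A1 A2 A3 A4 e1 e3 e4 A20 A10.
  apply: le_trans (_ : weight G i * (r ^+ d * std G j ^- d) * (A1 * A3 * A2) <= _).
    by rewrite ler_wpM2l // !mulr_ge0 ?exprn_ge0 // ltW // weight_gt0.
  have -> : weight G i * (r ^+ d * std G j ^- d) * (A1 * A3 * A2) =
     weight G i * (r ^+ d * A3) * (std G j ^- d * A1 * A2) by ring.
  have -> : expR logratio * A1 / rho_sigma G * (weight G j / std G j ^+ d) * A2 =
     (expR logratio / rho_sigma G * weight G j) * 1 * (std G j ^- d * A1 * A2) by ring.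
  apply: ler_wpM2r; first by rewrite !mulr_ge0.
  have wi : 0 <= weight G i by rewrite ltW // weight_gt0.
  rewrite mulr1; apply: le_trans e4; rewrite -[leRHS]mulr1.
  by rewrite ler_wpM2l.
have K0 : 0 <= K * (weight G j * std G j ^- d).
  by rewrite !mulr_ge0 ?expR_ge0 ?invr_ge0 ?exprn_ge0 // ltW.
apply: le_trans (ler_sum _ step) _; rewrite -mulr_sumr.
apply: le_trans (ler_wpM2l K0 (packing j)) _.
have -> : K * (weight G j * std G j ^- d) * (2 * rho_sigma G * 4 ^+ d) =
   (2 * 4 ^+ d * expR (logratio - 12 * c0 ^+ 2 * (d%:R + logratio))) * (weight G j * std G j ^- d).
  by rewrite /K; field; rewrite !gt_eqF // exprn_gt0.
apply: ler_wpM2r; first by rewrite !mulr_ge0 ?invr_ge0 ?exprn_ge0 // ltW.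
apply: le_trans (_ : expR (3 * d%:R) * expR (logratio - 12 * c0 ^+ 2 * (d%:R + logratio)) <= _).
  apply: ler_wpM2r; first exact: expR_ge0.
  apply: le_trans (_ : 2 ^+ (3 * d) <= _); last by apply: expR_ge_pow2; rewrite natrM.
  rewrite -[4](_ : 2 ^+ 2 = _ :> R); last by rewrite -natrX.
  by rewrite -exprM -exprS ler_weXn2l //; [rewrite ler1n|lia].
rewrite -expRD ler_expR.
(* As c0 >= 2, 12 c0^2 >= 24 c0 >= 12 c0 + 24, and 24 - 3 is the 21 of the claim; the logarithm is
   left with a negative coefficient. *)
have c4 : 2 * c0 <= c0 ^+ 2 by have := sqr_ge0 (c0 - 2); move: hc0; rewrite expr2; nra.
have t1 : 2 * c0 * d%:R <= c0 ^+ 2 * d%:R by rewrite ler_wpM2r.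
have t2 : 4 * logratio <= c0 ^+ 2 * logratio by rewrite ler_wpM2r //; move: hc0 c4; lra.
have t3 : 2 * d%:R <= c0 * d%:R by rewrite ler_wpM2r.
by lra.
Qed.

End Domination.

(** * The mixture near a mean: a single Gaussian profile *)

Section CellBounds.
Variable R : realType.
Implicit Types (m s a b y : R).

Lemma imass_gauss_ge m s a b e : 0 < s -> a <= b ->
  (forall t, a <= t < b -> (t - m) ^+ 2 <= e) ->
  (b - a) * (s^-1 * expR (- pi * e / s ^+ 2)) <= imass (gauss1 m s) a b.
Proof.
move=> s0 ab H; rewrite mulrC; apply: (imass_ge (K := s^-1)) => //.
- exact: measurable_gauss1.
- by move=> t; exact: gauss1_ge0.
- by move=> t; exact: gauss1_le.
- by rewrite mulr_ge0 ?invr_ge0 ?expR_ge0 // ltW.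
move=> t /H ht; rewrite ler_pM2l ?invr_gt0 // ler_expR ler_pM2r ?invr_gt0 ?exprn_gt0 //.
by rewrite !mulNr lerN2 ler_pM2l ?pi_gt0.
Qed.

Lemma imass_gauss_le2 m s a b e : 0 < s -> a <= b ->
  (forall t, a <= t < b -> e <= (t - m) ^+ 2) ->
  imass (gauss1 m s) a b <= (b - a) * (s^-1 * expR (- pi * e / s ^+ 2)).
Proof.
move=> s0 ab H; rewrite mulrC; apply: (imass_le (K := s^-1)) => //.
- exact: measurable_gauss1.
- by move=> t; exact: gauss1_ge0.
- by move=> t; exact: gauss1_le.
move=> t /H ht; rewrite ler_pM2l ?invr_gt0 // ler_expR ler_pM2r ?invr_gt0 ?exprn_gt0 //.
by rewrite !mulNr lerN2 ler_pM2l ?pi_gt0.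
Qed.

Lemma imass_gauss_ge0 m s a b : 0 < s -> 0 <= imass (gauss1 m s) a b.
Proof.
move=> s0; apply: fine_ge0; apply: integral_ge0 => y _.
by rewrite lee_fin gauss1_ge0.
Qed.

(** Merges an error 13/100 in the exponent, from the extent of a cell, with additive errors 1/4 from
    the other components and 1/10 from sampling. On the lower side, treated next, only the sampling
    error is additive. *)
Lemma expR_upper (e : R) : 0 <= e <= 1 -> expR (13 / 100 * e) + 35 / 100 * e <= expR e.
Proof.
move=> /andP[e0 e1]; apply: le_trans (expR_ge1Dx e).
have h : 0 < 1 - 13 / 100 * e by lra.
have : expR (13 / 100 * e) <= (1 - 13 / 100 * e)^-1.
  rewrite -[leLHS]invrK -expRN lef_pV2 ?posrE ?expR_gt0 //.
  by apply: le_trans (expR_ge1Dx _); lra.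
suff : (1 - 13 / 100 * e)^-1 <= 1 + 65 / 100 * e by lra.
rewrite -[leLHS]mul1r ler_pdivrMr //; nra.
Qed.

Lemma expR_lower (e : R) : 0 <= e <= 1 -> expR (- e) <= expR (- (13 / 100 * e)) - 1 / 10 * e.
Proof.
move=> /andP[e0 e1].
have : 1 - 13 / 100 * e <= expR (- (13 / 100 * e)) by apply: le_trans (expR_ge1Dx _); lra.
suff : expR (- e) <= 1 - 1 / 2 * e by lra.
have h : 0 < 1 + e by lra.
apply: le_trans (_ : (1 + e)^-1 <= _).
  by rewrite expRN lef_pV2 ?posrE ?expR_gt0 // expR_ge1Dx.
rewrite -[leLHS]mul1r ler_pdivrMr //; nra.
Qed.

End CellBounds.

Section Approximation.
Variables (R : realType) (d k : nat) (G : mixture R d k) (c0 : R).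
Hypotheses (hc0 : 2 <= c0) (d0 : (0 < d)%N) (k0 : (0 < k)%N) (sep : well_separated c0 G).
Variables (M N : nat) (F : nat -> nat) (tau : R).
Hypothesis M0 : (0 < M)%N.

Definition hstep : R := M%:R^-1.
Definition accuracy : R := expR (- c0 * d%:R) / (64 * d%:R).
(** To first order the contribution of component [j] to the probability of the cell at its mean. *)
Definition peak (j : 'I_k) : R := weight G j * std G j ^- d * hstep ^+ d.
Definition ctr (z : 'I_d -> nat) : 'I_d -> R := fun c => center R M (z c).
Definition freq (z : 'I_d -> nat) : R := (F (enc (M ^ 2) z))%:R / N%:R.

Hypothesis hM : forall j, 100 * d%:R * hstep <= accuracy * std G j.
(** Up to squared distance 5 d sigma^2 the exponent of the profile is at least -20 d, as pi <= 4;
    the noise is thus negligible wherever the profile is used. *)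
Hypothesis htau : forall j, tau <= accuracy / 10 * (peak j * expR (- (21 * d%:R))).
Hypothesis hF : forall z : 'I_d -> nat, inner_cell (M ^ 2) z -> `|freq z - cell_mass G M z| <= tau.

Let dR : 1 <= d%:R :> R. Proof. by rewrite ler1n. Qed.

Lemma hstep_gt0 : 0 < hstep. Proof. by rewrite invr_gt0 ltr0n. Qed.

Lemma eps_gt0 : 0 < accuracy.
Proof. by rewrite divr_gt0 ?expR_gt0 // mulr_gt0 // ltr0n. Qed.

Lemma eps_d : 64 * d%:R * accuracy = expR (- c0 * d%:R).
Proof. by rewrite /accuracy mulrC mulfVK // gt_eqF // mulr_gt0 // ltr0n. Qed.

Lemma eps_le : accuracy <= 1 / 64.
Proof.
have e1 : expR (- c0 * d%:R) <= 1.
  by rewrite expR_le1 mulNr oppr_le0 mulr_ge0 //; move: hc0; lra.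
have := eps_d; have := eps_gt0 => h1 h2.
have : accuracy <= d%:R * accuracy by rewrite ler_peMl // ltW.
by lra.
Qed.

Lemma peak_gt0 j : 0 < peak j.
Proof.
by rewrite !mulr_gt0 ?weight_gt0 ?invr_gt0 ?exprn_gt0 ?std_gt0 ?hstep_gt0.
Qed.

Lemma hstep_std j : 100 * d%:R * (hstep / std G j) <= accuracy.
Proof. by rewrite mulrA ler_pdivrMr ?std_gt0. Qed.

Lemma hstep_le j : hstep <= std G j / 64.
Proof.
have := hstep_std j; have := eps_le; have := hstep_gt0; have := std_gt0 G j => s0 h0 e1 e2.
have r0 : 0 <= hstep / std G j by rewrite divr_ge0 // ltW.
have : hstep / std G j <= d%:R * (hstep / std G j) by rewrite ler_peMl.
move=> h; have : hstep / std G j <= 1 / 64 by lra.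
by rewrite ler_pdivrMr //; lra.
Qed.

Lemma edge_step t : edge R M t.+1 - edge R M t = hstep.
Proof. by rewrite /edge -natr1 /hstep; ring. Qed.

Lemma edge_le_step t : edge R M t <= edge R M t.+1.
Proof. by rewrite edge_le. Qed.

Lemma center_edge t : center R M t = edge R M t + hstep / 2.
Proof. by rewrite /center /edge /hstep; ring. Qed.

Lemma cell_near t y : edge R M t <= y <= edge R M t.+1 -> `|y - center R M t| <= hstep / 2.
Proof. by move=> /andP[h1 h2]; have := edge_step t; rewrite center_edge ler_norml; lra. Qed.

Lemma expR_big : 256 * d%:R <= expR (23 * d%:R) :> R.
Proof.
apply: le_trans (_ : 2 ^+ (23 * d) <= _); last by apply: expR_ge_pow2; rewrite natrM.
have -> : 256 * d%:R = (2 ^ 8 * d)%:R :> R by rewrite natrM.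
rewrite -natrX ler_nat; apply: leq_trans (_ : 2 ^ 8 * 2 ^ d <= _)%N.
  by rewrite leq_mul2l /= ltnW // ltn_expl.
by rewrite -expnD leq_pexp2l //; move: d0; lia.
Qed.

Definition own_mass j z : R :=
  weight G j * \prod_(i < d) imass (gauss1 (mean G j 0 i) (std G j)) (edge R M (z i)) (edge R M (z i).+1).

Lemma cell_massD j z : cell_mass G M z = own_mass j z + \sum_(i | i != j) own_mass i z.
Proof. by rewrite /cell_mass (bigD1 j). Qed.

Lemma own_mass_ge0 j z : 0 <= own_mass j z.
Proof.
rewrite mulr_ge0 ?(ltW (weight_gt0 _ _)) // prodr_ge0 // => i _.
by apply: imass_gauss_ge0; exact: std_gt0.
Qed.

Lemma prod_gaussE j (e : 'I_d -> R) :
  \prod_(i < d) (hstep * ((std G j)^-1 * expR (- pi * e i / std G j ^+ 2))) =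
  std G j ^- d * hstep ^+ d * expR (- pi * (\sum_(i < d) e i) / std G j ^+ 2).
Proof.
have -> : - pi * (\sum_(i < d) e i) / std G j ^+ 2 = \sum_(i < d) (- pi * e i / std G j ^+ 2).
  by rewrite mulr_sumr mulr_suml.
rewrite big_split /= big_split /= !prodr_const !card_ord expR_sum [(std G j)^-1 ^+ d]exprVn.
by rewrite mulrCA mulrA.
Qed.

(** Within a cell the squared offset of a coordinate changes by at most h |delta| + h^2/4. Summed
    with |delta| <= (delta^2/sigma + sigma)/2 this is at most 3.1 d h sigma, and [hM] turns 4 * 3.1
    d h/sigma into less than 13/100 of [accuracy]. *)
Lemma own_mass_bounds j z : dist2 G (ctr z) j <= 5 * d%:R * std G j ^+ 2 ->
  peak j * expR (- pi * dist2 G (ctr z) j / std G j ^+ 2 - 13 / 100 * accuracy) <= own_mass j z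
  <= peak j * expR (- pi * dist2 G (ctr z) j / std G j ^+ 2 + 13 / 100 * accuracy).
Proof.
move=> hD; have s0 := std_gt0 G j; have h0 := hstep_gt0; have hs := hstep_le j.
pose dl (c : 'I_d) : R := `|ctr z c - mean G j 0 c|.
pose er (c : 'I_d) : R := hstep * dl c + hstep ^+ 2 / 4.
have dl2 c : dl c ^+ 2 = (ctr z c - mean G j 0 c) ^+ 2 by rewrite real_normK ?num_real.
have cellE c t : edge R M (z c) <= t < edge R M (z c).+1 ->
   (ctr z c - mean G j 0 c) ^+ 2 - er c <= (t - mean G j 0 c) ^+ 2 <= (ctr z c - mean G j 0 c) ^+ 2 + er c.
  move=> /andP[t1 t2]; have : `|t - ctr z c| <= hstep / 2.
    by apply: cell_near; rewrite t1 ltW.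
  have : - dl c <= ctr z c - mean G j 0 c <= dl c by rewrite -ler_norml.
  rewrite ler_norml; have dl0 : 0 <= dl c by rewrite /dl.
  have -> : t - mean G j 0 c = (t - ctr z c) + (ctr z c - mean G j 0 c) by ring.
  rewrite /er; move: (t - ctr z c) (ctr z c - mean G j 0 c) (dl c) dl0 (hstep : R) h0 => u v w w0 H H0.
  move=> /andP[v1 v2] /andP[u1 u2].
  have : (u + v) ^+ 2 = u ^+ 2 + v ^+ 2 + 2 * (u * v) by ring.
  have : u ^+ 2 <= H ^+ 2 / 4 by nra.
  have : 0 <= u ^+ 2 by apply: sqr_ge0.
  have : `|u * v| <= H / 2 * w by rewrite normrM; apply: ler_pM => //; rewrite ler_norml; lra.
  rewrite ler_norml; lra.
have sum_er : pi * (\sum_c er c) / std G j ^+ 2 <= 13 / 100 * accuracy.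
  have dls c : dl c <= (dl c ^+ 2 / std G j + std G j) / 2.
    have : 0 <= (dl c - std G j) ^+ 2 / std G j by rewrite divr_ge0 ?sqr_ge0 // ltW.
    have -> : (dl c - std G j) ^+ 2 / std G j = dl c ^+ 2 / std G j - 2 * dl c + std G j.
      by field; rewrite gt_eqF.
    by lra.
  have sdl : \sum_c dl c <= 3 * d%:R * std G j.
    apply: le_trans (ler_sum _ (fun c _ => dls c)) _.
    rewrite -mulr_suml big_split /= -mulr_suml sumr_const card_ord -[_ *+ _]mulr_natl.
    have : (\sum_(c < d) dl c ^+ 2) / std G j <= 5 * d%:R * std G j.
      rewrite ler_pdivrMr //.
      have -> : 5 * d%:R * std G j * std G j = 5 * d%:R * std G j ^+ 2 by ring.
      apply: le_trans hD.
      by rewrite le_eqVlt; apply/orP; left; apply/eqP; apply: eq_bigr.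
    by lra.
  have -> : \sum_c er c = hstep * (\sum_c dl c) + d%:R * (hstep ^+ 2 / 4).
    by rewrite big_split /= -mulr_sumr sumr_const card_ord -[_ *+ _]mulr_natl.
  have e1 : hstep * (\sum_c dl c) + d%:R * (hstep ^+ 2 / 4) <= 31 / 10 * d%:R * hstep * std G j.
    have : hstep * (\sum_c dl c) <= hstep * (3 * d%:R * std G j) by rewrite ler_pM2l.
    have : d%:R * (hstep ^+ 2) <= d%:R * (hstep * (std G j / 64)).
      by rewrite expr2 ler_pM2l ?ltr0n // ler_pM2l.
    have : 0 < d%:R * hstep * std G j by rewrite !mulr_gt0 // ltr0n.
    by lra.
  have pi4 : pi <= 4 :> R by have := pihalf_lt2 R; lra.
  rewrite ler_pdivrMr ?exprn_gt0 //.
  apply: le_trans (_ : 4 * (31 / 10 * d%:R * hstep * std G j) <= _).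
    apply: ler_pM => //; first exact: pi_ge0.
    have s1 : 0 <= \sum_c dl c by apply: sumr_ge0 => c _; rewrite /dl.
    apply: addr_ge0; first by apply: mulr_ge0 => //; exact: ltW.
    by rewrite mulr_ge0 // divr_ge0 // sqr_ge0.
  have := hM j; move=> h; have : 100 * d%:R * hstep * std G j <= accuracy * std G j * std G j by rewrite ler_pM2r.
  have : 0 < d%:R * hstep * std G j by rewrite !mulr_gt0 // ltr0n.
  by rewrite expr2; lra.
have A0 : 0 <= weight G j by rewrite ltW // weight_gt0.
have -> : forall e, peak j * e = weight G j * (std G j ^- d * hstep ^+ d * e) by move=> e; rewrite /peak; ring.
have -> : forall e, peak j * e = weight G j * (std G j ^- d * hstep ^+ d * e) by move=> e; rewrite /peak; ring.
rewrite /own_mass; apply/andP; split; (apply: ler_wpM2l => //).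
- apply: le_trans (_ : \prod_(i < d) (hstep * ((std G j)^-1 * expR (- pi * ((ctr z i - mean G j 0 i) ^+ 2 + er i) / std G j ^+ 2))) <= _).
    rewrite prod_gaussE; apply: ler_wpM2l.
      by rewrite mulr_ge0 ?invr_ge0 ?exprn_ge0 // ltW.
    rewrite ler_expR big_split /= -/(dist2 G (ctr z) j).
    have -> : forall D E : R, - pi * (D + E) / std G j ^+ 2 =
      - pi * D / std G j ^+ 2 - pi * E / std G j ^+ 2 by move=> D E; ring.
    by rewrite lerD2l lerN2.
  apply: ler_prod => i _; rewrite -(edge_step (z i)); apply/andP; split.
    by rewrite edge_step !mulr_ge0 ?expR_ge0 ?invr_ge0 // ltW.
  by apply: imass_gauss_ge => //; [exact: edge_le_step|move=> t /cellE /andP[]].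
- apply: le_trans (_ : \prod_(i < d) (hstep * ((std G j)^-1 * expR (- pi * ((ctr z i - mean G j 0 i) ^+ 2 - er i) / std G j ^+ 2))) <= _).
    apply: ler_prod => i _; rewrite -(edge_step (z i)) imass_gauss_ge0 //=.
    by apply: imass_gauss_le2 => //; [exact: edge_le_step|move=> t /cellE /andP[]].
  rewrite prod_gaussE; apply: ler_wpM2l.
    by rewrite mulr_ge0 ?invr_ge0 ?exprn_ge0 // ltW.
  rewrite ler_expR sumrB -/(dist2 G (ctr z) j).
  have -> : forall D E : R, - pi * (D - E) / std G j ^+ 2 =
    - pi * D / std G j ^+ 2 + pi * E / std G j ^+ 2 by move=> D E; ring.
  by rewrite lerD2l.
Qed.

(* The point of the closed cell closest to the mean of component i. *)
Definition nearest (i : 'I_k) (z : 'I_d -> nat) : 'I_d -> R := fun c =>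
  Num.max (edge R M (z c)) (Num.min (mean G i 0 c) (edge R M (z c).+1)).

Lemma nearest_in i z c : edge R M (z c) <= nearest i z c <= edge R M (z c).+1.
Proof.
have := edge_le_step (z c); rewrite /nearest => h.
by rewrite le_max lexx /= ge_max h ge_min lexx orbT.
Qed.

Lemma nearest_dist i z c t : edge R M (z c) <= t < edge R M (z c).+1 ->
  (nearest i z c - mean G i 0 c) ^+ 2 <= (t - mean G i 0 c) ^+ 2.
Proof.
move=> /andP[t1 t2]; rewrite /nearest; set m := mean G i 0 c.
have [mb|mb] := leP m (edge R M (z c).+1).
  have [am|am] := leP (edge R M (z c)) m; first by rewrite subrr expr0n sqr_ge0.
  by rewrite lerXn2r ?nnegrE; lra.
have h := edge_le_step (z c); rewrite (elimT max_idPr h).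
by rewrite -sqrrN -[leRHS]sqrrN lerXn2r ?nnegrE; lra.
Qed.

Lemma own_mass_le i z : own_mass i z <=
  hstep ^+ d * (weight G i * std G i ^- d * expR (- pi * dist2 G (nearest i z) i / std G i ^+ 2)).
Proof.
have s0 := std_gt0 G i; have w0 := weight_gt0 G i.
have -> : hstep ^+ d * (weight G i * std G i ^- d * expR (- pi * dist2 G (nearest i z) i / std G i ^+ 2)) =
  weight G i * \prod_(c < d) (hstep * ((std G i)^-1 * expR (- pi * (nearest i z c - mean G i 0 c) ^+ 2 / std G i ^+ 2))).
  by rewrite prod_gaussE; ring.
apply: ler_wpM2l; first exact: ltW.
apply: ler_prod => c _; rewrite imass_gauss_ge0 //= -(edge_step (z c)).
by apply: imass_gauss_le2 => //; [exact: edge_le_step|move=> t; exact: nearest_dist].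
Qed.

(** Of the gain (12 c0 + 21) d, the part 20 d pays for the least value of the profile, c0 d for the
    exponential in [accuracy], and the remaining (11 c0 + 1) d >= 23 d for the factor 256 d. *)
Lemma others_le j z : dist2 G (ctr z) j <= 5 * d%:R * std G j ^+ 2 ->
  \sum_(i | i != j) own_mass i z <= accuracy / 4 * (peak j * expR (- pi * dist2 G (ctr z) j / std G j ^+ 2)).
Proof.
move=> hD; have s0 := std_gt0 G j; have h0 := hstep_gt0; have hs := hstep_le j.
apply: le_trans (ler_sum _ (fun i _ => own_mass_le i z)) _; rewrite -mulr_sumr.
(* Passing from the centre to another point of the cell raises 5 to at most 5.29. That point depends
   on the component, which is why [domination] takes a family [y]. *)
have /(domination hc0 d0 k0 sep) hdom : forall i, i != j -> dist2 G (nearest i z) j <= 529 / 100 * d%:R * std G j ^+ 2.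
  move=> i _; apply: le_trans (_ : 21 / 20 * dist2 G (ctr z) j + d%:R * (6 * hstep ^+ 2) <= _).
    rewrite /dist2 mulr_sumr.
    have -> : d%:R * (6 * hstep ^+ 2) = \sum_(c < d) 6 * hstep ^+ 2.
      by rewrite sumr_const card_ord -[RHS]mulr_natl.
    rewrite -big_split /=; apply: ler_sum => c _.
    have := cell_near (nearest_in i z c); rewrite -/(ctr z c) ler_norml.
    set u : R := nearest i z c; set v : R := ctr z c; set m : R := mean G j 0 c => /andP[u1 u2].
    have := sqr_ge0 (v - m - 20 * (u - v)).
    have : 0 <= (hstep / 2 - (u - v)) * (hstep / 2 + (u - v)) by rewrite mulr_ge0; lra.
    have : 0 <= hstep ^+ 2 by apply: sqr_ge0.
    have -> : (u - m) ^+ 2 = ((v - m) + (u - v)) ^+ 2 by congr (_ ^+ 2); ring.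
    have -> : (v - m + (u - v)) ^+ 2 = (v - m) ^+ 2 + 2 * (v - m) * (u - v) + (u - v) ^+ 2 by ring.
    lra.
  have : hstep ^+ 2 <= std G j ^+ 2 / 600.
    apply: le_trans (_ : (std G j / 64) ^+ 2 <= _); first by rewrite lerXn2r ?nnegrE; lra.
    have := sqr_ge0 (std G j); rewrite exprMn; lra.
  move=> h1; have : d%:R * hstep ^+ 2 <= d%:R * (std G j ^+ 2 / 600) by rewrite ler_pM2l // ltr0n.
  have : 0 <= d%:R * std G j ^+ 2 by rewrite mulr_ge0 ?sqr_ge0.
  by lra.
apply: le_trans (ler_wpM2l (exprn_ge0 d (ltW h0)) hdom) _.
have -> : hstep ^+ d * (expR (- (12 * c0 + 21) * d%:R) * (weight G j * std G j ^- d)) =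
   expR (- (12 * c0 + 21) * d%:R) * peak j by rewrite /peak; ring.
have -> : accuracy / 4 * (peak j * expR (- pi * dist2 G (ctr z) j / std G j ^+ 2)) =
  accuracy / 4 * expR (- pi * dist2 G (ctr z) j / std G j ^+ 2) * peak j by ring.
apply: ler_wpM2r; first exact/ltW/peak_gt0.
apply: le_trans (_ : accuracy / 4 * expR (- (20 * d%:R)) <= _); last first.
  apply: ler_wpM2l; first by rewrite divr_ge0 // ltW // eps_gt0.
  rewrite ler_expR mulNr mulNr lerN2 ler_pdivrMr ?exprn_gt0 //.
  have pi4 : pi <= 4 :> R by have := pihalf_lt2 R; lra.
  apply: le_trans (_ : 4 * (5 * d%:R * std G j ^+ 2) <= _); last by lra.
  by apply: ler_pM => //; [exact: pi_ge0|exact: dist2_ge0].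
have -> : - (12 * c0 + 21) * d%:R = - (20 * d%:R) + (- c0 * d%:R + - ((11 * c0 + 1) * d%:R)) by ring.
rewrite expRD mulrC ler_pM2r ?expR_gt0 // expRD -eps_d.
have : expR (- ((11 * c0 + 1) * d%:R)) <= (256 * d%:R)^-1.
  rewrite expRN lef_pV2; [|exact: expR_gt0|by rewrite posrE mulr_gt0 ?ltr0n].
  apply: le_trans expR_big _; rewrite ler_expR ler_wpM2r //; move: hc0; lra.
move=> h; apply: le_trans (_ : 64 * d%:R * accuracy * (256 * d%:R)^-1 <= _).
  by rewrite ler_wpM2l // !mulr_ge0 // ltW // eps_gt0.
rewrite le_eqVlt; apply/orP; left; apply/eqP; field.
by rewrite gt_eqF // ltr0n.
Qed.

(** The radius is chosen so that the profile is still known after a shift by up to 11/10 sigma along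
    one coordinate, from a cell in a core or slightly outside: this is how far the search and the
    moves look. *)
Lemma approx j z : inner_cell (M ^ 2) z -> dist2 G (ctr z) j <= 5 * d%:R * std G j ^+ 2 ->
  peak j * expR (- pi * dist2 G (ctr z) j / std G j ^+ 2 - accuracy) <= freq z
  <= peak j * expR (- pi * dist2 G (ctr z) j / std G j ^+ 2 + accuracy).
Proof.
move=> hz hD; have := hF hz; rewrite (cell_massD j) => hf.
have /andP[g1 g2] := own_mass_bounds hD; have g3 := others_le hD.
have g4 : 0 <= \sum_(i | i != j) own_mass i z by apply: sumr_ge0 => i _; exact: own_mass_ge0.
have p0 := peak_gt0 j; have e0 := eps_gt0; have e1 := eps_le.
have ht : tau <= accuracy / 10 * (peak j * expR (- pi * dist2 G (ctr z) j / std G j ^+ 2)).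
  apply: le_trans (htau j) _; apply: ler_wpM2l; first by lra.
  apply: ler_wpM2l; first exact: ltW.
  rewrite ler_expR.
  rewrite mulNr mulNr lerN2 ler_pdivrMr ?exprn_gt0 ?std_gt0 //.
  have pi4 : pi <= 4 :> R by have := pihalf_lt2 R; lra.
  apply: le_trans (_ : 4 * (5 * d%:R * std G j ^+ 2) <= _).
    by apply: ler_pM => //; [exact: pi_ge0|exact: dist2_ge0].
  have : 0 <= d%:R * std G j ^+ 2 by rewrite mulr_ge0 ?sqr_ge0.
  by lra.
rewrite !expRD in g1 g2 *.
have P0 : 0 < peak j * expR (- pi * dist2 G (ctr z) j / std G j ^+ 2) by rewrite mulr_gt0 ?expR_gt0.
set X : R := expR (- pi * dist2 G (ctr z) j / std G j ^+ 2) in g1 g2 g3 ht P0 *.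
rewrite ![peak j * (X * _)]mulrA in g1 g2 *.
move: (peak j * X : R) P0 g1 g2 g3 ht => A A0 g1 g2 g3 ht.
have u1 := @expR_upper R accuracy; have l1 := @expR_lower R accuracy.
have u2 : expR (13 / 100 * accuracy) + 35 / 100 * accuracy <= expR accuracy by apply: u1; lra.
have l2 : expR (- accuracy) <= expR (- (13 / 100 * accuracy)) - 1 / 10 * accuracy by apply: l1; lra.
have u3 : A * (expR (13 / 100 * accuracy) + 35 / 100 * accuracy) <= A * expR accuracy by rewrite ler_pM2l.
have l3 : A * expR (- accuracy) <= A * (expR (- (13 / 100 * accuracy)) - 1 / 10 * accuracy) by rewrite ler_pM2l.
move: hf; rewrite ler_norml => /andP[f1 f2]; apply/andP; split; lra.
Qed.

End Approximation.

(** * The discrete Laplacian of the mixture *)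

Section CoshBound.
Variable R : realType.

(** From (1 + x/4)^4 <= exp x; the coefficient 3/8 in place of 1/2 is good enough for
    subharmonicity. *)
Lemma expR_ge_quadratic (x : R) : 0 <= x -> 1 + x + 3 / 8 * x ^+ 2 <= expR x.
Proof.
move=> x0; have -> : x = 4%:R * (x / 4) by field.
rewrite expRM_natl; apply: le_trans (_ : (1 + x / 4) ^+ 4 <= _).
  have -> : (1 + x / 4) ^+ 4 = 1 + 4 * (x / 4) + 3 / 8 * (4 * (x / 4)) ^+ 2 + x ^+ 3 / 16 + x ^+ 4 / 256 by field.
  have : 0 <= x ^+ 3 by apply: exprn_ge0.
  have : 0 <= x ^+ 4 by apply: exprn_ge0.
  by lra.
by rewrite lerXn2r ?nnegrE ?expR_ge0 ?expR_ge1Dx //; lra.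
Qed.

Lemma cosh_ge (x : R) : 2 + 3 / 8 * x ^+ 2 <= expR x + expR (- x).
Proof.
wlog x0 : x / 0 <= x => [H|].
  have [x0|x0] := leP 0 x; first exact: H.
  by have := H (- x); rewrite opprK sqrrN [expR _ + _]addrC; apply; lra.
by have := expR_ge_quadratic x0; have := expR_ge1Dx (- x); lra.
Qed.

(* The sum on the right is exp(-u) (e^a + e^-a) times the middle value, where
   u = pi h^2/s^2 and a = 2 pi h (y - m)/s^2. *)
Lemma gauss1_lap (m s h y e : R) : 0 < s -> pi * h ^+ 2 / s ^+ 2 <= 1 -> e <= (y - m) ^+ 2 ->
  (1 - pi * h ^+ 2 / s ^+ 2) * (2 + 3 / 2 * (pi * h / s ^+ 2) ^+ 2 * e) * gauss1 m s y <=
  gauss1 m s (y + h) + gauss1 m s (y - h).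
Proof.
move=> s0 u1 he; have sn : s != 0 by rewrite gt_eqF.
set u := pi * h ^+ 2 / s ^+ 2 in u1 *.
pose a : R := 2 * pi * h * (y - m) / s ^+ 2.
have shift t : expR (- pi * (y + t * h - m) ^+ 2 / s ^+ 2) =
   expR (- pi * (y - m) ^+ 2 / s ^+ 2) * expR (- (t ^+ 2 * u)) * expR (- (t * a)).
  by rewrite -!expRD; congr expR; rewrite /u /a; field.
have gp : gauss1 m s (y + h) = gauss1 m s y * expR (- u) * expR (- a).
  by have := shift 1; rewrite /gauss1 expr1n !mul1r => ->; ring.
have gm : gauss1 m s (y - h) = gauss1 m s y * expR (- u) * expR a.
  by have := shift (- 1); rewrite /gauss1 sqrrN expr1n !mulN1r !mul1r opprK => ->; ring.
rewrite gp gm.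
have -> : gauss1 m s y * expR (- u) * expR (- a) + gauss1 m s y * expR (- u) * expR a =
  expR (- u) * (expR a + expR (- a)) * gauss1 m s y by ring.
apply: ler_wpM2r; first exact: gauss1_ge0.
apply: le_trans (_ : (1 - u) * (expR a + expR (- a)) <= _); last first.
  apply: ler_wpM2r; first by rewrite addr_ge0 ?expR_ge0.
  by apply: le_trans (expR_ge1Dx _); lra.
apply: ler_wpM2l; first lra.
apply: le_trans (cosh_ge a).
have -> : a ^+ 2 = 4 * ((pi * h / s ^+ 2) ^+ 2 * (y - m) ^+ 2) by rewrite /a; field.
have : (pi * h / s ^+ 2) ^+ 2 * e <= (pi * h / s ^+ 2) ^+ 2 * (y - m) ^+ 2.
  by rewrite ler_wpM2l ?sqr_ge0.
by lra.
Qed.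

End CoshBound.

Section Shifts.
Variable d : nat.
Implicit Types (z : 'I_d -> nat) (i : 'I_d).

Definition up z i (c : nat) : 'I_d -> nat := fun a => if a == i then (z a + c)%N else z a.
Definition dn z i (c : nat) : 'I_d -> nat := fun a => if a == i then (z a - c)%N else z a.

Lemma enc_up B z i c : enc B (up z i c) = (enc B z + c * B ^ i)%N.
Proof. exact: enc_shift. Qed.

Lemma enc_dn B z i c : (c <= z i)%N -> enc B (dn z i c) = (enc B z - c * B ^ i)%N.
Proof.
move=> h; suff -> : enc B z = (enc B (dn z i c) + c * B ^ i)%N by rewrite addnK.
rewrite -enc_shift; congr enc; apply: funext => a; rewrite /dn.
by case: eqP => // ->; rewrite subnK.
Qed.

Lemma prod_shift (R : realType) (f : 'I_d -> nat -> R) z i (v : nat) :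
  \prod_c f c (if c == i then v else z c) = f i v * \prod_(c | c != i) f c (z c).
Proof.
rewrite (bigD1 i) //= eqxx; congr (_ * _); apply: eq_bigr => c /negbTE ->; by [].
Qed.

End Shifts.

Section Subharmonic.
Variables (R : realType) (d k : nat) (G : mixture R d k) (M : nat).
Hypotheses (d0 : (0 < d)%N) (M0 : (0 < M)%N).
Notation h := (hstep R M).

Lemma edgeS t : edge R M t + h = edge R M t.+1.
Proof. by have := edge_step R M t; lra. Qed.

Lemma edgeP t : (0 < t)%N -> edge R M t - h = edge R M t.-1.
Proof. by move=> t0; have := edge_step R M t.-1; rewrite prednK //; lra. Qed.

Definition slab j (c : 'I_d) (t : nat) : R :=
  imass (gauss1 (mean G j 0 c) (std G j)) (edge R M t) (edge R M t.+1).

Lemma slab_ge0 j c t : 0 <= slab j c t.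
Proof. by apply: imass_gauss_ge0; exact: std_gt0. Qed.

Lemma sqr_shift_ge (x w e : R) : `|w| <= e / 2 -> 3 / 4 * (x ^+ 2 - e ^+ 2) <= (x + w) ^+ 2.
Proof.
rewrite ler_norml => /andP[w1 w2].
have a1 : 0 <= e / 2 - w by lra.
have a2 : 0 <= e / 2 + w by lra.
have := mulr_ge0 a1 a2; have := sqr_ge0 (x / 2 + 2 * w); lra.
Qed.

Lemma slab_lap j c t (u e : R) : (0 < t)%N -> u = pi * h ^+ 2 / std G j ^+ 2 -> u <= 1 ->
  e = 3 / 4 * ((center R M t - mean G j 0 c) ^+ 2 - h ^+ 2) ->
  0 <= 2 + 3 / 2 * (pi * h / std G j ^+ 2) ^+ 2 * e ->
  (1 - u) * (2 + 3 / 2 * (pi * h / std G j ^+ 2) ^+ 2 * e) * slab j c t <=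
  slab j c t.+1 + slab j c t.-1.
Proof.
move=> t0 uE u1 eE k0; have s0 := std_gt0 G j.
rewrite /slab prednK // -(edgeP t0) -(edgeS t.+1).
have -> : imass (gauss1 (mean G j 0 c) (std G j)) (edge R M t - h) (edge R M t) =
  imass (gauss1 (mean G j 0 c) (std G j)) (edge R M t - h) (edge R M t.+1 - h).
  by rewrite (edgeP (t := t.+1)).
have -> : imass (gauss1 (mean G j 0 c) (std G j)) (edge R M t.+1) (edge R M t.+1 + h) =
  imass (gauss1 (mean G j 0 c) (std G j)) (edge R M t + h) (edge R M t.+1 + h).
  by rewrite (edgeS t).
apply: (imass_lap (K := (std G j)^-1)).
- exact: measurable_gauss1.
- by move=> y; apply: gauss1_ge0.
- by move=> y; apply: gauss1_le.
- exact: edge_le_step.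
- by apply: mulr_ge0 => //; rewrite subr_ge0.
move=> y /andP[y1 y2]; rewrite uE; apply: gauss1_lap => //; first by rewrite -uE.
have hy : `|y - center R M t| <= h / 2 by apply: cell_near; rewrite y1 ltW.
have -> : (y - mean G j 0 c) ^+ 2 = ((center R M t - mean G j 0 c) + (y - center R M t)) ^+ 2.
  by congr (_ ^+ 2); ring.
by rewrite eE; exact: sqr_shift_ge.
Qed.

Lemma own_massE j z : own_mass G M j z = weight G j * \prod_c slab j c (z c).
Proof. by []. Qed.

Lemma own_mass_step j z i : own_mass G M j (up z i 1) + own_mass G M j (dn z i 1) =
  weight G j * ((slab j i (z i).+1 + slab j i (z i).-1) * \prod_(c | c != i) slab j c (z c)).
Proof.
have E (v : nat) (z' : 'I_d -> nat) : (forall c, z' c = if c == i then v else z c) ->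
    own_mass G M j z' = weight G j * (slab j i v * \prod_(c | c != i) slab j c (z c)).
  move=> hz'; rewrite own_massE -(prod_shift (slab j) z); congr (_ * _).
  by apply: eq_bigr => c _; rewrite hz'.
have E1 c : up z i 1 c = if c == i then (z i).+1 else z c.
  by rewrite /up addn1; case: (altP eqP) => [->|].
have E2 c : dn z i 1 c = if c == i then (z i).-1 else z c.
  by rewrite /dn subn1; case: (altP eqP) => [->|].
by rewrite (E _ _ E1) (E _ _ E2) -mulrDr -mulrDl.
Qed.

Lemma lap_constant (u D n q X : R) : 0 <= u -> u <= 1 / 100 -> 0 <= n ->
  198 / 100 * n * u <= X -> 2 * n <= (1 - u) * (n * 2 + 9 / 8 * X).
Proof.
move=> u0 u1 n0 hX.
have n1 : 0 <= n * u by rewrite mulr_ge0.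
have n2 : 0 <= (1 / 100 - u) * X by rewrite mulr_ge0; lra.
by lra.
Qed.

Lemma step_small (s : R) : 0 < s -> h <= s / 64 ->
  h ^+ 2 <= s ^+ 2 / 100 /\ 0 <= pi * h ^+ 2 / s ^+ 2 <= 1 / 100.
Proof.
move=> s0 hs; have h0 := hstep_gt0 R M0.
have pi4 : pi <= 4 :> R by have := pihalf_lt2 R; lra.
have s2 : 0 < s ^+ 2 by rewrite exprn_gt0.
have h1 : h ^+ 2 <= (s / 64) ^+ 2 by rewrite lerXn2r ?nnegrE //; [exact: ltW|rewrite divr_ge0 // ltW].
have h2 : h ^+ 2 <= s ^+ 2 / 400 by rewrite exprMn in h1; lra.
split; first lra.
apply/andP; split.
  by rewrite divr_ge0 ?sqr_ge0 // mulr_ge0 ?sqr_ge0 // pi_ge0.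
rewrite ler_pdivrMr //; apply: le_trans (_ : 4 * (s ^+ 2 / 400) <= _); last by lra.
by apply: ler_pM => //; [exact: pi_ge0|exact: sqr_ge0].
Qed.

(** A single coordinate may have a negative second difference; only the sum is controlled. Relative
    to the mass and up to small terms, with u = pi h^2/sigma^2, the loss is 2 d u and the gain 9/8
    pi u dist2/sigma^2, which wins since 9/8 pi > 2. *)
Lemma own_mass_lap j z : h <= std G j / 64 -> (forall i, (0 < z i)%N) ->
  d%:R * std G j ^+ 2 < dist2 G (ctr R M z) j ->
  2 * d%:R * own_mass G M j z <= \sum_i (own_mass G M j (up z i 1) + own_mass G M j (dn z i 1)).
Proof.
move=> hs z0 hD; have s0 := std_gt0 G j; have sn : std G j != 0 by rewrite gt_eqF.
have [hs2 /andP[u0 u1]] := step_small s0 hs.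
pose u : R := pi * h ^+ 2 / std G j ^+ 2.
pose e (c : 'I_d) : R := 3 / 4 * ((ctr R M z c - mean G j 0 c) ^+ 2 - h ^+ 2).
pose w : R := (pi * h / std G j ^+ 2) ^+ 2.
pose kp (c : 'I_d) : R := (1 - u) * (2 + 3 / 2 * w * e c).
have w0 : 0 <= w by apply: sqr_ge0.
have v1 : w * h ^+ 2 <= 1.
  have -> : w * h ^+ 2 = u ^+ 2 by rewrite /w /u; field.
  by rewrite expr_le1 // (le_trans u1) //; lra.
have k0 c : 0 <= 2 + 3 / 2 * w * e c.
  have : 0 <= w * (ctr R M z c - mean G j 0 c) ^+ 2 by rewrite mulr_ge0 ?sqr_ge0.
  by rewrite /e; move: v1; clear; lra.
have u1' : u <= 1 by apply: le_trans u1 _; lra.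
have lapc c : kp c * slab j c (z c) <= slab j c (z c).+1 + slab j c (z c).-1.
  by apply: slab_lap => //; exact: k0.
rewrite own_massE (eq_bigr _ (fun i _ => own_mass_step j z i)) -mulr_sumr mulrCA ler_pM2l ?weight_gt0 //.
apply: le_trans (_ : \sum_i (kp i * \prod_c slab j c (z c)) <= _); last first.
  apply: ler_sum => i _; rewrite [in leLHS](bigD1 i) //= mulrA ler_wpM2r //.
  by apply: prodr_ge0 => c _; exact: slab_ge0.
rewrite -mulr_suml; apply: ler_wpM2r.
  by apply: prodr_ge0 => c _; exact: slab_ge0.
rewrite /kp -mulr_sumr big_split /= sumr_const card_ord -[2 *+ d]mulr_natl.
have -> : \sum_(i < d) (3 / 2 * w * e i) = 9 / 8 * (w * (dist2 G (ctr R M z) j - d%:R * h ^+ 2)).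
  rewrite -mulr_sumr /e -mulr_sumr sumrB sumr_const card_ord -[(h ^+ 2) *+ d]mulr_natl /dist2.
  by field.
apply: (lap_constant 0 0) => //.
have pi2 : 2 <= pi :> R := pi_ge2 R.
have d1 : d%:R * h ^+ 2 <= d%:R * (std G j ^+ 2 / 100) by rewrite ler_pM2l ?ltr0n.
apply: le_trans (_ : w * (d%:R * std G j ^+ 2 * (99 / 100)) <= _); last first.
  by rewrite ler_wpM2l //; lra.
have -> : w * (d%:R * std G j ^+ 2 * (99 / 100)) = 99 / 100 * (d%:R * (pi * u)).
  by rewrite /w /u; field.
have : d%:R * (2 * u) <= d%:R * (pi * u) by rewrite ler_wpM2l // ler_wpM2r.
by move: (pi * u) => pu; clear; lra.
Qed.

Lemma cell_mass_lap z : (forall j, h <= std G j / 64) -> (forall i, (0 < z i)%N) ->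
  (forall j, d%:R * std G j ^+ 2 < dist2 G (ctr R M z) j) ->
  2 * d%:R * cell_mass G M z <= \sum_i (cell_mass G M (up z i 1) + cell_mass G M (dn z i 1)).
Proof.
move=> hs z0 hD; rewrite /cell_mass mulr_sumr.
under [leRHS]eq_bigr do rewrite -big_split /=.
by rewrite exchange_big /=; apply: ler_sum => j _; exact: own_mass_lap.
Qed.

End Subharmonic.

(** * The acceptance test in terms of frequencies; cells outside all cores fail it *)

Section InteriorCells.
Variables (d M : nat).
Implicit Types (z : 'I_d -> nat).

Definition interior_cell z : Prop := forall i, interior (M ^ 2) (z i).

Lemma interior_lt z : interior_cell z -> forall i, (z i < M ^ 2)%N.
Proof. by move=> h i; have /andP[_] := h i; lia. Qed.

Lemma interior_inner z : interior_cell z -> inner_cell (M ^ 2) z.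
Proof. by move=> hz i; have /andP[] := hz i; lia. Qed.

Lemma inner_up z i : interior_cell z -> inner_cell (M ^ 2) (up z i 1).
Proof. by move=> hz c; have /andP[] := hz c; rewrite /up; case: eqP; lia. Qed.

Lemma inner_dn z i : interior_cell z -> inner_cell (M ^ 2) (dn z i 1).
Proof. by move=> hz c; have /andP[] := hz c; rewrite /dn; case: eqP; lia. Qed.

End InteriorCells.

Section PassTest.
Variables (R : realType) (d : nat) (M N Q FL : nat) (F : nat -> nat).
Hypotheses (M0 : (0 < M)%N) (N0 : (0 < N)%N).
Notation freq := (freq R M N F).
Implicit Types (z : 'I_d -> nat).

Let NR : 0 < N%:R :> R. Proof. by rewrite ltr0n. Qed.

Lemma interior_digits z : (forall i, (z i < M ^ 2)%N) ->
  reflect (interior_cell M z) (\big[andb/true]_(i < d) interior (M ^ 2) (digit (M ^ 2) (enc (M ^ 2) z) i)).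
Proof.
move=> hz; apply: (iffP idP) => [h i|h].
  by move: h; rewrite big_andE => /forallP /(_ i); rewrite digit_enc.
by rewrite big_andE; apply/forallP => i; rewrite digit_enc // h.
Qed.

Lemma freq_lap z : (forall i, (0 < z i)%N) ->
  (lapsum d (M ^ 2) F (enc (M ^ 2) z))%:R = N%:R * \sum_i (freq (up z i 1) + freq (dn z i 1)).
Proof.
move=> hz; rewrite /lapsum natr_sum mulr_sumr; apply: eq_bigr => i _.
by rewrite natrD /freq enc_up enc_dn // mul1n -mulrDl mulrC mulfVK // gt_eqF.
Qed.

Lemma freqE z : (F (enc (M ^ 2) z))%:R = N%:R * freq z.
Proof. by rewrite /freq mulrC mulfVK // gt_eqF. Qed.

Lemma passesP z : (forall i, (z i < M ^ 2)%N) ->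
  passes d (M ^ 2) Q FL N F (enc (M ^ 2) z) <->
  [/\ interior_cell M z,
      (\sum_i (freq (up z i 1) + freq (dn z i 1))) * Q%:R + freq z <= 2 * d%:R * freq z * Q%:R &
      1 <= freq z * FL%:R].
Proof.
move=> hz.
have key : interior_cell M z -> ((lapsum d (M ^ 2) F (enc (M ^ 2) z) * Q + F (enc (M ^ 2) z) <=
    2 * d * F (enc (M ^ 2) z) * Q)%N = ((\sum_i (freq (up z i 1) + freq (dn z i 1))) * Q%:R + freq z <= 2 * d%:R * freq z * Q%:R)) /\
    ((N <= F (enc (M ^ 2) z) * FL)%N = (1 <= freq z * FL%:R)).
  move=> hi; have z0 i : (0 < z i)%N by have /andP[] := hi i; lia.
  split.
    rewrite -(ler_nat R) natrD !natrM freq_lap // !freqE.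
    set S := \sum_i _; rewrite -[RHS](ler_pM2l NR); congr (_ <= _); ring.
  by rewrite -(ler_nat R) natrM freqE -[RHS](ler_pM2l NR) mulr1 [in RHS]mulrA.
rewrite /passes; split.
  by case/and3P => /(interior_digits hz) hi => h1 h2; have [k1 k2] := key hi; rewrite -k1 -k2.
case=> hi h1 h2; have [k1 k2] := key hi; rewrite -k1 in h1; rewrite -k2 in h2.
by apply/and3P; split=> //; exact/(interior_digits hz).
Qed.

End PassTest.

Section Noncore.
Variables (R : realType) (d k : nat) (G : mixture R d k) (M N Q FL : nat) (F : nat -> nat) (tau : R).
Hypotheses (d0 : (0 < d)%N) (M0 : (0 < M)%N) (N0 : (0 < N)%N).
Notation freq := (freq R M N F).
Hypothesis hs : forall j, hstep R M <= std G j / 64.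
Hypothesis hF : forall z : 'I_d -> nat, inner_cell (M ^ 2) z -> `|freq z - cell_mass G M z| <= tau.
Hypothesis hnoise : 4 * d%:R * tau * Q%:R * FL%:R < 1.

(** Outside all cores the exact Laplacian is nonnegative, so the observed one is at least -4 d tau.
    Passing requires it to be at most -f/Q with f >= 1/FL, hence 1 <= 4 d tau Q FL, against
    [hnoise]. *)
Lemma passes_core (z : 'I_d -> nat) : (forall i, (z i < M ^ 2)%N) ->
  passes d (M ^ 2) Q FL N F (enc (M ^ 2) z) ->
  exists j, dist2 G (ctr R M z) j <= d%:R * std G j ^+ 2.
Proof.
move=> hz /(passesP R Q FL F M0 N0 hz) [hi h1 h2].
apply: contrapT => /forallNP hn.
have hn' j : d%:R * std G j ^+ 2 < dist2 G (ctr R M z) j by rewrite ltNge; apply/negP.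
have z0 i : (0 < z i)%N by have /andP[] := hi i; lia.
have := cell_mass_lap d0 M0 hs z0 hn' => lap.
have L1 : \sum_i (cell_mass G M (up z i 1) + cell_mass G M (dn z i 1)) - 2 * d%:R * tau <=
   \sum_i (freq (up z i 1) + freq (dn z i 1)).
  have -> : 2 * d%:R * tau = \sum_(i < d) (2 * tau).
    by rewrite sumr_const card_ord -[RHS]mulr_natl; ring.
  rewrite -sumrB; apply: ler_sum => i _.
  have a1 := hF (inner_up i hi); have a2 := hF (inner_dn i hi).
  rewrite ler_norml in a1; rewrite ler_norml in a2.
  by move: a1 a2; move: (freq _) (freq _) (cell_mass _ _ _) (cell_mass _ _ _) => a b e f; lra.
have := hF (interior_inner hi); rewrite ler_norml => /andP[_ f1].
have f2 : 2 * d%:R * (freq z - cell_mass G M z) <= 2 * d%:R * tau.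
  by rewrite ler_wpM2l // mulr_ge0.
have f3 : freq z <= 4 * d%:R * tau * Q%:R.
  have : (2 * d%:R * freq z - 4 * d%:R * tau) * Q%:R <= (\sum_i (freq (up z i 1) + freq (dn z i 1))) * Q%:R.
    by rewrite ler_wpM2r //; move: L1 f2 lap; move: (\sum_i _) (\sum_i _) => S S'; lra.
  by move: h1; lra.
have : freq z * FL%:R <= 4 * d%:R * tau * Q%:R * FL%:R by rewrite ler_wpM2r.
by move: h2 hnoise; lra.
Qed.

End Noncore.

(** * Maximizing over a box of cells, and the paraboloid *)

Section BoxArgmax.
Variables (R : realType) (d : nat).

Definition in_box (z0 : 'I_d -> nat) n (z : 'I_d -> nat) : Prop :=
  forall c, (z0 c - n <= z c <= z0 c + n)%N.

Lemma box_argmax (z0 : 'I_d -> nat) n (psi : ('I_d -> nat) -> R) :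
  exists z, in_box z0 n z /\ forall z', in_box z0 n z' -> psi z' <= psi z.
Proof.
(* The minimum matters when truncated subtraction has cut the box at 0, so that it has fewer than 2
   n + 1 cells in this coordinate. *)
pose zof (t : {ffun 'I_d -> 'I_(2 * n).+1}) c := minn (z0 c - n + t c) (z0 c + n).
have zofP z : in_box z0 n z -> exists t, zof t = z.
  move=> hz; exists [ffun c => inord (z c - (z0 c - n))]; apply: funext => c.
  by rewrite /zof ffunE inordK; have := hz c; [move=> /andP[h1 h2]; rewrite (minn_idPl _); lia|lia].
have [t _ ht] := Order.TotalTheory.arg_maxP (fun t => psi (zof t)) (isT : xpredT [ffun=> ord0]).
exists (zof t); split; first by move=> c; rewrite /zof; lia.
by move=> z' /zofP [t' <-]; exact: ht.
Qed.

End BoxArgmax.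

Section Paraboloid.
Variables (R : realType) (d : nat).
Implicit Types (z : 'I_d -> nat).

(** Its second difference is 2 in every coordinate; at a maximum of f + a [offset2] the discrete
    Laplacian of f is therefore at most -2 d a. *)
Definition offset2 z0 z : R := \sum_c ((z c)%:R - (z0 c)%:R) ^+ 2.

Lemma offset2_up z0 z i : offset2 z0 (up z i 1) = offset2 z0 z + 2 * ((z i)%:R - (z0 i)%:R) + 1.
Proof.
rewrite /offset2 (bigD1 i) //= [in RHS](bigD1 i) //= /up eqxx natrD.
under eq_bigr => c /negbTE -> do [].
set S := \sum_(c | _) _; ring.
Qed.

Lemma offset2_dn z0 z i : (0 < z i)%N ->
  offset2 z0 (dn z i 1) = offset2 z0 z - 2 * ((z i)%:R - (z0 i)%:R) + 1.
Proof.
move=> zi; rewrite /offset2 (bigD1 i) //= [in RHS](bigD1 i) //= /dn eqxx natrB //.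
under eq_bigr => c /negbTE -> do [].
set S := \sum_(c | _) _; ring.
Qed.

Lemma offset2_le z0 z n : in_box z0 n z -> offset2 z0 z <= d%:R * n%:R ^+ 2.
Proof.
move=> hz; rewrite -[d%:R * _](_ : \sum_(c < d) n%:R ^+ 2 = _); last first.
  by rewrite sumr_const card_ord -[LHS]mulr_natl.
apply: ler_sum => c _; have /andP[b1 b2] := hz c.
rewrite leq_subLR addnC -(ler_nat R) natrD in b1; rewrite -(ler_nat R) natrD in b2.
by rewrite -real_normK ?num_real // lerXn2r ?nnegrE // ler_norml; lra.
Qed.

End Paraboloid.

Lemma range_interior B t : (3 <= t)%N && (t + 4 <= B)%N -> interior B t.
Proof. by move=> /andP[h1 h2]; apply/andP; split; [exact: ltnW|apply: leq_trans h2; rewrite leq_add2l]. Qed.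

Lemma interior_gt1 B t : interior B t -> (1 < t)%N.
Proof. by case/andP. Qed.

Lemma step_up_box a b n : (a - n <= b <= a + n)%N -> b != (a + n)%N -> (a - n <= b + 1 <= a + n)%N.
Proof. lia. Qed.

Lemma step_dn_box a b n : (a - n <= b <= a + n)%N -> b != (a - n)%N -> (a - n <= b - 1 <= a + n)%N.
Proof. lia. Qed.

(** * Numerical inequalities for finding a core and reading off its parameters *)

Section CoreNumeric.
Variable R : realType.

Lemma expR_lt2 (x : R) : x <= 3 / 64 -> expR x <= 11 / 10.
Proof.
move=> hx; have h : 1 - 3 / 64 <= expR (- x) by apply: le_trans (expR_ge1Dx _); lra.
have e1 : expR x * expR (- x) = 1 by rewrite -expRD subrr expR0.
have := ler_wpM2l (expR_ge0 x) h; rewrite e1; lra.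
Qed.

Lemma expRN1_le : expR (- 1) <= 1 / 2 :> R.
Proof.
rewrite expRN div1r lef_pV2 ?posrE ?expR_gt0 //.
by apply: le_trans (expR_ge1Dx 1); lra.
Qed.

Lemma side_sqr (h s t D : R) : 0 < s -> 0 < h -> h <= s / 64 -> 3 / 4 * s - h <= t ->
  t - h / 2 <= D -> 21 / 40 * s ^+ 2 <= D ^+ 2.
Proof.
move=> s0 h0 hs h1 h2; have h3 : 29 / 40 * s <= D by lra.
have : (29 / 40 * s) ^+ 2 <= D ^+ 2 by rewrite lerXn2r ?nnegrE //; lra.
have : 0 < s ^+ 2 by rewrite exprn_gt0.
rewrite exprMn; lra.
Qed.

Lemma box_offset (a b v h s w : R) : 0 < s -> h <= s / 64 -> `|w| <= h / 2 ->
  a <= b + v -> b <= a + v -> v <= 3 / 4 * s -> `|a - b + w| <= 19 / 25 * s.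
Proof. by rewrite !ler_norml => s0 h1 /andP[w1 w2] h2 h3 h4; lra. Qed.

Lemma box_sqr (e s : R) : 0 <= e -> e * (19 / 25 * s) ^+ 2 <= 3 / 5 * (e * s ^+ 2).
Proof.
by move=> e0; have : 0 <= e * s ^+ 2 by [rewrite mulr_ge0 ?sqr_ge0]; rewrite exprMn; lra.
Qed.

Lemma lt_next (x n h : R) : x <= (n + 1) * h -> x - h <= n * h.
Proof. lra. Qed.

Lemma radius_gt0 (s h v : R) : 0 < s -> h <= s / 64 -> 3 / 4 * s - h <= v -> 0 < v.
Proof. lra. Qed.

Lemma box_le5 (e f : R) : 0 <= e * f -> 3 / 5 * (e * f) <= 5 * e * f.
Proof. lra. Qed.

Lemma eqW (x y : R) : x = y -> x <= y.
Proof. by move=> ->. Qed.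

Lemma nine_tenth (x y z : R) : x <= y + z -> z <= x / 10 -> 9 / 10 * x <= y.
Proof. lra. Qed.

Lemma home_small (e s h d p D : R) : 1 <= d -> 0 < s -> 0 < h -> h <= s / 64 -> 100 * d * h <= e * s ->
  0 <= p <= 4 -> 0 <= D <= d * (h / 2) ^+ 2 -> p * D <= e * s ^+ 2.
Proof.
move=> d1 s0 h0 hs he /andP[p0 p4] /andP[D0 hD].
apply: le_trans (ler_pM p0 D0 p4 hD) _.
have -> : 4 * (d * (h / 2) ^+ 2) = d * h * h by field.
have dh : 0 <= d * h by rewrite mulr_ge0 ?(ltW h0) //; lra.
have h1 : d * h * h <= d * h * (s / 64) by rewrite ler_wpM2l.
have h2 : 100 * d * h * s <= e * s * s by rewrite ler_pM2r.
have h3 : 0 <= d * h * s by rewrite mulr_ge0 // ltW.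
by rewrite expr2; lra.
Qed.

Lemma negE (u v w : R) : - u * v / w = - (u * v / w).
Proof. by rewrite !mulNr. Qed.

Lemma twice_side (s D : R) : 21 / 40 * s <= D -> 21 / 20 * s <= 2 * D.
Proof. lra. Qed.

Lemma half_absurd (x y : R) : 0 < x -> 9 / 10 * x <= y -> y <= x / 2 -> False.
Proof. lra. Qed.

Lemma side_up (a n h w : R) : `|w| <= h / 2 -> n - h / 2 <= `|a + n - a + w|.
Proof. by rewrite ler_norml => /andP[w1 w2]; apply: le_trans (ler_norm _); lra. Qed.

Lemma side_dn (a n h w : R) : `|w| <= h / 2 -> n - h / 2 <= `|a - n - a + w|.
Proof. by rewrite ler_norml => /andP[w1 w2]; rewrite -normrN; apply: le_trans (ler_norm _); lra. Qed.

Lemma paraboloid_step (f fu fd a o x : R) :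
  fd + a * (o - 2 * x + 1) <= f + a * o -> fu + a * (o + 2 * x + 1) <= f + a * o ->
  fu + fd <= 2 * f - 2 * a.
Proof. lra. Qed.

Lemma box_le1 (e f : R) : 0 <= e * f -> 3 / 5 * (e * f) <= e * f.
Proof. lra. Qed.

Lemma box_le4 (e f : R) : 0 <= e * f -> 4 * (3 / 5 * (e * f)) <= 4 * e * f.
Proof. lra. Qed.

Lemma budget (s m n : R) : 10 * s ^+ 2 <= m -> n ^+ 2 <= (3 / 4 * s * m) ^+ 2 -> 10 * n ^+ 2 <= m ^+ 3.
Proof.
move=> hs hn; have h1 : 10 * s ^+ 2 * m ^+ 2 <= m * m ^+ 2 by rewrite ler_wpM2r ?sqr_ge0.
have h2 : 0 <= s ^+ 2 * m ^+ 2 by rewrite mulr_ge0 ?sqr_ge0.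
by move: hn; rewrite !exprMn exprS; lra.
Qed.

Lemma pass_arith (f D S Q a z : R) : f <= 2 * z -> 2 * z <= 2 * D * a * Q ->
  S * Q <= (2 * D * f - 2 * D * a) * Q -> S * Q + f <= 2 * D * f * Q.
Proof. lra. Qed.

Lemma floor_exp (D e x : R) : 1 <= D -> e <= 1 / 64 -> x <= 4 * D -> - (5 * D) <= - x - e.
Proof. lra. Qed.

Lemma core_ratio (A x y e b : R) : 0 < A -> 0 <= e -> e <= 1 / 64 -> 0 <= x -> x <= e -> y <= - (21 / 20) ->
  A * expR (- x - e) <= b -> A * expR (y + e) <= b / 2.
Proof.
move=> A0 e0 e1 x0 xe hy hb; have b1 : A * expR (- x - e) / 2 <= b / 2 by rewrite ler_pM2r.
apply: le_trans b1; rewrite -mulrA ler_pM2l //.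
apply: le_trans (_ : expR (- x - e) * expR (- 1) <= _); last first.
  by rewrite ler_wpM2l ?expR_ge0 //; have := expRN1_le; lra.
by rewrite -expRD ler_expR; lra.
Qed.

Lemma mid_ratio (A x y e b : R) : 0 < A -> 0 <= e -> e <= 1 / 64 -> 0 <= x -> x <= e -> y <= 0 ->
  A * expR (- x - e) <= b -> A * expR (y + e) <= 2 * b.
Proof.
move=> A0 e0 e1 x0 xe hy hb; have b1 : 2 * (A * expR (- x - e)) <= 2 * b by rewrite ler_pM2l.
apply: le_trans b1; rewrite mulrCA ler_pM2l //.
have h : expR (3 / 64) <= 2 :> R by have := @expR_lt2 (3 / 64) (lexx _); lra.
apply: le_trans (_ : expR (3 / 64) * expR (- x - e) <= _).
  by rewrite -expRD ler_expR; lra.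
by rewrite ler_wpM2r ?expR_ge0.
Qed.

End CoreNumeric.

(** The scan goes downwards from B to 1 and remembers the last success, which is the smallest
    one. *)
Lemma srchP (P : pred nat) B c1 (f := iteri B (fun t c => if P (B - t)%N then (B - t)%N else c) 0%N) :
  (0 < c1 <= B)%N -> P c1 ->
  [/\ P f, (0 < f <= c1)%N & forall c, (0 < c < f)%N -> ~~ P c].
Proof.
move=> /andP[c0 cB] Pc; rewrite {}/f.
pose Q t v := (v = 0%N /\ forall c, (B - t < c <= B)%N -> ~~ P c) \/
    [/\ P v, (B - t < v <= B)%N & forall c, (B - t < c < v)%N -> ~~ P c].
have : Q B (iteri B (fun t c => if P (B - t)%N then (B - t)%N else c) 0%N).
  apply: (iteri_ind (Q := Q)) => [|t v tB ih]; first by left; split => // c; rewrite subn0; lia.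
  case: ifP => Pt.
    by right; split => //; [lia|move=> c; lia].
  have ne c : c = (B - t)%N -> ~~ P c by move=> ->; rewrite Pt.
  case: ih => [[-> h]|[Pv hv h]]; [left|right]; split => //.
  - move=> c hc; have [/ne //|] := eqVneq c (B - t)%N => cn; apply: h; lia.
  - lia.
  - move=> c hc; have [/ne //|] := eqVneq c (B - t)%N => cn; apply: h; lia.
case=> [[_ h]|[Pv hv h]]; first by have := h c1; rewrite Pc subnn c0 cB => /(_ isT).
rewrite subnn in h hv; have /andP[v0 _] := hv; split => //.
rewrite v0 leqNgt; apply/negP => cv; have := h c1; rewrite Pc c0 cv => /(_ isT); by [].
Qed.

Lemma shift_inner t c B : (c + 3 <= t)%N -> (t + c + 4 <= B)%N ->
  ((0 < t + c)%N && ((t + c).+1 < B)%N) /\ ((0 < t - c)%N && ((t - c).+1 < B)%N).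
Proof. by move=> h1 h2; split; apply/andP; split; lia. Qed.

Section RefineNumeric.
Variable R : realType.
Implicit Types (D E M h m s u v x : R).

Lemma coord_of_dist D s v : 1 <= D -> 0 < s -> v ^+ 2 <= 11 / 10 * D * s ^+ 2 -> `|v| <= 3 / 2 * D * s.
Proof.
move=> D1 s0 hv; rewrite -ler_sqr ?nnegrE ?mulr_ge0 //; [|by lra|exact: ltW].
rewrite real_normK ?num_real //; apply: le_trans hv _.
have -> : (3 / 2 * D * s) ^+ 2 = 9 / 4 * (D * D) * s ^+ 2 by rewrite !exprMn !expr2; field.
have h1 : D <= D * D by rewrite ler_peMl //; lra.
by apply: ler_wpM2r; rewrite ?sqr_ge0 //; lra.
Qed.

Lemma shift_dist D E s v x : 1 <= D -> 0 < s -> 0 <= x -> x <= 11 / 10 * s ->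
  v ^+ 2 <= E -> E <= 11 / 10 * D * s ^+ 2 ->
  E + 2 * v * x + x ^+ 2 <= 5 * D * s ^+ 2 /\ E - 2 * v * x + x ^+ 2 <= 5 * D * s ^+ 2.
Proof.
move=> D1 s0 x0 xs hv hD.
have x2 : x ^+ 2 <= 121 / 100 * s ^+ 2.
  have : x ^+ 2 <= (11 / 10 * s) ^+ 2 by rewrite lerXn2r ?nnegrE // mulr_ge0 // ltW.
  by rewrite exprMn; lra.
have s2 : s ^+ 2 <= D * s ^+ 2 by rewrite ler_peMl ?sqr_ge0.
have q1 := sqr_ge0 (v + x); have q2 := sqr_ge0 (v - x); rewrite sqrrD in q1; rewrite sqrrB in q2.
by split; lra.
Qed.

Lemma range_shift_lo u s D m M h x : 1 <= D -> 0 < s -> h <= 1 -> 0 < h -> `|m| + 3 * D * s + 4 <= M / 2 ->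
  `|u + h / 2 - M / 2 - m| <= 3 / 2 * D * s -> x <= 11 / 10 * s ->
  x + 3 * h <= u /\ u + x + 4 * h <= M.
Proof.
move=> D1 s0 h1 h0 hm hu hx; have hs : s <= D * s by rewrite ler_peMl // ltW.
have m1 := ler_norm m; have m2 : - m <= `|m| by rewrite -normrN ler_norm.
by move: hu; rewrite ler_norml => /andP[u1 u2]; split; lra.
Qed.

End RefineNumeric.

Section SearchNumeric.
Variable R : realType.
Implicit Types (A b l e w y p U V W : R).

(** The linear parts [l] cancel in the product of the two opposite values, so the width can be read
    off before the mean is known. With p = pi and y = (c h/sigma)^2, comparing exponents leaves p (1
    - y) <= 2 e. *)
Lemma search_true A b l e w y p U V W : 0 < A -> 0 <= e -> 2 <= p -> b = w + p * y ->
  A * expR (- (b + l) - e) <= U -> A * expR (- (b - l) - e) <= V -> 0 <= W -> W <= A * expR (- w + e) ->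
  U * V <= expR (- (2 * p)) * (W * W) -> 1 - e <= y.
Proof.
move=> A0 e0 p2 hb hU hV W0 hW hUV.
have B0 x : 0 <= A * expR x by rewrite mulr_ge0 ?expR_ge0 // ltW.
have h1 := ler_pM (B0 _) (B0 _) hU hV.
have h2 : expR (- (2 * p)) * (W * W) <= expR (- (2 * p)) * ((A * expR (- w + e)) * (A * expR (- w + e))).
  by rewrite ler_pM2l ?expR_gt0 //; exact: ler_pM.
have := le_trans h1 (le_trans hUV h2).
rewrite mulrACA [X in _ <= _ * X]mulrACA [X in _ <= X]mulrCA -!expRD ler_pM2l ?mulr_gt0 // ler_expR hb => h3.
have h4 : p * (1 - y) <= 2 * e by lra.
have [|h] := lerP (1 - e) y => //.
have : 2 * (1 - y) <= p * (1 - y) by rewrite ler_wpM2r //; lra.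
by lra.
Qed.

Lemma search_false A b l e w y p U V W : 0 < A -> 0 <= e -> 2 <= p -> b = w + p * y ->
  0 <= U -> 0 <= V ->
  U <= A * expR (- (b + l) + e) -> V <= A * expR (- (b - l) + e) -> A * expR (- w - e) <= W ->
  expR (- (2 * p)) * (W * W) < U * V -> y <= 1 + e.
Proof.
move=> A0 e0 p2 hb U0 V0 hU hV hW hUV.
have B0 x : 0 <= A * expR x by rewrite mulr_ge0 ?expR_ge0 // ltW.
have h1 := ler_pM U0 V0 hU hV.
have h2 : expR (- (2 * p)) * ((A * expR (- w - e)) * (A * expR (- w - e))) <= expR (- (2 * p)) * (W * W).
  by rewrite ler_pM2l ?expR_gt0 //; exact: ler_pM.
have := le_trans h2 (le_trans (ltW hUV) h1).
rewrite [X in _ * X <= _]mulrACA [X in X <= _]mulrCA [X in _ <= X]mulrACA -!expRD ler_pM2l ?mulr_gt0 // ler_expR hb => h3.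
have h4 : p * (y - 1) <= 2 * e by lra.
have [|h] := lerP y (1 + e) => //.
have : 2 * (y - 1) <= p * (y - 1) by rewrite ler_wpM2r //; lra.
by lra.
Qed.

Lemma near_one_lo y e : 0 <= e -> e <= 1 / 64 -> 0 <= y -> 1 - e <= y ^+ 2 -> 1 - e <= y.
Proof.
move=> e0 e1 y0; have [//|h] := lerP (1 - e) y.
have : y * y <= 1 * y by rewrite ler_wpM2r //; lra.
by rewrite expr2; lra.
Qed.

Lemma near_one_hi y e : 0 <= e -> y ^+ 2 <= 1 + e -> y <= 1 + e / 2.
Proof.
move=> e0 hy; have [//|h] := lerP y (1 + e / 2).
have : (1 + e / 2) ^+ 2 < y ^+ 2 by rewrite ltrXn2r // ?nnegrE; lra.
have -> : (1 + e / 2) ^+ 2 = 1 + e + (e / 2) ^+ 2 by field.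
by have := sqr_ge0 (e / 2); lra.
Qed.

Lemma last_step (u s e h : R) : 0 < e * s -> h <= e * s / 100 -> u * h <= (1 + e / 2) * s ->
  (u + 1) * h <= (1 + e) * s.
Proof. lra. Qed.

End SearchNumeric.

Section MoveNumeric.
Variable R : realType.
Implicit Types (A b l e s x v h p n U V : R).

Lemma move_slope A b l e U V : 0 < A -> A * expR (- (b - l) - e) <= V -> U <= A * expR (- (b + l) + e) ->
  V <= U -> l <= e.
Proof.
move=> A0 hV hU hVU; have := le_trans hV (le_trans hVU hU).
by rewrite ler_pM2l // ler_expR; lra.
Qed.

Lemma slope_offset p v x s e : 2 <= p -> 0 < s -> 0 < e -> 3 / 4 * s <= x ->
  p * (2 * v * x) / s ^+ 2 <= e -> v <= e * s / 3.
Proof.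
move=> p2 s0 e0 hx; rewrite ler_pdivrMr ?exprn_gt0 // => h1.
have [v0|v0] := lerP v 0; first by apply: le_trans v0 _; rewrite divr_ge0 // mulr_ge0 // ltW.
have h2 : v * (3 / 4 * s) <= v * x by rewrite ler_pM2l.
have vx : 0 <= v * x by apply: le_trans h2; rewrite mulr_ge0 ?(ltW v0) //; lra.
have h3 : 2 * (v * x) <= p * (v * x) by rewrite ler_wpM2r.
have : 3 * v * s <= e * s * s by move: h1; rewrite expr2; lra.
by rewrite ler_pM2r //; lra.
Qed.

(** A step either comes closer to the mean by h or stays within the zone of radius [n], where it may
    overshoot but cannot escape. The maximum is stable under iteration. *)
Lemma move_up_abs v h n a : 0 <= h -> v <= a -> a + h <= n -> `|v + h| <= Num.max n (`|v| - h).
Proof.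
move=> h0 va an; rewrite le_max; have [vh|vh] := lerP v (- h).
  by rewrite (ler0_norm (_ : v + h <= 0)) ?(ler0_norm (_ : v <= 0)); [|lra|lra]; apply/orP; right; lra.
by rewrite ger0_norm; [|lra]; apply/orP; left; lra.
Qed.

Lemma move_dn_abs v h n a : 0 <= h -> - v <= a -> a + h <= n -> `|v - h| <= Num.max n (`|v| - h).
Proof.
by move=> h0 va an; have := move_up_abs h0 va an; rewrite normrN [- v + h]addrC distrC.
Qed.

Lemma stay_abs v h n a : v <= a -> - v <= a -> a <= n -> `|v| <= Num.max n (`|v| - h).
Proof. by move=> v1 v2 an; rewrite le_max; apply/orP; left; rewrite ler_norml; lra. Qed.

Lemma max_step n h u v w t : u <= Num.max n (v - h) -> v <= Num.max n (w - t * h) -> 0 <= h ->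
  u <= Num.max n (w - (t + 1) * h).
Proof.
move=> hu; rewrite !le_max => /orP[hv|hv] h0; move: hu; rewrite le_max => /orP[hu|hu]; apply/orP;
  by [left; lra | right; lra].
Qed.

Lemma max_le_abs n u v t : 0 <= t -> u <= Num.max n (v - t) -> u <= Num.max n v.
Proof. by move=> t0; rewrite !le_max => /orP[->//|h]; apply/orP; right; lra. Qed.

Lemma max_trans n u v w : u <= Num.max n v -> v <= Num.max n w -> u <= Num.max n w.
Proof. by rewrite !le_max => /orP[->//|h] /orP[h1|h1]; apply/orP; [left|right]; lra. Qed.

Lemma sqr_max_le n u v : 0 <= n -> `|u| <= Num.max n `|v| -> u ^+ 2 <= v ^+ 2 + n ^+ 2.
Proof.
move=> n0; rewrite le_max -[u ^+ 2]real_normK ?num_real // -[v ^+ 2]real_normK ?num_real // => /orP[h|h].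
  by apply: le_trans (_ : n ^+ 2 <= _); [rewrite lerXn2r ?nnegrE|rewrite lerDr sqr_ge0].
by apply: le_trans (_ : `|v| ^+ 2 <= _); [rewrite lerXn2r ?nnegrE|rewrite lerDl sqr_ge0].
Qed.

Lemma near_sum n s t : 0 <= n -> t <= (s / 4) ^+ 2 -> n * s ^+ 2 + n * t <= 11 / 10 * n * s ^+ 2.
Proof.
move=> n0 ht; have h1 := ler_wpM2l n0 ht.
have : 0 <= n * s ^+ 2 by rewrite mulr_ge0 ?sqr_ge0.
by rewrite exprMn in h1; lra.
Qed.

End MoveNumeric.

Section WeightNumeric.
Variables (R : realType) (d : nat).
Hypothesis d0 : (0 < d)%N.
Implicit Types (e x y : R).

Lemma expR_near1 x : 0 <= x -> x <= 1 / 2 -> expR x <= 1 + 2 * x.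
Proof.
move=> x0 x1; have h := expR_ge1Dx (- x).
have e1 : expR x * expR (- x) = 1 by rewrite -expRD subrr expR0.
have h2 := ler_wpM2l (expR_ge0 x) h; rewrite e1 in h2.
have h3 : 0 < 1 - x by lra.
rewrite -(ler_pM2r h3); apply: (le_trans h2).
have : 0 <= x * (1 / 2 - x) by rewrite mulr_ge0; lra.
by lra.
Qed.

Lemma power_hi y e : 0 <= y -> y <= 1 + e -> y ^+ d <= expR (d%:R * e).
Proof.
move=> y0 hy; rewrite expRM_natl lerXn2r ?nnegrE ?expR_ge0 //.
exact: le_trans hy (expR_ge1Dx e).
Qed.

Lemma power_lo y e : 0 <= e -> e <= 1 / 2 -> 1 - e <= y -> expR (- (d%:R * (2 * e))) <= y ^+ d.
Proof.
move=> e0 e1 hy; have y0 : 0 <= y by lra.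
rewrite -mulrN expRM_natl lerXn2r ?nnegrE ?expR_ge0 //; apply: le_trans hy.
have h : 1 + 2 * e <= expR (2 * e) by exact: expR_ge1Dx.
rewrite expRN; have p0 : 0 < expR (2 * e) by rewrite expR_gt0.
rewrite -[leLHS]mul1r ler_pdivrMr //.
have h1 : (1 - e) * (1 + 2 * e) <= (1 - e) * expR (2 * e) by rewrite ler_wpM2l //; lra.
have : 0 <= e * (1 / 2 - e) by rewrite mulr_ge0; lra.
by lra.
Qed.

Lemma weight_formula (f n w S H C : R) : n != 0 -> w != 0 -> S != 0 -> H != 0 ->
  f / n / (w * S^-1 * H) * (w * (C * H * S^-1)) = f * C / n.
Proof. by move=> n0 w0 S0 H0; field; rewrite n0 w0 S0 H0. Qed.

(** Here [y] is the estimated width over the true one and [q] the height of the peak. The d-th power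
    of [y] is responsible for the factor d in the error. *)
Lemma weight_close (w q f y e t : R) : 0 < w -> 0 <= y -> 0 <= e -> d%:R * e <= 1 / 64 -> 0 <= t -> t <= e ->
  1 - e <= y -> y <= 1 + e ->
  q * expR (- t - e) <= f -> f <= q * expR (- t + e) -> 0 < q ->
  `|f / q * (w * y ^+ d) - w| <= 64 * d%:R * e * w.
Proof.
move=> w0 y0 e0 de t0 te ylo yhi flo fhi q0; have dR : 1 <= d%:R :> R by rewrite ler1n.
have ed : e <= d%:R * e by rewrite ler_peMl.
have g1 : expR (- t - e) <= f / q by rewrite ler_pdivlMr // mulrC.
have g2 : f / q <= expR (- t + e) by rewrite ler_pdivrMr // mulrC.
have y1 := power_hi y0 yhi; have y2 : expR (- (d%:R * (2 * e))) <= y ^+ d by apply: power_lo => //; lra.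
have E0 x : 0 <= expR x := expR_ge0 x.
have hi : f / q * y ^+ d <= 1 + 4 * (d%:R * e).
  apply: le_trans (_ : expR (- t + e) * expR (d%:R * e) <= _).
    by apply: ler_pM => //; [exact: le_trans (E0 _) g1|exact: exprn_ge0].
  rewrite -expRD; apply: le_trans (_ : expR (2 * (d%:R * e)) <= _); first by rewrite ler_expR; lra.
  by apply: le_trans (expR_near1 _ _) _; lra.
have lo : 1 - 4 * (d%:R * e) <= f / q * y ^+ d.
  apply: le_trans (_ : expR (- t - e) * expR (- (d%:R * (2 * e))) <= _); last exact: ler_pM.
  by rewrite -expRD; apply: le_trans (expR_ge1Dx _); lra.
have -> : f / q * (w * y ^+ d) - w = w * (f / q * y ^+ d - 1) by ring.
rewrite normrM (gtr0_norm w0) [leRHS]mulrC ler_pM2l // ler_norml; move: hi lo.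
have : 0 <= d%:R * e by rewrite mulr_ge0.
by move: (f / q * y ^+ d) => u; clear; lra.
Qed.

End WeightNumeric.

Section SlotNumeric.
Variable R : realType.
Implicit Types (e n s t u v w X Y Z : R).

Lemma sqr_est s t e : 0 < s -> 0 <= e -> e <= 1 / 64 -> `|t - s| <= e * s ->
  15 / 16 * s ^+ 2 <= t ^+ 2 /\ t ^+ 2 <= 5 / 4 * s ^+ 2.
Proof.
move=> s0 e0 e1; rewrite ler_norml => /andP[t1 t2].
have es : e * s <= 1 / 64 * s by rewrite ler_pM2r.
have s2 : 0 < s ^+ 2 by rewrite exprn_gt0.
have h1 : (63 / 64 * s) ^+ 2 <= t ^+ 2 by rewrite lerXn2r ?nnegrE; lra.
have h2 : t ^+ 2 <= (65 / 64 * s) ^+ 2 by rewrite lerXn2r ?nnegrE; lra.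
by rewrite !exprMn in h1 h2; split; lra.
Qed.

Lemma half_eps_sqr s e : 0 < s -> 0 <= e -> e <= 1 / 64 -> (e * s / 2) ^+ 2 <= s ^+ 2 / 16.
Proof.
move=> s0 e0 e1; have es : e * s <= 1 / 64 * s by rewrite ler_pM2r.
have es0 : 0 <= e * s by rewrite mulr_ge0 // ltW.
apply: le_trans (_ : (s / 4) ^+ 2 <= _); first by rewrite lerXn2r ?nnegrE; lra.
by rewrite exprMn; lra.
Qed.

Lemma same_slot n s e t X Y Z : 0 <= n -> 0 < s -> 0 <= e -> e <= 1 / 64 -> `|t - s| <= e * s ->
  X <= 2 * Y + 2 * Z -> Y <= n * s ^+ 2 -> Z <= n * (e * s / 2) ^+ 2 -> X <= 4 * n * t ^+ 2.
Proof.
move=> n0 s0 e0 e1 ht hX hY hZ; have [t1 _] := sqr_est s0 e0 e1 ht.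
have h1 := ler_wpM2l n0 t1; have h2 := ler_wpM2l n0 (half_eps_sqr s0 e0 e1).
by have : 0 <= n * s ^+ 2; [rewrite mulr_ge0 ?sqr_ge0|lra].
Qed.

Lemma other_slot n s u e t W X Y Z : 0 < n -> 0 < s -> 0 < u -> 0 <= e -> e <= 1 / 64 -> `|t - s| <= e * s ->
  64 * n * (s + u) ^+ 2 <= W -> W <= 3 * Z + 3 * X + 3 * Y -> Y <= n * u ^+ 2 -> Z <= n * (e * s / 2) ^+ 2 ->
  4 * n * t ^+ 2 < X.
Proof.
move=> n0 s0 u0 e0 e1 ht hW hWX hY hZ; have [_ t1] := sqr_est s0 e0 e1 ht.
have n0' := ltW n0.
have h1 := ler_wpM2l n0' t1; have h2 := ler_wpM2l n0' (half_eps_sqr s0 e0 e1).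
have h3 : 0 <= n * s * u by rewrite !mulr_ge0 // ltW.
have h4 : 0 < n * s ^+ 2 by rewrite mulr_gt0 ?exprn_gt0.
have h5 : 0 < n * u ^+ 2 by rewrite mulr_gt0 ?exprn_gt0.
have E : 64 * n * (s + u) ^+ 2 = 64 * (n * s ^+ 2) + 128 * (n * s * u) + 64 * (n * u ^+ 2) by ring.
by lra.
Qed.

Lemma two_cores n s u W Y Z : 0 < n -> 0 < s -> 0 < u ->
  64 * n * (s + u) ^+ 2 <= W -> W <= 2 * Y + 2 * Z -> Y <= n * s ^+ 2 -> Z <= n * u ^+ 2 -> False.
Proof.
move=> n0 s0 u0 hW hWX hY hZ.
have h3 : 0 <= n * s * u by rewrite !mulr_ge0 // ltW.
have h4 : 0 < n * s ^+ 2 by rewrite mulr_gt0 ?exprn_gt0.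
have h5 : 0 < n * u ^+ 2 by rewrite mulr_gt0 ?exprn_gt0.
have E : 64 * n * (s + u) ^+ 2 = 64 * (n * s ^+ 2) + 128 * (n * s * u) + 64 * (n * u ^+ 2) by ring.
by lra.
Qed.

Lemma sqr_sub2 u v w : (u - w) ^+ 2 <= 2 * (u - v) ^+ 2 + 2 * (w - v) ^+ 2.
Proof.
have := sqr_ge0 ((u - v) + (w - v)); rewrite -subr_ge0 => h.
by rewrite -subr_ge0; move: h; rewrite subr0; congr (_ <= _); ring.
Qed.

Lemma sqr_sub2r u v w : (u - w) ^+ 2 <= 2 * (v - u) ^+ 2 + 2 * (v - w) ^+ 2.
Proof. by rewrite -(sqrrN (v - u)) -(sqrrN (v - w)) !opprB; exact: sqr_sub2. Qed.

Lemma sqr_sub3 u v w t : (u - t) ^+ 2 <= 3 * (v - u) ^+ 2 + 3 * (w - v) ^+ 2 + 3 * (w - t) ^+ 2.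
Proof.
have a1 := sqr_ge0 ((v - u) - (w - v)); have a2 := sqr_ge0 ((v - u) + (w - t)).
have a3 := sqr_ge0 ((w - v) + (w - t)).
have : 0 <= ((v - u) - (w - v)) ^+ 2 + ((v - u) + (w - t)) ^+ 2 + ((w - v) + (w - t)) ^+ 2 by rewrite !addr_ge0.
by rewrite -[in X in _ -> X]subr_ge0; congr (_ <= _); ring.
Qed.

End SlotNumeric.

(** * Correctness of the learner on an accurate histogram *)

Section Analysis.
Variables (R : realType) (d k : nat) (G : mixture R d k) (c0 : R).
Hypotheses (hc0 : 2 <= c0) (d0 : (0 < d)%N) (k0 : (0 < k)%N) (sep : well_separated c0 G).
Variables (M N FL : nat) (F : nat -> nat) (tau : R).
Hypotheses (M0 : (0 < M)%N) (N0 : (0 < N)%N).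
Notation h := (hstep R M).
Notation freq := (freq R M N F).
Notation eps := (accuracy d c0).
Notation peak := (peak G M).
Notation E2 := (expR (- (2 * pi)) : R).
Hypothesis hM : forall j, 100 * d%:R * h <= eps * std G j.
Hypothesis htau : forall j, tau <= eps / 10 * (peak j * expR (- (21 * d%:R))).
Hypothesis hF : forall z : 'I_d -> nat, inner_cell (M ^ 2) z -> `|freq z - cell_mass G M z| <= tau.
(** Four demands on the constants: [hrange] keeps the cells around a mean off the rim of the grid,
    [hQ] makes the Laplacian of the paraboloid visible to the test, [hfloor] lets core cells reach
    the fraction 1/[FL], and [hnoise] prevents noise from faking a negative Laplacian. *)
Hypothesis hrange : forall j c, `|mean G j 0 c| + 3 * d%:R * std G j + 4 <= M%:R / 2.
Hypothesis hQ : forall j, 10 * std G j ^+ 2 <= M%:R.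
Hypothesis hfloor : forall j, 1 <= FL%:R * (peak j * expR (- (5 * d%:R))).
Hypothesis hnoise : 4 * d%:R * tau * (M ^ 3)%:R * FL%:R < 1.

Let dR : 1 <= d%:R :> R. Proof. by rewrite ler1n. Qed.
Let MR : 0 < M%:R :> R. Proof. by rewrite ltr0n. Qed.
Let h0 : 0 < h := hstep_gt0 R M0.
Let h_small j : h <= std G j / 64 := hstep_le hc0 d0 M0 hM j.

Lemma centerE t : center R M t = t%:R * h + h / 2 - M%:R / 2.
Proof. by rewrite /center /hstep; ring. Qed.

Lemma hMR : h * M%:R = 1.
Proof. by rewrite /hstep mulVf // gt_eqF. Qed.

Lemma range_cell j (c : 'I_d) t : `|center R M t - mean G j 0 c| <= 3 * d%:R * std G j ->
  (3 <= t)%N && (t + 4 <= M ^ 2)%N.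
Proof.
move=> ht; have hr := hrange j c; rewrite centerE in ht.
have h1 : h <= 1 by rewrite invf_le1 // ler1n.
move: ht hr; move: (mean G j 0 c) (3 * _ * _) => m S; rewrite ler_norml => /andP[a1 a2] hr.
have m1 := ler_norm m; have m3 : - m <= `|m| by rewrite -normrN ler_norm.
have b1 : 3 * h <= t%:R * h by lra.
have b2 : (t%:R + 4) * h <= M%:R by lra.
apply/andP; split.
  by move: b1; rewrite ler_pM2r // ler_nat.
have : (t%:R + 4) * h * M%:R <= M%:R * M%:R by rewrite ler_wpM2r // ltW.
by rewrite -mulrA hMR mulr1 -natrD -natrM ler_nat mulnn.
Qed.

Lemma dist_coord j x (c : 'I_d) : (x c - mean G j 0 c) ^+ 2 <= dist2 G x j.
Proof. by rewrite /dist2 (bigD1 c) //= lerDl sumr_ge0 // => i _; rewrite sqr_ge0. Qed.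

Lemma dist_box j x (e : R) : (forall c, `|x c - mean G j 0 c| <= e) -> dist2 G x j <= d%:R * e ^+ 2.
Proof.
move=> he; rewrite /dist2 -[d%:R * _](_ : \sum_(c < d) e ^+ 2 = _); last first.
  by rewrite sumr_const card_ord -[LHS]mulr_natl.
apply: ler_sum => c _; rewrite -real_normK ?num_real // lerXn2r ?nnegrE //.
exact: le_trans (he c).
Qed.

Definition home j (c : 'I_d) : nat := Num.truncn ((mean G j 0 c + M%:R / 2) * M%:R).

Lemma homeP j c : `|ctr R M (home j) c - mean G j 0 c| <= h / 2.
Proof.
have hr := hrange j c; have m3 : - mean G j 0 c <= `|mean G j 0 c| by rewrite -normrN ler_norm.
have s0 : 0 <= 3 * d%:R * std G j by rewrite !mulr_ge0 // ltW // std_gt0.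
have y0 : 0 <= (mean G j 0 c + M%:R / 2) * M%:R by rewrite mulr_ge0 ?(ltW MR) //; lra.
have /andP[t1 t2] := truncn_itv y0; rewrite -/(home j c) in t1 t2.
rewrite /ctr centerE.
have e1 : (mean G j 0 c + M%:R / 2) * M%:R * h = mean G j 0 c + M%:R / 2.
  by rewrite -mulrA [_ * h]mulrC hMR mulr1.
have u1 : (home j c)%:R * h <= mean G j 0 c + M%:R / 2 by rewrite -[leRHS]e1 ler_pM2r.
have u2 : mean G j 0 c + M%:R / 2 <= ((home j c)%:R + 1) * h.
  by rewrite -[leLHS]e1 ler_pM2r // natr1 ltW.
by rewrite ler_norml; lra.
Qed.

Lemma pi_lt4 : pi <= 4 :> R. Proof. by have := pihalf_lt2 R; lra. Qed.

(* At a maximum of the frequency plus a small paraboloid the discrete Laplacian is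
   clearly negative; the maximum is not attained on the boundary of the box, where
   the frequency is less than half of the central one. *)
Lemma core_passes j : exists z, [/\ dist2 G (ctr R M z) j <= d%:R * std G j ^+ 2,
   forall i, (z i < M ^ 2)%N & passes d (M ^ 2) (M ^ 3) FL N F (enc (M ^ 2) z)].
Proof.
have s0 := std_gt0 G j; have hsj := h_small j; have e0 := eps_gt0 c0 d0; have e1 := eps_le hc0 d0.
(* Radius 3/4 sigma, in cells: the box stays in the core, as (19/25)^2 < 3/5, while on its faces a
   coordinate is off by at least 29/40 sigma, and 2 (29/40)^2 > 21/20 brings the profile below half
   its central value. *)
pose n := Num.truncn (3 / 4 * std G j * M%:R).
have /andP[n1 n2] : n%:R <= 3 / 4 * std G j * M%:R < n.+1%:R.
  by apply: truncn_itv; apply: mulr_ge0 => //; apply: mulr_ge0; [lra|exact: (ltW s0)].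
have E1 : 3 / 4 * std G j * M%:R * h = 3 / 4 * std G j by rewrite -mulrA [_ * h]mulrC hMR mulr1.
have nh1 : n%:R * h <= 3 / 4 * std G j by rewrite -[leRHS]E1 ler_pM2r.
have nh2 : 3 / 4 * std G j - h <= n%:R * h.
  apply: lt_next.
  by rewrite -[leLHS]E1 ler_pM2r // natr1 ltW.
have n0 : 0 < n%:R :> R.
  have : 0 < n%:R * h := radius_gt0 s0 hsj nh2.
  by rewrite pmulr_lgt0.
pose z0 := home j.
have boxP z : in_box z0 n z -> forall c, `|ctr R M z c - mean G j 0 c| <= 19 / 25 * std G j.
  move=> hz c; have hc := homeP j c; have /andP[b1 b2] := hz c.
  have E : ctr R M z c - mean G j 0 c = (z c)%:R * h - (z0 c)%:R * h + (ctr R M z0 c - mean G j 0 c).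
    by rewrite /ctr !centerE; ring.
  have c1 : (z c)%:R * h <= (z0 c)%:R * h + n%:R * h by rewrite -mulrDl ler_pM2r // -natrD ler_nat.
  have c2 : (z0 c)%:R * h <= (z c)%:R * h + n%:R * h.
    by rewrite -mulrDl ler_pM2r // -natrD ler_nat addnC -leq_subLR.
  by rewrite E; exact: (box_offset s0 hsj hc c1 c2 nh1).
have boxD z : in_box z0 n z -> dist2 G (ctr R M z) j <= 3 / 5 * (d%:R * std G j ^+ 2).
  by move=> /boxP /dist_box h1; apply: le_trans h1 (box_sqr _ _).
have ds0 : 0 <= d%:R * std G j ^+ 2 by rewrite mulr_ge0 // sqr_ge0.
have boxI z : in_box z0 n z -> interior_cell M z.
  move=> /boxP hz i; apply: range_interior; apply: (@range_cell j).
  apply: le_trans (hz i) _; apply: ler_wpM2r; first exact: (ltW s0).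
  by apply: le_trans (_ : 3 * 1 <= _); [lra|rewrite ler_pM2l].
have boxA z : in_box z0 n z ->
    peak j * expR (- (pi * dist2 G (ctr R M z) j / std G j ^+ 2) - eps) <= freq z
    <= peak j * expR (- (pi * dist2 G (ctr R M z) j / std G j ^+ 2) + eps).
  move=> hz; rewrite -negE; apply: (approx hc0 d0 k0 sep M0 hM htau hF).
    exact/interior_inner/boxI.
  exact: le_trans (boxD _ hz) (box_le5 ds0).
have box0 : in_box z0 n z0 by move=> c; rewrite leq_subr leq_addr.
have /andP[f0 _] := boxA z0 box0.
have A0 := peak_gt0 G M0 j.
have xz0 : 0 <= pi * dist2 G (ctr R M z0) j / std G j ^+ 2.
  by rewrite divr_ge0 ?sqr_ge0 // mulr_ge0 ?pi_ge0 ?dist2_ge0.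
have xz1 : pi * dist2 G (ctr R M z0) j / std G j ^+ 2 <= eps.
  rewrite ler_pdivrMr ?exprn_gt0 //; apply: (home_small dR s0 h0 hsj (hM j)).
    by rewrite pi_ge0 pi_lt4.
  by rewrite dist2_ge0; apply: dist_box => c; exact: homeP.
have fz0 : 0 < freq z0 by apply: lt_le_trans f0; rewrite mulr_gt0 ?expR_gt0.
(* On the box the paraboloid stays below a tenth of the central frequency, so the maximum keeps 9/10
   of it; the Laplacian -2 d a is large enough for the test because M^3 >= 10 n^2. *)
pose a := freq z0 / (10 * d%:R * n%:R ^+ 2).
have dn0 : 0 < 10 * d%:R * n%:R ^+ 2 :> R by rewrite !mulr_gt0 ?exprn_gt0 // ltr0n.
have a0 : 0 < a by rewrite divr_gt0.
have [zm [bm hm]] := box_argmax z0 n (fun z => freq z + a * offset2 R z0 z).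
have am : a * offset2 R z0 zm <= freq z0 / 10.
  apply: le_trans (_ : a * (d%:R * n%:R ^+ 2) <= _); first by rewrite ler_pM2l // offset2_le.
  by apply/eqW; rewrite /a; field; rewrite !gt_eqF // ltr0n.
have h00 : freq z0 <= freq zm + a * offset2 R z0 zm.
  apply: le_trans (hm z0 box0); rewrite lerDl mulr_ge0 ?(ltW a0) //.
  by apply: sumr_ge0 => c _; rewrite sqr_ge0.
have hm9 : 9 / 10 * freq z0 <= freq zm := nine_tenth h00 am.
have /andP[_ fm] := boxA zm bm.
have side c : n%:R * h - h / 2 <= `|ctr R M zm c - mean G j 0 c| -> False.
  move=> hc; have := side_sqr s0 h0 hsj nh2 hc; rewrite real_normK ?num_real // => hD.
  have {}hD := le_trans hD (dist_coord j (ctr R M zm) c).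
  have y1 : - (pi * dist2 G (ctr R M zm) j / std G j ^+ 2) <= - (21 / 20).
    rewrite lerN2 ler_pdivlMr ?exprn_gt0 //; apply: le_trans (_ : 2 * dist2 G (ctr R M zm) j <= _).
      exact: twice_side.
    by rewrite ler_wpM2r ?dist2_ge0 // pi_ge2.
  have := core_ratio A0 (ltW e0) e1 xz0 xz1 y1 f0.
  by move=> /(le_trans fm); apply: (half_absurd fz0 hm9).
have zmS c : zm c != (z0 c + n)%N /\ zm c != (z0 c - n)%N.
  have hc := homeP j c.
  have E : ctr R M zm c - mean G j 0 c = (zm c)%:R * h - (z0 c)%:R * h + (ctr R M z0 c - mean G j 0 c).
    by rewrite /ctr !centerE; ring.
  split; apply/eqP => e; apply: (side c); rewrite E e.
    by rewrite natrD mulrDl; exact: side_up.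
  have nz : (n <= z0 c)%N.
    by have := interior_gt1 (boxI _ bm c); rewrite e => /ltnW; rewrite subn_gt0 => /ltnW.
  by rewrite natrB // mulrBl; exact: side_dn.
have box_up i : in_box z0 n (up zm i 1).
  move=> c; rewrite /up; case: eqP => [_|_]; last exact: bm.
  by apply: step_up_box; [exact: bm|exact: (zmS c).1].
have box_dn i : in_box z0 n (dn zm i 1).
  move=> c; rewrite /dn; case: eqP => [_|_]; last exact: bm.
  by apply: step_dn_box; [exact: bm|exact: (zmS c).2].
have lap : \sum_i (freq (up zm i 1) + freq (dn zm i 1)) <= 2 * d%:R * freq zm - 2 * d%:R * a.
  have -> : 2 * d%:R * freq zm - 2 * d%:R * a = \sum_(i < d) (2 * freq zm - 2 * a).
    by rewrite sumr_const card_ord -[RHS]mulr_natl; ring.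
  apply: ler_sum => i _; have := hm _ (box_up i); have := hm _ (box_dn i).
  rewrite offset2_up offset2_dn; last by apply: ltnW; exact: interior_gt1 (boxI _ bm i).
  exact: paraboloid_step.
have lt z : in_box z0 n z -> forall i, (z i < M ^ 2)%N by move=> /boxI; exact: interior_lt.
have Dm := boxD _ bm.
exists zm; split.
- by apply: le_trans Dm _; exact: box_le1.
- exact: lt.
apply/(passesP R (M ^ 3) FL F M0 N0 (lt _ bm)); split; first exact: boxI.
- have Q0 : 0 <= (M ^ 3)%:R :> R by [].
  have := ler_wpM2r Q0 lap.
  have fm2 : freq zm <= 2 * freq z0.
    apply: le_trans fm _; apply: (mid_ratio A0 (ltW e0) e1 xz0 xz1 _ f0).
    by rewrite oppr_le0 divr_ge0 ?sqr_ge0 // mulr_ge0 ?pi_ge0 ?dist2_ge0.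
  have fa : 2 * freq z0 <= 2 * d%:R * a * (M ^ 3)%:R.
    have nQ : 10 * n%:R ^+ 2 <= (M ^ 3)%:R :> R.
      have : n%:R ^+ 2 <= (3 / 4 * std G j * M%:R) ^+ 2 by rewrite lerXn2r ?nnegrE // (le_trans _ n1).
      rewrite natrX; exact: (budget (hQ j)).
    have -> : 2 * d%:R * a * (M ^ 3)%:R = 2 * freq z0 * ((M ^ 3)%:R / (10 * n%:R ^+ 2)).
      by rewrite /a; field; rewrite !gt_eqF // ltr0n.
    rewrite ler_peMr //; first by rewrite mulr_ge0 // ltW.
    by rewrite ler_pdivlMr ?mul1r // mulr_gt0 ?exprn_gt0.
  by move: fm2 fa; exact: pass_arith.
- have low : peak j * expR (- (5 * d%:R)) <= freq zm.
    have /andP[lm _] := boxA zm bm; apply: le_trans lm; rewrite ler_pM2l // ler_expR.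
    apply: (floor_exp dR e1); rewrite ler_pdivrMr ?exprn_gt0 //.
    apply: le_trans (_ : 4 * (3 / 5 * (d%:R * std G j ^+ 2)) <= _).
      by apply: ler_pM => //; [exact: pi_ge0|exact: dist2_ge0|exact: pi_lt4].
    exact: box_le4.
  by apply: le_trans (hfloor j) _; rewrite mulrC ler_wpM2r.
Qed.

(** Slightly larger than a core: during the refinement a coordinate that starts very close to the
    mean may drift away by up to half of eps sigma. *)
Definition near j z : Prop := dist2 G (ctr R M z) j <= 11 / 10 * d%:R * std G j ^+ 2.
Definition delta j z c : R := ctr R M z c - mean G j 0 c.

Lemma near_coord j z c : near j z -> `|delta j z c| <= 3 / 2 * d%:R * std G j.
Proof.
move=> hz; apply: coord_of_dist => //; first exact: std_gt0.
exact: le_trans (dist_coord _ _ _) hz.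
Qed.

Lemma h_le1 : h <= 1.
Proof. by rewrite invf_le1 // ler1n. Qed.

Lemma near_shift j z i c : near j z -> c%:R * h <= 11 / 10 * std G j ->
  (c + 3 <= z i)%N /\ (z i + c + 4 <= M ^ 2)%N.
Proof.
move=> hz hc; have s0 := std_gt0 G j; have := near_coord i hz; rewrite /delta /ctr centerE => hu.
have [b1 b2] := range_shift_lo dR s0 h_le1 h0 (hrange j i) hu hc; split.
  by move: b1; rewrite -mulrDl ler_pM2r // -natrD ler_nat.
have : ((z i)%:R + c%:R + 4) * h * M%:R <= M%:R * M%:R by rewrite -!mulrDl in b2; apply: ler_wpM2r b2; exact: ltW.
by rewrite -mulrA hMR // mulr1 -!natrD -natrM ler_nat mulnn.
Qed.

Lemma near_interior j z : near j z -> interior_cell M z.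
Proof.
move=> hz i; have [|] := @near_shift j z i 0 hz; first by rewrite mul0r; apply: mulr_ge0; [lra|exact/ltW/std_gt0].
by rewrite addn0 => h1 h2; apply: range_interior; rewrite h2 andbT.
Qed.

Lemma dist2_up j z i c : dist2 G (ctr R M (up z i c)) j =
  dist2 G (ctr R M z) j + 2 * delta j z i * (c%:R * h) + (c%:R * h) ^+ 2.
Proof.
rewrite /dist2 (bigD1 i) //= [in RHS](bigD1 i) //= /delta /ctr /up eqxx.
under eq_bigr => a /negbTE -> do [].
by rewrite /center natrD /hstep; set S := \sum_(a | _) _; ring.
Qed.

Lemma dist2_dn j z i c : (c <= z i)%N -> dist2 G (ctr R M (dn z i c)) j =
  dist2 G (ctr R M z) j - 2 * delta j z i * (c%:R * h) + (c%:R * h) ^+ 2.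
Proof.
move=> cz; rewrite /dist2 (bigD1 i) //= [in RHS](bigD1 i) //= /delta /ctr /dn eqxx.
under eq_bigr => a /negbTE -> do [].
by rewrite /center natrB // /hstep; set S := \sum_(a | _) _; ring.
Qed.

(** Together with [slope], the even and odd parts in [x] of the exponent of the profile after a
    shift by [x] along a coordinate: the search exploits the even part, the moves the odd one. *)
Definition level j z x : R := pi * (dist2 G (ctr R M z) j + x ^+ 2) / std G j ^+ 2.
Definition slope j z i x : R := pi * (2 * delta j z i * x) / std G j ^+ 2.

Lemma approx_shift j z i c (x := c%:R * h) : near j z -> x <= 11 / 10 * std G j ->
  [/\ peak j * expR (- (level j z x + slope j z i x) - eps) <= freq (up z i c),
      freq (up z i c) <= peak j * expR (- (level j z x + slope j z i x) + eps),
      peak j * expR (- (level j z x - slope j z i x) - eps) <= freq (dn z i c) &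
      freq (dn z i c) <= peak j * expR (- (level j z x - slope j z i x) + eps)].
Proof.
move=> hz hx; have s0 := std_gt0 G j; have [b1 b2] := near_shift i hz hx.
have x0 : 0 <= x by rewrite mulr_ge0 // ltW.
have cz : (c <= z i)%N by apply: leq_trans b1; rewrite leq_addr.
have int_ := interior_inner (near_interior hz).
have [e1 e2] := shift_dist dR s0 x0 hx (dist_coord j (ctr R M z) i) hz.
have iu : inner_cell (M ^ 2) (up z i c).
  move=> a; rewrite /up; case: eqP => [->|_]; last exact: int_.
  exact: (shift_inner b1 b2).1.
have idn : inner_cell (M ^ 2) (dn z i c).
  move=> a; rewrite /dn; case: eqP => [->|_]; last exact: int_.
  exact: (shift_inner b1 b2).2.
have E1 : level j z x + slope j z i x = pi * dist2 G (ctr R M (up z i c)) j / std G j ^+ 2.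
  by rewrite dist2_up /level /slope -/x; ring.
have E2 : level j z x - slope j z i x = pi * dist2 G (ctr R M (dn z i c)) j / std G j ^+ 2.
  by rewrite dist2_dn // /level /slope -/x; ring.
rewrite E1 E2 -!negE.
have /andP[] : _ := @approx _ _ _ _ _ hc0 d0 k0 sep _ _ _ _ M0 hM htau hF j _ iu ltac:(by rewrite dist2_up).
have /andP[] : _ := @approx _ _ _ _ _ hc0 d0 k0 sep _ _ _ _ M0 hM htau hF j _ idn ltac:(by rewrite dist2_dn).
by move=> *; split.
Qed.

Lemma eps_h j : h <= eps * std G j / 100.
Proof.
have := hM j; have hd : h <= d%:R * h by rewrite ler_peMl // ltW.
by move=> h1; lra.
Qed.

Lemma freq_ge0 (z : 'I_d -> nat) : 0 <= freq z.
Proof. by rewrite divr_ge0. Qed.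

Lemma near_approx j z : near j z ->
  peak j * expR (- (pi * dist2 G (ctr R M z) j / std G j ^+ 2) - eps) <= freq z
  <= peak j * expR (- (pi * dist2 G (ctr R M z) j / std G j ^+ 2) + eps).
Proof.
move=> hz; rewrite -negE; apply: (approx hc0 d0 k0 sep M0 hM htau hF).
  exact/interior_inner/(near_interior hz).
apply: le_trans hz _; apply: ler_wpM2r; first exact: sqr_ge0.
by apply: ler_wpM2r => //; lra.
Qed.

(** The width is searched along the coordinate in which neighbouring cells have consecutive numbers,
    whence the plain g + c and g - c in the search. *)
Definition coord0 : 'I_d := Ordinal d0.

Lemma srch_condE z c : (c <= z coord0)%N -> srch_cond E2 F (enc (M ^ 2) z) c =
  (freq (up z coord0 c) * freq (dn z coord0 c) <= E2 * (freq z * freq z)).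
Proof.
move=> hc; rewrite /srch_cond !natrM.
have -> : (enc (M ^ 2) z + c = enc (M ^ 2) (up z coord0 c))%N by rewrite enc_up expn0 muln1.
have -> : (enc (M ^ 2) z - c = enc (M ^ 2) (dn z coord0 c))%N by rewrite enc_dn // expn0 muln1.
rewrite !(freqE R M F N0) [X in X <= _]mulrACA [X in _ <= _ * X]mulrACA [X in _ <= X]mulrCA.
by rewrite ler_pM2l // mulr_gt0 ?ltr0n.
Qed.

Lemma srch_near j z c : near j z -> c%:R * h <= 11 / 10 * std G j ->
  (srch_cond E2 F (enc (M ^ 2) z) c -> 1 - eps <= c%:R * h / std G j) /\
  (~~ srch_cond E2 F (enc (M ^ 2) z) c -> c%:R * h / std G j <= 1 + eps / 2).
Proof.
move=> hz hc; have s0 := std_gt0 G j; have e0 := eps_gt0 c0 d0; have e1 := eps_le hc0 d0.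
have [b1 b2] := near_shift coord0 hz hc.
have cz : (c <= z coord0)%N by apply: leq_trans b1; rewrite leq_addr.
rewrite srch_condE //; have [u1 u2 v1 v2] := approx_shift coord0 hz hc.
have /andP[w1 w2] := near_approx hz; have A0 := peak_gt0 G M0 j.
have yE : level j z (c%:R * h) = pi * dist2 G (ctr R M z) j / std G j ^+ 2 + pi * (c%:R * h / std G j) ^+ 2.
  by rewrite /level; field; rewrite gt_eqF.
have y0 : 0 <= c%:R * h / std G j by rewrite divr_ge0 ?mulr_ge0 // ltW.
split => [hP|]; last rewrite -ltNge => hP.
  apply: (near_one_lo (ltW e0) e1 y0).
  exact: (search_true A0 (ltW e0) (pi_ge2 R) yE u1 v1 (freq_ge0 _) w2 hP).
apply: (near_one_hi (ltW e0)).
exact: (search_false A0 (ltW e0) (pi_ge2 R) yE (freq_ge0 _) (freq_ge0 _) u2 v2 w1 hP).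
Qed.

Lemma srch_accurate j z (c := srch E2 (M ^ 2) F (enc (M ^ 2) z)) : near j z ->
  [/\ (0 < c)%N, 1 - eps <= c%:R * h / std G j & c%:R * h / std G j <= 1 + eps].
Proof.
move=> hz; have s0 := std_gt0 G j; have e0 := eps_gt0 c0 d0; have e1 := eps_le hc0 d0.
have es0 : 0 < eps * std G j by rewrite mulr_gt0.
have es1 : eps * std G j <= std G j / 64 by rewrite mulrC -[leRHS]mulr1 -mulrA ler_pM2l //; lra.
have eh := eps_h j.
(* The least number of cells longer than (1 + eps) sigma. By [srch_near] it satisfies the search
   condition, so the search stops where the profile is known. *)
pose c1 := (Num.truncn ((1 + eps) * std G j * M%:R)).+1.
have y0 : 0 <= (1 + eps) * std G j * M%:R.
  by apply: mulr_ge0 => //; apply: mulr_ge0; [lra|exact: ltW].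
have /andP[t1 t2] := truncn_itv y0; rewrite -/c1 in t2.
have EM : (1 + eps) * std G j * M%:R * h = (1 + eps) * std G j by rewrite -mulrA [_ * h]mulrC hMR // mulr1.
have c1lo : (1 + eps) * std G j < c1%:R * h by rewrite -[ltLHS]EM ltr_pM2r.
have c1hi : c1%:R * h <= (1 + eps) * std G j + h.
  by rewrite -[X in X + _]EM -natr1 mulrDl mul1r lerD2r ler_pM2r.
have c1h : c1%:R * h <= 11 / 10 * std G j by lra.
have [b1 b2] := near_shift coord0 hz c1h.
have c1B : (0 < c1 <= M ^ 2)%N by move: b1 b2; clear; lia.
have P1 : srch_cond E2 F (enc (M ^ 2) z) c1.
  have [_ hN] := srch_near hz c1h; apply: contraT => /hN.
  by rewrite ler_pdivrMr //; lra.
have [Pc /andP[cpos cle] cmin] := srchP c1B P1; rewrite -/(srch E2 (M ^ 2) F (enc (M ^ 2) z)) -/c in Pc cpos cle cmin.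
have ch : c%:R * h <= 11 / 10 * std G j by apply: le_trans c1h; rewrite ler_pM2r // ler_nat.
split => //; first by have [hP _] := srch_near hz ch; exact: hP.
have [c2|c2] := leqP c 1.
  rewrite ler_pdivrMr //; have : c%:R * h <= 1 * h by rewrite ler_pM2r // lern1.
  by lra.
have hc' : (c.-1)%:R * h <= 11 / 10 * std G j.
  by apply: le_trans ch; rewrite ler_pM2r // ler_nat leq_pred.
have [_ hN] := srch_near hz hc'.
(* The preceding length failed, hence is at most (1 + eps/2) sigma, and one more cell adds at most
   eps sigma/100. *)
have := hN (cmin c.-1 ltac:(by rewrite -ltnS prednK // c2 /=)).
rewrite !(ler_pdivrMr _ _ s0).
have -> : c%:R = (c.-1)%:R + 1 :> R by rewrite natr1 prednK.
by move=> hlast; apply: (last_step es0 eh hlast).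
Qed.

Section Refine.
Variables (j : 'I_k) (c : nat).
Hypotheses (c_lo : 1 - eps <= c%:R * h / std G j)
  (c_hi : c%:R * h / std G j <= 1 + eps).
Notation eta := (eps * std G j / 2).

Lemma eta_gt0 : 0 < eta.
Proof. by rewrite divr_gt0 // mulr_gt0 ?std_gt0 // eps_gt0. Qed.

Lemma c_bounds : 3 / 4 * std G j <= c%:R * h /\ c%:R * h <= 11 / 10 * std G j.
Proof.
have s0 := std_gt0 G j; have e1 := eps_le hc0 d0.
by rewrite -(ler_pdivlMr _ _ s0) -(ler_pdivrMr _ _ s0); move: c_lo c_hi e1; split; lra.
Qed.

Lemma delta_up z i : delta j (up z i 1) i = delta j z i + h.
Proof. by rewrite /delta /ctr /up eqxx /center natrD /hstep; ring. Qed.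

Lemma delta_dn z i : (0 < z i)%N -> delta j (dn z i 1) i = delta j z i - h.
Proof. by move=> zi; rewrite /delta /ctr /dn eqxx /center natrB // /hstep; ring. Qed.

(* For a Gaussian profile the sign of f(x + c) - f(x - c) is that of m - x. *)
Lemma move_ok z (i : 'I_d) : near j z -> exists z', [/\ move_step F c ((M ^ 2) ^ i) (enc (M ^ 2) z) = enc (M ^ 2) z',
  forall a, a != i -> z' a = z a & `|delta j z' i| <= Num.max eta (`|delta j z i| - h)].
Proof.
move=> hz; have [cl ch] := c_bounds; have A0 := peak_gt0 G M0 j; have s0 := std_gt0 G j.
have [b1 b2] := near_shift i hz ch; have e0 := eps_gt0 c0 d0.
have cz : (c <= z i)%N by apply: leq_trans b1; rewrite leq_addr.
have zi : (0 < z i)%N by apply: leq_trans b1; rewrite addn3.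
have [u1 u2 v1 v2] := approx_shift i hz ch.
have EU : (enc (M ^ 2) z + c * (M ^ 2) ^ i)%N = enc (M ^ 2) (up z i c) by rewrite enc_up.
have ED : (enc (M ^ 2) z - c * (M ^ 2) ^ i)%N = enc (M ^ 2) (dn z i c) by rewrite enc_dn.
have leF y y' : (F (enc (M ^ 2) y) <= F (enc (M ^ 2) y'))%N -> freq y <= freq y'.
  by move=> hy; rewrite ler_wpM2r ?invr_ge0 // ler_nat.
have ae : eps * std G j / 3 + h <= eta.
  by have := eps_h j; have : 0 < eps * std G j by [rewrite mulr_gt0]; lra.
have ae' : eps * std G j / 3 <= eta by apply: le_trans ae; rewrite lerDl ltW.
have goUp : (F (enc (M ^ 2) (dn z i c)) <= F (enc (M ^ 2) (up z i c)))%N -> delta j z i <= eps * std G j / 3.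
  by move=> /leF hf; apply: (slope_offset (pi_ge2 R) s0 e0 cl); exact: move_slope A0 v1 u2 hf.
have goDn : (F (enc (M ^ 2) (up z i c)) <= F (enc (M ^ 2) (dn z i c)))%N -> - delta j z i <= eps * std G j / 3.
  move=> /leF hf; apply: (slope_offset (pi_ge2 R) s0 e0 cl).
  have -> : pi * (2 * - delta j z i * (c%:R * h)) / std G j ^+ 2 = - slope j z i (c%:R * h).
    by rewrite /slope; ring.
  by apply: move_slope A0 _ v2 hf; rewrite opprK.
rewrite /move_step EU ED; case: ltnP => h1.
  exists (up z i 1); split; first by rewrite enc_up mul1n.
    by move=> a /negbTE ai; rewrite /up ai.
  by rewrite delta_up; apply: move_up_abs (ltW h0) (goUp (ltnW h1)) ae.
case: ltnP => h2.
  exists (dn z i 1); split; first by rewrite enc_dn // mul1n.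
    by move=> a /negbTE ai; rewrite /dn ai.
  by rewrite delta_dn //; apply: move_dn_abs (ltW h0) (goDn h1) ae.
by exists z; split => //; apply: stay_abs (goUp h2) (goDn h1) ae'.
Qed.

Variable z0 : 'I_d -> nat.
Hypothesis hz0 : dist2 G (ctr R M z0) j <= d%:R * std G j ^+ 2.

Definition closer z := forall a, `|delta j z a| <= Num.max eta `|delta j z0 a|.

Lemma closer_near z : closer z -> near j z.
Proof.
move=> hz; have s0 := std_gt0 G j; have e1 := eps_le hc0 d0; have e0 := eps_gt0 c0 d0.
rewrite /near; apply: le_trans (_ : d%:R * std G j ^+ 2 + d%:R * eta ^+ 2 <= _).
  apply: le_trans (_ : dist2 G (ctr R M z0) j + d%:R * eta ^+ 2 <= _); last by rewrite lerD2r.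
  have -> : d%:R * eta ^+ 2 = \sum_(a < d) eta ^+ 2 by rewrite sumr_const card_ord -[RHS]mulr_natl.
  rewrite /dist2 -big_split /=; apply: ler_sum => a _; apply: sqr_max_le (hz a).
  exact/ltW/eta_gt0.
apply: near_sum => //.
rewrite lerXn2r ?nnegrE ?(ltW eta_gt0) //; first by rewrite divr_ge0 // ltW.
by have : eps * std G j <= 1 / 64 * std G j; [rewrite ler_pM2r|lra].
Qed.

Lemma moves_ok z (i : 'I_d) : closer z -> exists z',
  [/\ iteri (M ^ 2) (fun _ x => move_step F c ((M ^ 2) ^ i) x) (enc (M ^ 2) z) = enc (M ^ 2) z',
      closer z', forall a, a != i -> z' a = z a & `|delta j z' i| <= eta].
Proof.
move=> hz.
pose Q (t x : nat) := exists z', [/\ x = enc (M ^ 2) z', forall a, a != i -> z' a = z a &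
  `|delta j z' i| <= Num.max eta (`|delta j z i| - t%:R * h)].
have Qcloser z' t : (forall a, a != i -> z' a = z a) ->
    `|delta j z' i| <= Num.max eta (`|delta j z i| - t%:R * h) -> closer z'.
  move=> h1 h2 a; have [->|/h1 ai] := eqVneq a i; last by rewrite /delta /ctr ai; exact: hz.
  by apply: max_trans (hz i); apply: max_le_abs h2; rewrite mulr_ge0 // ltW.
have : Q (M ^ 2)%N (iteri (M ^ 2) (fun _ x => move_step F c ((M ^ 2) ^ i) x) (enc (M ^ 2) z)).
  apply: (iteri_ind (Q := Q)) => [|t x tM [z' [-> h1 h2]]].
    by exists z; split => //; rewrite mul0r subr0 le_max lexx orbT.
  have [z'' [-> g1 g2]] := move_ok i (closer_near (Qcloser _ _ h1 h2)).
  exists z''; split => //; first by move=> a ai; rewrite g1 // h1.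
  by rewrite -[t.+1%:R]natr1; exact: max_step g2 h2 (ltW h0).
case=> z' [e h1 h2]; exists z'; split => //; first exact: Qcloser h1 h2.
move: h2; rewrite le_max => /orP[//|h2]; apply: le_trans h2 _.
(* M^2 steps of width h make up M, more than any offset of a near cell, so the second alternative of
   the maximum ends below eta too. *)
apply: le_trans (ltW eta_gt0); rewrite subr_le0 natrX expr2 -mulrA [_ * h]mulrC hMR // mulr1.
apply: le_trans (near_coord i (closer_near hz)) _; have := hrange j i.
have := normr_ge0 (mean G j 0 i); have : 0 <= d%:R * std G j by rewrite mulr_ge0 // ltW // std_gt0.
by move: MR; lra.
Qed.

Lemma refine_ok : exists z, [/\ refine d (M ^ 2) F c (enc (M ^ 2) z0) = enc (M ^ 2) z, closer z &
  forall a, `|delta j z a| <= eta].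
Proof.
pose Q (i x : nat) := exists z, [/\ x = enc (M ^ 2) z, closer z & forall a : 'I_d, (a < i)%N -> `|delta j z a| <= eta].
have : Q d (refine d (M ^ 2) F c (enc (M ^ 2) z0)).
  apply: (iteri_ind (Q := Q)) => [|i x id_ [z [-> hz hi]]].
    by exists z0; split => // a; rewrite le_max lexx orbT.
  have [z' [e h1 h2 h3]] := moves_ok (Ordinal id_) hz.
  exists z'; split => // a; rewrite ltnS leq_eqVlt => /orP[/eqP ai|ai].
    by have -> : a = Ordinal id_ by exact/val_inj.
  have an : a != Ordinal id_ by apply/eqP => ae; move: ai; rewrite ae /= ltnn.
  by rewrite /delta /ctr h2 //; exact: hi.
by case=> z [e h1 h2]; exists z; split => // a; exact: h2.
Qed.

End Refine.

Section Output.
Variables (j : 'I_k) (z0 : 'I_d -> nat).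
Hypothesis hz0 : dist2 G (ctr R M z0) j <= d%:R * std G j ^+ 2.
Let c := srch E2 (M ^ 2) F (enc (M ^ 2) z0).
Let x := refine d (M ^ 2) F c (enc (M ^ 2) z0).

Lemma core_near : near j z0.
Proof.
apply: le_trans hz0 _; rewrite ler_wpM2r ?sqr_ge0 //.
by rewrite ler_peMl //; lra.
Qed.

Lemma small_dist z : (forall a, `|delta j z a| <= eps * std G j / 2) ->
  pi * dist2 G (ctr R M z) j / std G j ^+ 2 <= eps.
Proof.
move=> hz; have s0 := std_gt0 G j; have e0 := eps_gt0 c0 d0; have e1 := eps_le hc0 d0.
have ed : d%:R * eps <= 1 / 64.
  have := eps_d c0 d0; have : expR (- c0 * d%:R) <= 1; last lra.
  by rewrite expR_le1 mulNr oppr_le0 mulr_ge0 //; apply: le_trans hc0.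
rewrite ler_pdivrMr ?exprn_gt0 //.
apply: le_trans (_ : 4 * (d%:R * (eps * std G j / 2) ^+ 2) <= _).
  by apply: ler_pM; [exact: pi_ge0|exact: dist2_ge0|exact: pi_lt4|exact: dist_box].
have -> : 4 * (d%:R * (eps * std G j / 2) ^+ 2) = (d%:R * eps) * (eps * std G j ^+ 2) by field.
rewrite ler_piMl //; last by apply: le_trans ed _; lra.
by rewrite mulr_ge0 ?sqr_ge0 // ltW.
Qed.

Lemma output_ok : exists z, [/\ x = enc (M ^ 2) z, forall a, (z a < M ^ 2)%N,
  forall a, `|delta j z a| <= eps * std G j / 2, `|c%:R / M%:R - std G j| <= eps * std G j &
  `|(F x * c ^ d)%:R / N%:R - weight G j| <= 64 * d%:R * eps * weight G j].
Proof.
have s0 := std_gt0 G j; have e0 := eps_gt0 c0 d0; have e1 := eps_le hc0 d0.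
have [c_gt0 c_lo c_hi] := srch_accurate core_near.
rewrite -/c in c_gt0 c_lo c_hi.
have [z [xE hz hd]] := refine_ok c_lo c_hi hz0.
have nz := closer_near hz0 hz.
have zlt := interior_lt (near_interior nz).
exists z; split => //.
- rewrite -/(hstep R M); have -> : c%:R * h - std G j = (c%:R * h / std G j - 1) * std G j.
    by rewrite mulrBl mulfVK ?gt_eqF // mul1r.
  rewrite normrM (gtr0_norm s0) ler_pM2r // ler_norml.
  by apply/andP; split; lra.
have A0 := peak_gt0 G M0 j.
have /andP[a1 a2] := near_approx nz.
have t0 : 0 <= pi * dist2 G (ctr R M z) j / std G j ^+ 2.
  by rewrite divr_ge0 ?sqr_ge0 // mulr_ge0 ?pi_ge0 ?dist2_ge0.
have y0 : 0 <= c%:R * h / std G j by rewrite divr_ge0 ?mulr_ge0 // ltW.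
have ed : d%:R * eps <= 1 / 64.
  have := eps_d c0 d0; have : expR (- c0 * d%:R) <= 1; last lra.
  by rewrite expR_le1 mulNr oppr_le0 mulr_ge0 //; apply: le_trans hc0.
have := weight_close d0 (weight_gt0 G j) y0 (ltW e0) ed t0 (small_dist hd) c_lo c_hi a1 a2 A0.
have -> : freq z / peak j * (weight G j * (c%:R * h / std G j) ^+ d) = (F x * c ^ d)%:R / N%:R.
  rewrite /x xE natrM natrX /freq /peak !exprMn [(std G j)^-1 ^+ d]exprVn; apply: weight_formula.
  - by rewrite pnatr_eq0 -lt0n.
  - by rewrite gt_eqF // weight_gt0.
  - by rewrite gt_eqF // exprn_gt0.
  - by rewrite gt_eqF // exprn_gt0.
by [].
Qed.

End Output.

Implicit Types (rm : nat -> R) (i j : 'I_k).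

(** The tolerance of the weight is exactly eps0; those of mean and width are smaller, and the
    recognition of duplicates relies on these. *)
Definition slot_ok rm l j : Prop :=
  [/\ \sum_(a < d) (rm (l * (d + 2) + a)%N - mean G j 0 a) ^+ 2 <= d%:R * (eps * std G j / 2) ^+ 2,
      `|rm (l * (d + 2) + d)%N - std G j| <= eps * std G j &
      `|rm (l * (d + 2) + (d + 1))%N - weight G j| <= 64 * d%:R * eps * weight G j].

Lemma slot_lt l J (a : nat) : (l < J)%N -> (a < d + 2)%N -> (l * (d + 2) + a < J * (d + 2))%N.
Proof.
move=> lJ ad; apply: (@leq_trans (l.+1 * (d + 2))); last by rewrite leq_mul2r lJ orbT.
by rewrite mulSn addnC ltn_add2r.
Qed.

Lemma slot_ok_ext rm rm' l j J : (l < J)%N -> (forall a, (a < J * (d + 2))%N -> rm' a = rm a) ->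
  slot_ok rm l j -> slot_ok rm' l j.
Proof.
move=> lJ hr [h1 h2 h3]; split.
- under eq_bigr => a _ do rewrite hr ?slot_lt ?(leq_trans (ltn_ord a)) ?leq_addr //.
  exact: h1.
- by rewrite hr //; apply: slot_lt => //; rewrite addn2 ltnS leqnSn.
- by rewrite hr //; apply: slot_lt => //; rewrite addn1 addn2.
Qed.

Definition core j z : Prop := dist2 G (ctr R M z) j <= d%:R * std G j ^+ 2.

Lemma core_unique i j z : core i z -> core j z -> i = j.
Proof.
move=> hi hj; apply/eqP; apply: contraT => ij; exfalso.
have n0 : 0 < d%:R :> R by rewrite ltr0n.
have hW : dist2 G (mean_fun G i) j <= 2 * dist2 G (ctr R M z) i + 2 * dist2 G (ctr R M z) j.
  rewrite /dist2 !mulr_sumr -big_split /=; apply: ler_sum => a _.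
  exact: sqr_sub2r.
exact: (two_cores n0 (std_gt0 G i) (std_gt0 G j) (separation64 hc0 k0 sep ij) hW hi hj).
Qed.

Lemma near_slotE rm J l z i j : core j z -> (forall a : 'I_d, rm (J * (d + 2) + a)%N = ctr R M z a) ->
  slot_ok rm l i -> near_slot rm d J l = (i == j).
Proof.
move=> hz hJ [h1 h2 _]; have e0 := ltW (eps_gt0 c0 d0); have e1 := eps_le hc0 d0.
rewrite /near_slot; under eq_bigr => a _ do rewrite hJ.
rewrite natrM; have [ij|ij] := eqVneq i j.
  rewrite -ij in hz; apply: (same_slot _ (std_gt0 G i) e0 e1 h2 _ hz h1) => //.
  rewrite /dist2 !mulr_sumr -big_split /=; apply: ler_sum => a _; exact: sqr_sub2.
apply/negbTE; rewrite -ltNge.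
apply: (other_slot _ (std_gt0 G i) (std_gt0 G j) e0 e1 h2 (separation64 hc0 k0 sep ij) _ hz h1).
  by rewrite ltr0n.
rewrite /dist2 !mulr_sumr -!big_split /=; apply: ler_sum => a _; exact: sqr_sub3.
Qed.

Variable tape : nat -> R.

Definition setup (s : fstate R) : Prop :=
  [/\ [/\ rg s 0%N = d, rg s 2%N = (M ^ 2)%N, rg s 3%N = N, rg s 4%N = ((M ^ 2) ^ d)%N & rg s 5%N = M],
      rg s 8%N = FL, rg s 9%N = (M ^ 3)%N & hp s = F].

(** [sg] is a ghost list of the components in the order of their slots, so that [index j sg] is the
    slot of [j]. *)
Definition found (s : fstate R) (sg : seq 'I_k) : Prop :=
  [/\ uniq sg, rg s 17%N = size sg & forall j, j \in sg -> slot_ok (rl s) (index j sg) j].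

Definition covered g (sg : seq 'I_k) : Prop := forall z j, (forall a, (z a < M ^ 2)%N) ->
  (enc (M ^ 2) z < g)%N -> passes d (M ^ 2) (M ^ 3) FL N F (enc (M ^ 2) z) -> core j z -> j \in sg.

(** For a cell in a core the distance test is exact: by [near_slotE] a slot is near if and only if
    it belongs to the same component. *)
Lemma fresh_slot s sg rm j z : found s sg -> core j z ->
  (forall a, (a < size sg * (d + 2))%N -> rm a = rl s a) ->
  (forall a : 'I_d, rm (size sg * (d + 2) + a)%N = ctr R M z a) ->
  \big[andb/true]_(l < size sg) ~~ near_slot rm d (size sg) l = (j \notin sg).
Proof.
move=> [us _ hs] hz h1 h2; rewrite big_andE.
have E (l : 'I_(size sg)) : near_slot rm d (size sg) l = (nth j sg l == j).
  apply: (near_slotE hz h2).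
  apply: (slot_ok_ext (ltn_ord l) h1).
  by have := hs _ (mem_nth j (ltn_ord l)); rewrite index_uniq.
apply/forallP/idP => [h|h l].
  apply/negP => js; have js' : (index j sg < size sg)%N by rewrite index_mem.
  by have := h (Ordinal js'); rewrite E /= nth_index // eqxx.
by rewrite E; apply: contraNN h => /eqP <-; exact: mem_nth.
Qed.

Lemma candidate_ok s g sg : setup s -> found s sg -> covered g sg -> (size sg <= g)%N ->
  (g < (M ^ 2) ^ d)%N -> exists sg', let s' := den tape (candidate_prog E2) (setr s 10 g) in
  [/\ hp s' = F, found s' sg', covered g.+1 sg' & (size sg' <= g.+1)%N].
Proof.
move=> hset hf hc hsz hg; have [[r0 r2 r3 r4 r5] r8 r9 hpF] := hset; have [us r17 hs] := hf.
pose z := fun a : 'I_d => digit (M ^ 2) g a.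
have gE : enc (M ^ 2) z = g by exact: enc_digit.
have B0 : (0 < M ^ 2)%N by rewrite expn_gt0 M0.
have zlt a : (z a < M ^ 2)%N by exact: digit_lt.
set s2 := setr s 10 g.
have kc r : r \in consts -> rg s2 r = rg s r.
  by move=> hr; rewrite /s2 /= updE; case: eqP => // e; rewrite e in hr.
have [k0' k2 k3 k4] : [/\ rg s2 0%N = d, rg s2 2%N = (M ^ 2)%N, rg s2 3%N = N & rg s2 4%N = ((M ^ 2) ^ d)%N].
  by rewrite !kc.
have [k5 k8 k9] : [/\ rg s2 5%N = M, rg s2 8%N = FL & rg s2 9%N = (M ^ 3)%N] by rewrite !kc.
have k10 : rg s2 10%N = g by [].
have k17 : rg s2 17%N = size sg by rewrite -r17.
have [kh kl] : hp s2 = F /\ rl s2 = rl s by [].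
clearbody s2.
have := @den_candidate R tape E2 s2; cbv zeta.
rewrite k0' k2 k3 k4 k5 k8 k9 k10 k17 kh kl.
set c := srch E2 _ F g; set x := refine d _ F c g; set rm := fun a => if _ then _ else _.
set pass := passes d _ _ FL N F g; set fresh := \big[andb/true]_(l < size sg) _.
set s' := den tape _ s2 => /(_ B0 hg (leq_trans hsz (ltnW hg))) cand.
have rm_lo a : (a < size sg * (d + 2))%N -> rm a = rl s a by move=> ha; rewrite /rm leqNgt ha.
have rm_hi (a : 'I_d) : rm (size sg * (d + 2) + a)%N = ctr R M z a.
  by rewrite /rm leq_addr ltn_add2l ltn_ord /= addKn.
have coreF j : core j z -> fresh = (j \notin sg) by move=> hj; apply: fresh_slot hf hj rm_lo rm_hi.
have old z' j : (forall a, (z' a < M ^ 2)%N) -> (enc (M ^ 2) z' < g.+1)%N ->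
    passes d (M ^ 2) (M ^ 3) FL N F (enc (M ^ 2) z') -> core j z' -> j \in sg \/ [/\ pass, core j z & True].
  move=> hz'; rewrite ltnS leq_eqVlt => /orP[/eqP e|lt] hp hj; last by left; exact: hc hp hj.
  have zz' : z' = z by apply: funext => a; apply: (enc_inj hz' zlt); rewrite e gE.
  by right; rewrite -zz' /pass -e.
(* A passing cell of a core is rejected only if the component of that core is already recorded, so a
   rejection cannot spoil [covered]. *)
have reject : ~~ (pass && fresh) ->
    [/\ hp s' = F, forall r, r \in consts -> rg s' r = rg s2 r,
      rg s' 17%N = size sg & forall a, (a < size sg * (d + 2))%N -> rl s' a = rl s a] ->
    [/\ hp s' = F, found s' sg, covered g.+1 sg & (size sg <= g.+1)%N].
  move=> na [q1 _ q3 q4]; split => //; [|move=> z' j h1 h2 h3 h4|exact: leqW].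
    split => // j js; apply: (slot_ok_ext _ q4 (hs j js)); by rewrite index_mem.
  case: (old z' j h1 h2 h3 h4) => [//|[hp hj _]].
  by move: na; rewrite hp (coreF j hj) /= negbK.
have [acc|nacc] := boolP (pass && fresh); last first.
  have [|q1 q2 q3 q4 _] := cand; first by move=> a; rewrite a in nacc.
  exists sg; apply: reject => //.
  by split => //; rewrite q3 (negbTE nacc).
have /andP[hp hfr] := acc.
(* Nothing is known about search and refinement at an arbitrary cell; acceptance puts the cell into
   a core, where [output_ok] applies. *)
have [j hj] : exists j, core j z.
  by apply: (passes_core d0 M0 N0 h_small hF hnoise zlt); rewrite gE.
have [z1 [xE z1lt zd zs zw]] := output_ok hj.
rewrite gE -/c -/x in xE zs zw.
have xlt : (x < (M ^ 2) ^ d)%N by rewrite xE enc_lt.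
have [//|q1 q2 q3 q4 /(_ acc) [q5 q6 q7]] := cand; exists (rcons sg j).
have jn : j \notin sg by rewrite -(coreF j hj).
split => //.
- split; first by rewrite rcons_uniq jn.
    by rewrite q3 acc size_rcons.
  move=> i; rewrite mem_rcons inE -cats1 index_cat => /orP[/eqP ->|isg].
    rewrite (negbTE jn) /= eqxx addn0; split.
    + under eq_bigr => a _ do rewrite q5 // xE digit_enc //.
      exact: dist_box.
    + by rewrite q6.
    + by rewrite q7.
  by rewrite isg; apply: (slot_ok_ext _ q4 (hs i isg)); rewrite index_mem.
- move=> z' i h1 h2 h3 h4; rewrite mem_rcons inE.
  case: (old z' i h1 h2 h3 h4) => [->|[_ hi _]]; first by rewrite orbT.
  by rewrite (core_unique hi hj) eqxx.
- by rewrite size_rcons ltnS.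
Qed.

Lemma learn_ok s : setup s -> exists sg : seq 'I_k,
  [/\ uniq sg, forall j, j \in sg & forall j, slot_ok (rl (den tape (learn_prog E2) s)) (index j sg) j].
Proof.
move=> hset; have [[r0 r2 r3 r4 r5] r8 r9 hpF] := hset.
rewrite /learn_prog den_seq den_reg.
pose Q g s' := hp s' = F /\ exists sg, [/\ found s' sg, covered g sg & (size sg <= g)%N].
apply: (@den_for _ tape _ _ _ _ Q (fun s' => exists sg : seq 'I_k,
  [/\ uniq sg, forall j, j \in sg & forall j, slot_ok (rl s') (index j sg) j])).
- split; first by rewrite /= hpF.
  by exists [::]; split.
- move=> g s' hg [fr _ _] [hp' [sg [h1 h2 h3]]].
  have hset' : setup s' by split => //; [split|..]; rewrite fr.
  have hg' : (g < (M ^ 2) ^ d)%N by move: hg; rewrite /= !updE /= r4.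
  have [sg' [q1 q2 q3 q4]] := candidate_ok hset' h1 h2 h3 hg'.
  by split => //; exists sg'.
- move=> s' _ [_ [sg [[us _ hs] h2 _]]]; exists sg.
  (* Every core contains a passing cell, and at the end of the scan all cells are covered. *)
  have all_in j : j \in sg.
    have [z [hz zlt hp]] := core_passes j.
    by apply: (h2 z j zlt _ hp hz); rewrite /= !updE /= r4 enc_lt.
  by split => // j; rewrite /=; exact: hs.
Qed.

End Analysis.

(** * From the recorded slots to the required accuracy *)

Section Accurate.
Variables (R : realType) (d k : nat) (G : mixture R d k) (c0 : R).
Hypotheses (hc0 : 2 <= c0) (d0 : (0 < d)%N).

(** The permutation sends a component to its slot; as [sg] enumerates all components, its length is
    [k] and slot numbers are below [k]. *)
Lemma accurate_of_slots (st : state R) (sg : seq 'I_k) : uniq sg -> (forall j, j \in sg) ->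
  (forall j, slot_ok G c0 (rmem st) (index j sg) j) -> accurate (expR (- c0 * d%:R)) G st.
Proof.
move=> us all_in hs; have szk : size sg = k.
  by rewrite -(card_uniqP us) (eq_card (B := 'I_k)) ?card_ord // => j; rewrite all_in inE.
have lt j : (index j sg < k)%N by rewrite -[X in (_ < X)%N]szk index_mem.
have inj : injective (fun j => Ordinal (lt j)).
  move=> i j /(congr1 val) /= e.
  by rewrite -(nth_index i (all_in i)) e nth_index.
have e0 := eps_gt0 c0 d0; have dR : 1 <= d%:R :> R by rewrite ler1n.
exists (perm inj) => j; rewrite permE; have s0 := std_gt0 G j; have [h1 h2 h3] := hs j.
have de : accuracy d c0 <= expR (- c0 * d%:R).
  by rewrite -(eps_d c0 d0); have : accuracy d c0 <= d%:R * accuracy d c0 by [rewrite ler_peMl // ltW]; lra.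
rewrite /out_mean /out_std /out_weight /= -[d.+2]addn2 -[d.+1]addn1; split.
- have -> : l2norm (\row_(i < d) rmem st (index j sg * (d + 2) + i)%N - mean G j) =
    Num.sqrt (\sum_(a < d) (rmem st (index j sg * (d + 2) + a)%N - mean G j 0 a) ^+ 2).
    by rewrite /l2norm; congr Num.sqrt; apply: eq_bigr => a _; rewrite !mxE.
  have t0 : 0 <= accuracy d c0 * std G j / 2 by rewrite divr_ge0 // mulr_ge0 // ltW.
  apply: le_trans (_ : Num.sqrt (d%:R * (accuracy d c0 * std G j / 2) ^+ 2) <= _).
    by rewrite ler_sqrt // mulr_ge0 ?sqr_ge0.
  rewrite sqrtrM // sqrtr_sqr (ger0_norm t0) mulrC ler_wpM2r ?sqrtr_ge0 //.
  have : accuracy d c0 * std G j <= expR (- c0 * d%:R) * std G j by rewrite ler_pM2r.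
  have : 0 < accuracy d c0 * std G j by rewrite mulr_gt0.
  by lra.
- by apply: le_trans h2 _; rewrite ler_pM2r.
- by rewrite -(eps_d c0 d0).
Qed.

End Accurate.

(** * Verification of the constants of the grid *)

Section Powers.
Variables (R : realType) (x : R).
Hypothesis x8 : 8 <= x.

Lemma x_gt0 : 0 < x. Proof. by apply: lt_le_trans x8; rewrite ltr0n. Qed.

Lemma x_ge1 : 1 <= x. Proof. by apply: le_trans x8; rewrite ler1n. Qed.

Lemma x_pow m n : (m <= n)%N -> x ^+ m <= x ^+ n.
Proof. by move=> mn; rewrite ler_weXn2l ?x_ge1. Qed.

(** Positive quantities are bounded from below by inverse powers of one base, so that checking the
    constants reduces to comparing exponents. *)
Definition lower a n : Prop := (x ^+ n)^-1 <= a.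

Lemma lowerM a b m n : lower a m -> lower b n -> lower (a * b) (m + n).
Proof.
by move=> ha hb; rewrite /lower exprD invfM; apply: ler_pM => //;
  rewrite invr_ge0 exprn_ge0 // ltW // x_gt0.
Qed.

Lemma lowerV a n : 0 < a -> a <= x ^+ n -> lower a^-1 n.
Proof. by move=> a0 ha; rewrite /lower lef_pV2 ?posrE ?exprn_gt0 // x_gt0. Qed.

Lemma lowerX a n : lower a 1 -> lower (a ^+ n) n.
Proof.
rewrite /lower expr1 => ha; rewrite -exprVn lerXn2r ?nnegrE ?invr_ge0 ?(ltW x_gt0) //.
by apply: le_trans ha; rewrite invr_ge0 ltW // x_gt0.
Qed.

Lemma num_le2 (a : R) : a <= 64 -> a <= x ^+ 2.
Proof.
move=> ha; apply: le_trans ha _; have : 0 <= (x - 8) * (x - 8) by rewrite mulr_ge0 // subr_ge0.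
by move: x8; rewrite expr2; lra.
Qed.

End Powers.

Lemma trunc_fraction_bounds (R : realType) (y : R) : 0 < y ->
  exists n : nat, [/\ (0 < n)%N, y <= n%:R, forall m, (m < n)%N -> m%:R < y & n%:R <= y + 1].
Proof.
move=> y0; have ex : exists n, y <= n%:R.
  have /andP[_ h] := truncn_itv (ltW y0); by exists (Num.truncn y).+1; exact: ltW.
case: (ex_minnP ex) => n hn hmin.
have n0 : (0 < n)%N by rewrite -(ltr0n R); exact: lt_le_trans hn.
have lt m : (m < n)%N -> m%:R < y by move=> mn; rewrite ltNge; apply/negP => /hmin; rewrite leqNgt mn.
exists n; split => //; have := lt n.-1; rewrite prednK // leqnn => /(_ isT) h.
by rewrite -(prednK n0) -natr1 lerD2r ltW.
Qed.

Lemma range_num (R : realType) (m n s t q u : R) : m <= t -> n * s <= q -> 8 * t <= q -> 64 * q <= u -> 8 <= t ->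
  m + 3 * n * s + 4 <= u / 2.
Proof. lra. Qed.

Lemma fail_num (R : realType) (n : R) : 0 < n -> forall p, 0 < p -> forall t, 0 < t -> forall a,
  a * p ^+ 2 * t <= n -> a / (n * p^-1 ^+ 2) <= t^-1.
Proof.
move=> n0 p p0 t t0 a h; have -> : a / (n * p^-1 ^+ 2) = a * p ^+ 2 / n.
  by field; rewrite !gt_eqF.
by rewrite ler_pdivrMr // [leRHS]mulrC ler_pdivlMr.
Qed.

Section GridConstants.
Variables (R : realType) (d k : nat) (G : mixture R d k) (c0 rho w0 : R) (K0 nR nW : nat).
Hypotheses (hc0 : 2 <= c0) (d0 : (0 < d)%N) (k0 : (0 < k)%N).
Hypotheses (hrho : rho_bounded rho G) (hw0 : 0 < w0 <= wmin G).
Hypotheses (hK : expR c0 <= K0%:R) (hK8 : (8 <= K0)%N).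
Hypotheses (hnR : rho <= nR%:R) (nR0 : (0 < nR)%N) (hnW : 1 <= nW%:R * w0).

(** An integer at least 8 that bounds rho, d and exp(c0 d) at once; all parameters but the weights
    are controlled by its powers. *)
Definition base : nat := (nR * d * K0 ^ d)%N.
Notation b := base.
Notation x := (b%:R : R).
Notation M := ((b ^ 20)%N).
Notation T := ((b ^ 20) ^ d)%N.
Notation eps := (accuracy d c0).
(** Of order b^(-160 d), well below the b^(-21 d - 17) needed by [check_htau]. In [check_fail] its
    square costs M^(16 d) and the number of cells M^(2 d), out of the M^(20 d) in the number of
    samples. *)
Definition noise : R := (nW * M ^ (8 * d))%:R^-1.

Lemma K0_gt0 : (0 < K0)%N. Proof. exact: leq_trans hK8. Qed.

Lemma b_ge8 : (8 <= b)%N.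
Proof.
apply: leq_trans hK8 _; rewrite /b -{1}(expn1 K0).
apply: (@leq_trans (K0 ^ d)); first by rewrite leq_pexp2l // K0_gt0.
by rewrite leq_pmull // muln_gt0 nR0.
Qed.

Lemma x8 : 8 <= x. Proof. by rewrite (ler_nat R 8) b_ge8. Qed.

Lemma b_gt0 : (0 < b)%N. Proof. exact: leq_trans b_ge8. Qed.

Lemma M_gt0 : (0 < M)%N. Proof. by rewrite expn_gt0 b_gt0. Qed.

Lemma nW_gt0 : (0 < nW)%N.
Proof.
by rewrite lt0n; apply/negP => /eqP n0; move: hnW; rewrite n0 mul0r ler10.
Qed.

Lemma d_le : (d <= b)%N.
Proof. by rewrite /b mulnAC mulnC leq_pmulr // muln_gt0 nR0 expn_gt0 K0_gt0. Qed.

Lemma nR_le : (nR <= b)%N.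
Proof. by rewrite /b -mulnA leq_pmulr // muln_gt0 d0 expn_gt0 K0_gt0. Qed.

Lemma exp_le n : expR ((n%:R * d%:R) * c0) <= x ^+ n.
Proof.
rewrite -mulrA expRM_natl lerXn2r ?nnegrE ?expR_ge0 ?ler0n //.
rewrite expRM_natl; apply: le_trans (_ : (K0 ^ d)%:R <= _).
  by rewrite natrX lerXn2r ?nnegrE ?expR_ge0.
by rewrite ler_nat /b leq_pmull // muln_gt0 nR0.
Qed.

Lemma exp_le2 n m : (m <= 2 * n)%N -> expR (m%:R * d%:R) <= x ^+ n.
Proof.
move=> mn; apply: le_trans (exp_le n); rewrite ler_expR mulrAC.
apply: ler_wpM2r => //; apply: le_trans (_ : n%:R * 2 <= _); last by rewrite ler_wpM2l.
by rewrite -natrM ler_nat mulnC.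
Qed.

Lemma std_le j : std G j <= x ^+ 1.
Proof.
have [_ /andP[_ h]] := hrho j; apply: le_trans h _; apply: le_trans hnR _.
by rewrite expr1 ler_nat nR_le.
Qed.

Lemma std_lower j : lower x (std G j) 1.
Proof.
have [_ /andP[h1 h2]] := hrho j; apply: le_trans h1.
have r0 : 0 < rho by apply: lt_le_trans h2; exact: std_gt0.
rewrite lef_pV2 ?posrE ?exprn_gt0 ?(x_gt0 x8) // expr1.
by apply: le_trans hnR _; rewrite ler_nat nR_le.
Qed.

Lemma weight_lower j : nW%:R^-1 <= weight G j.
Proof.
have /andP[w1 w2] := hw0; apply: le_trans (fmin_le (weight G) j); apply: le_trans w2.
rewrite -[leLHS]mul1r ler_pdivrMr ?ltr0n ?nW_gt0 //; by rewrite mulrC.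
Qed.

Lemma hstepE : hstep R M = (x ^+ 20)^-1.
Proof. by rewrite /hstep natrX. Qed.

(** One power of the base for exp(c0 d), one for d, two for 64. *)
Lemma eps_lower : lower x eps 4.
Proof.
rewrite /accuracy mulNr expRN -invfM; apply: (lowerV x8).
  by rewrite !mulr_gt0 ?expR_gt0 ?ltr0n.
have h1 : expR (c0 * d%:R) <= x ^+ 1 by have := exp_le 1; rewrite mul1r mulrC.
have h2 : d%:R <= x ^+ 1 by rewrite expr1 ler_nat d_le.
have h3 : 64 <= x ^+ 2 := num_le2 x8 (lexx _).
rewrite -[4%N]/(1 + (2 + 1))%N !exprD; apply: ler_pM; rewrite ?expR_ge0 ?mulr_ge0 //.
exact: ler_pM.
Qed.

(** The exponent 21 d is d for the power of the width and 20 d for the volume of a cell. *)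
Lemma peak_lower j : nW%:R^-1 * (x ^+ (21 * d))^-1 <= peak G M j.
Proof.
rewrite /peak -mulrA; apply: ler_pM; rewrite ?invr_ge0 ?exprn_ge0 ?weight_lower //.
have -> : (21 * d = d + 20 * d)%N by rewrite -mulSn.
apply: (lowerM x8).
  by rewrite -exprVn; apply: (lowerX x8); apply: lowerV; [exact: x8|exact: std_gt0|exact: std_le].
by rewrite /lower hstepE exprVn -exprM.
Qed.

Lemma check_hM j : 100 * d%:R * hstep R M <= eps * std G j.
Proof.
apply: le_trans (_ : (x ^+ 5)^-1 <= _); last exact: (lowerM x8 eps_lower (std_lower j)).
have h2 : d%:R <= x ^+ 1 by rewrite expr1 ler_nat d_le.
have h3 : 100 <= x ^+ 2 * x ^+ 1.
  have h3 : 64 <= x ^+ 2 := num_le2 x8 (lexx _).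
  by apply: le_trans (_ : 64 * 8 <= _); [lra|apply: ler_pM; rewrite ?expr1 ?x8].
rewrite hstepE ler_pdivrMr ?exprn_gt0 ?(x_gt0 x8) //.
apply: le_trans (_ : x ^+ 2 * x ^+ 1 * x ^+ 1 <= _).
  by apply: ler_pM; rewrite ?mulr_ge0.
have xn : x != 0 by rewrite gt_eqF // (x_gt0 x8).
rewrite -[20%N]/(5 + 15)%N exprD mulKf ?expf_neq0 // -!exprD.
exact: (x_pow x8).
Qed.

Lemma noise_gt0 : 0 < noise.
Proof. by rewrite invr_gt0 ltr0n muln_gt0 nW_gt0 expn_gt0 M_gt0. Qed.

Lemma check_htau j : noise <= eps / 10 * (peak G M j * expR (- (21 * d%:R))).
Proof.
have l1 : lower x (eps / 10) 6.
  apply: (lowerM x8 eps_lower); apply: (lowerV x8) => //.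
  by apply: (num_le2 x8); lra.
have l2 : lower x (expR (- (21 * d%:R))) 11.
  by rewrite expRN; apply: (lowerV x8); [exact: expR_gt0|exact: exp_le2].
have l3 := lowerM x8 l1 l2; have l4 := peak_lower j.
have -> : eps / 10 * (peak G M j * expR (- (21 * d%:R))) = (eps / 10 * expR (- (21 * d%:R))) * peak G M j by ring.
apply: le_trans (_ : (x ^+ (6 + 11))^-1 * (nW%:R^-1 * (x ^+ (21 * d))^-1) <= _); last first.
  by apply: ler_pM => //; rewrite ?mulr_ge0 ?invr_ge0 ?exprn_ge0.
rewrite /noise natrM invfM natrX natrX mulrCA ler_pM2l ?invr_gt0 ?ltr0n ?nW_gt0 //.
rewrite -invfM -exprD lef_pV2 ?posrE ?exprn_gt0 ?(x_gt0 x8) // -exprM.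
by apply: (x_pow x8); move: d0; lia.
Qed.

Lemma check_hnoise : 4 * d%:R * noise * (M ^ 3)%:R * (nW * T ^ 2 * M)%:R < 1.
Proof.
have -> : 4 * d%:R * noise * (M ^ 3)%:R * (nW * T ^ 2 * M)%:R =
  (4 * d * M ^ 3 * (nW * T ^ 2 * M))%:R / (nW * M ^ (8 * d))%:R.
  by rewrite /noise !natrM; ring.
have n0 : 0 < (nW * M ^ (8 * d))%:R :> R by rewrite ltr0n muln_gt0 nW_gt0 expn_gt0 M_gt0.
rewrite (ltr_pdivrMr _ _ n0) mul1r ltr_nat.
have -> : (4 * d * M ^ 3 * (nW * T ^ 2 * M) = nW * (4 * d * (M ^ 3 * T ^ 2 * M)))%N by lia.
rewrite ltn_pmul2l ?nW_gt0 // -!expnM -!expnD.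
have b4 : (4 * d < b ^ 3)%N.
  apply: (@leq_ltn_trans (b ^ 2)).
    by rewrite (expnS b 1) expn1 leq_mul ?d_le // (leq_trans _ b_ge8).
  by rewrite ltn_exp2l // (leq_trans _ b_ge8).
apply: leq_trans (_ : b ^ 3 * b ^ (20 * 3 + 20 * (d * 2) + 20) <= _)%N.
  by rewrite ltn_pmul2r // expn_gt0 b_gt0.
by rewrite -expnD leq_pexp2l ?b_gt0 //; move: d0; lia.
Qed.

Lemma check_hfloor j : 1 <= (nW * T ^ 2 * M)%:R * (peak G M j * expR (- (5 * d%:R))).
Proof.
have l2 : lower x (expR (- (5 * d%:R))) 3.
  by rewrite expRN; apply: (lowerV x8); [exact: expR_gt0|exact: exp_le2].
apply: le_trans (_ : (nW * T ^ 2 * M)%:R * (nW%:R^-1 * (x ^+ (21 * d))^-1 * (x ^+ 3)^-1) <= _); last first.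
  apply: ler_wpM2l => //; apply: ler_pM; rewrite ?mulr_ge0 ?invr_ge0 ?exprn_ge0 //.
  exact: peak_lower.
have xx : 0 < x ^+ (21 * d) * x ^+ 3 by rewrite mulr_gt0 ?exprn_gt0 ?(x_gt0 x8).
have nWR : nW%:R != 0 :> R by rewrite pnatr_eq0 -lt0n nW_gt0.
rewrite -mulrA -invfM -mulnA natrM [nW%:R * _]mulrC mulrA mulfK //.
rewrite ler_pdivlMr // mul1r -exprD -!expnM -expnD natrX.
by apply: (x_pow x8); move: d0; lia.
Qed.

Lemma check_hQ j : 10 * std G j ^+ 2 <= M%:R.
Proof.
have h1 : std G j ^+ 2 <= x ^+ 2.
  by rewrite lerXn2r ?nnegrE ?(ltW (std_gt0 G j)) //; have := std_le j; rewrite expr1.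
apply: le_trans (_ : x ^+ 2 * x ^+ 2 <= _).
  by apply: ler_pM; rewrite ?sqr_ge0 //; apply: (num_le2 x8); lra.
by rewrite -exprD natrX; exact: (x_pow x8).
Qed.

Lemma coord_le (v : 'rV[R]_d) c : `|v 0 c| <= l2norm v.
Proof.
rewrite /l2norm -sqrtr_sqr ler_sqrt; last by rewrite sumr_ge0 // => i _; rewrite sqr_ge0.
by rewrite (bigD1 c) //= lerDl sumr_ge0 // => i _; rewrite sqr_ge0.
Qed.

Lemma check_hrange j c : `|mean G j 0 c| + 3 * d%:R * std G j + 4 <= M%:R / 2.
Proof.
have [m1 _] := hrho j.
have h1 : `|mean G j 0 c| <= x.
  by apply: le_trans (coord_le _ _) _; apply: le_trans m1 _; apply: le_trans hnR _; rewrite ler_nat nR_le.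
have h2 : d%:R * std G j <= x * x.
  apply: ler_pM => //; [exact/ltW/std_gt0|by rewrite ler_nat d_le|].
  by have := std_le j; rewrite expr1.
have h3 : 8 * x <= x * x by rewrite ler_wpM2r ?x8.
have h4 : x ^+ 2 * x ^+ 2 <= M%:R by rewrite -exprD natrX; exact: (x_pow x8).
have h5 : 64 * x ^+ 2 <= x ^+ 2 * x ^+ 2 by rewrite ler_wpM2r ?sqr_ge0 //; apply: (num_le2 x8).
rewrite expr2 in h4 h5; have h6 := le_trans h5 h4; exact: range_num h1 h2 h3 h6 x8.
Qed.

Lemma k_le : (k <= nW)%N.
Proof.
have /andP[w1 w2] := hw0; rewrite -(ler_nat R).
have : k%:R * w0 <= 1.
  rewrite -[leRHS](weight_sum1 G); have -> : k%:R * w0 = \sum_(j < k) w0 by rewrite sumr_const card_ord -[RHS]mulr_natl.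
  by apply: ler_sum => j _; apply: le_trans w2 _; exact: fmin_le.
by move=> /le_trans /(_ hnW); rewrite ler_pM2r.
Qed.

(** Since k <= nW, d + k is at most nW b^d. This factor nW and the two in the square of [noise]
    explain the cube of nW in the number of samples. *)
Lemma check_fail : ((M ^ 2) ^ d)%:R / ((nW ^ 3 * T ^ 20)%:R * noise ^+ 2) <= (d + k)%:R^-1.
Proof.
have n0 : (0 < nW * M ^ (8 * d))%N by rewrite muln_gt0 nW_gt0 expn_gt0 M_gt0.
have dk0 : (0 < d + k)%N by rewrite addn_gt0 d0.
have key : ((M ^ 2) ^ d * (nW * M ^ (8 * d)) ^ 2 * (d + k) <= nW ^ 3 * T ^ 20)%N.
  have h1 : (d + k <= nW * b ^ d)%N.
    apply: (@leq_trans (nW * d.+1)); last by rewrite leq_mul2l ltn_expl ?orbT // (leq_trans _ b_ge8).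
    by rewrite mulnS addnC leq_add ?k_le // leq_pmull // nW_gt0.
  apply: leq_trans (leq_mul (leqnn _) h1) _.
  rewrite expnMn -!expnM.
  have -> : (b ^ (20 * (2 * d)) * (nW ^ 2 * b ^ (20 * (8 * d * 2))) * (nW * b ^ d) =
    nW ^ 3 * (b ^ (20 * (2 * d)) * b ^ (20 * (8 * d * 2)) * b ^ d))%N by rewrite (expnS nW 2); lia.
  by rewrite leq_mul2l -!expnD leq_pexp2l ?b_gt0 ?orbT //; move: d0; lia.
have NR : 0 < (nW ^ 3 * T ^ 20)%:R :> R by rewrite ltr0n muln_gt0 !expn_gt0 nW_gt0 b_gt0.
have pR : 0 < (nW * M ^ (8 * d))%:R :> R by rewrite ltr0n.
have kR : 0 < (d + k)%:R :> R by rewrite ltr0n.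
have keyR : ((M ^ 2) ^ d)%:R * (nW * M ^ (8 * d))%:R ^+ 2 * (d + k)%:R <= (nW ^ 3 * T ^ 20)%:R :> R.
  by rewrite -natrX -!natrM ler_nat.
exact: (fail_num NR pR kR keyR).
Qed.

End GridConstants.

(** * The running time in terms of the parameters *)

Lemma time_exponent q D d X : (2 * (q * (d * (q * D))) <= (X + (2 * (q * (q * D)) + 3 * D)) * d)%N.
Proof.
have -> : (2 * (q * (d * (q * D))) = 2 * (q * (q * D)) * d)%N by lia.
by rewrite leq_mul2r; move: (2 * (q * (q * D)))%N => Z; apply/orP; right; lia.
Qed.

Section RunningTime.
Variable R : realType.

Lemma two_le_exp (x : R) : 1 <= x -> 2 <= expR x.
Proof. by move=> x1; apply: le_trans (expR_ge1Dx x); lra. Qed.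

(** The cube of eps0 in [Y] absorbs the rounding of exp(c0) to an integer, as K0^d <= exp(3 c0 d);
    the factor 2 from rounding rho is absorbed by squaring, since Y >= 2. *)
Lemma grid_base_le (c0 rho : R) (d K0 nR : nat) (Y := rho * d%:R / expR (- c0 * d%:R) ^+ 3) :
  2 <= c0 -> (0 < d)%N -> K0%:R <= expR (3 * c0) -> 1 <= rho -> nR%:R <= 2 * rho ->
  2 <= Y /\ (base d K0 nR)%:R <= Y ^+ 2.
Proof.
move=> hc d0 hK hrho hn; have dR : 1 <= d%:R :> R by rewrite ler1n.
have YE : Y = rho * d%:R * expR (d%:R * (3 * c0)).
  rewrite /Y -expRM_natl -expRN; congr (_ * expR _); ring.
have rd : 1 <= rho * d%:R by rewrite mulr_ege1.
have cd : 1 <= d%:R * (3 * c0) by rewrite mulr_ege1 //; lra.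
have Y2 : 2 <= Y.
  rewrite YE; apply: le_trans (two_le_exp cd) _.
  by rewrite ler_peMl ?expR_ge0.
split => //; apply: le_trans (_ : 2 * Y <= _); last by rewrite expr2 ler_wpM2r //; lra.
rewrite /base !natrM natrX YE expRM_natl mulrA; apply: ler_pM; rewrite ?mulr_ge0 ?exprn_ge0 //.
  by rewrite mulrA ler_wpM2r.
by rewrite lerXn2r ?nnegrE ?expR_ge0.
Qed.

Lemma running_time (A D : nat) (c0 : R) (K0 : nat) : 2 <= c0 -> K0%:R <= expR (3 * c0) ->
  exists C : nat, forall (d nR nW t : nat) (rho w0 : R) (M := ((nR * d * K0 ^ d) ^ 20)%N),
  (0 < d)%N -> 1 <= rho -> nR%:R <= 2 * rho -> 0 < w0 <= 1 -> nW%:R <= 2 * (1 / w0) ->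
  (t <= A * (nW ^ 3 * (M ^ d) ^ 20) ^ D)%N ->
  t%:R <= C%:R * (rho * d%:R / expR (- c0 * d%:R) ^+ 3) ^+ (C * d) * (1 / w0) ^+ C.
Proof.
move=> hc hK; set C := (A * 2 ^ (3 * D) + (2 * (20 * (20 * D)) + 3 * D))%N.
have CA : (A * 2 ^ (3 * D) <= C)%N by exact: leq_addr.
have CW : (3 * D <= C)%N by exact: (leq_trans (leq_addl _ _) (leq_addl _ _)).
have CY d : (2 * (20 * (d * (20 * D))) <= C * d)%N by exact: time_exponent.
clearbody C; exists C => d nR nW t rho w0 M d0 hrho hn /andP[w0p w1] hW ht.
have [Y2 hb] := grid_base_le hc d0 hK hrho hn.
set Y := rho * _ / _ in Y2 hb *; set b := base d K0 nR in hb; set W := 1 / w0 in hW *.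
have W1 : 1 <= W by rewrite /W ler_pdivlMr // mul1r.
have Y1 : 1 <= Y by apply: le_trans Y2; rewrite ler1n.
apply: le_trans (_ : (A * (nW ^ 3 * (M ^ d) ^ 20) ^ D)%:R <= _); first by rewrite ler_nat.
have -> : (A * (nW ^ 3 * (M ^ d) ^ 20) ^ D = A * (nW ^ (3 * D) * b ^ (20 * (d * (20 * D)))))%N.
  by rewrite expnMn -!expnM.
rewrite !natrM !natrX.
apply: le_trans (_ : A%:R * ((2 * W) ^+ (3 * D) * (Y ^+ 2) ^+ (20 * (d * (20 * D)))) <= _).
  apply: ler_wpM2l => //; apply: ler_pM; rewrite ?exprn_ge0 //.
    by rewrite lerXn2r ?nnegrE // (le_trans _ hW).
  by rewrite lerXn2r ?nnegrE // (le_trans _ hb).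
rewrite exprMn -exprM mulrA mulrA -natrX -natrM -mulrA [W ^+ _ * _]mulrC mulrA.
apply: ler_pM; rewrite ?mulr_ge0 ?exprn_ge0 // ?(le_trans _ W1) ?(le_trans _ Y1) //.
  apply: ler_pM; rewrite ?exprn_ge0 ?(le_trans _ Y1) //; first by rewrite ler_nat.
  by rewrite ler_weXn2l //; exact: CY.
by rewrite ler_weXn2l.
Qed.

End RunningTime.

(** * Assembly of the theorem *)

Section Samples.
Variables (R : realType) (d k : nat) (G : mixture R d k) (tape : nat -> R).

Lemma samples_setup (s1 : fstate R) (M N FL : nat) (F : nat -> nat) :
  [/\ [/\ rg s1 0%N = d, rg s1 2%N = (M ^ 2)%N, rg s1 3%N = N, rg s1 4%N = ((M ^ d) ^ 2)%N & rg s1 5%N = M],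
      rg s1 8%N = FL, rg s1 9%N = (M ^ 3)%N, (forall a, hp s1 a = 0%N) & ps s1 = 0%N] ->
  (forall g, F g = \sum_(n < N) (cell_index tape d (M ^ 2) M n == g))%N ->
  setup d M N FL F (den tape (sample_prog R) s1).
Proof.
move=> [[r0 r2 r3 r4 r5] r8 r9 hh hp0] hF.
have := den_samples tape hp0 hh; rewrite r0 r2 r3 r5 => hs.
have [fr _ _] := frame_den tape (sample_prog R) s1.
set s := den tape (sample_prog R) s1 in hs fr *; clearbody s.
split; [split|..]; try by rewrite fr.
- by rewrite fr // r4 -!expnM mulnC.
- by apply: funext => g; rewrite hs hF.
Qed.

End Samples.

Lemma mixture_w0_le1 (R : realType) (d k : nat) (G : mixture R d k) (w0 : R) : (0 < k)%N -> w0 <= wmin G -> w0 <= 1.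
Proof.
move=> k0 hw; apply: le_trans hw _; apply: le_trans (fmin_le (weight G) (Ordinal k0)) _.
rewrite -(weight_sum1 G) (bigD1 (Ordinal k0)) //= lerDl sumr_ge0 // => i _.
exact/ltW/weight_gt0.
Qed.

Lemma rho_ge1 (R : realType) (d k : nat) (G : mixture R d k) (rho : R) : (0 < k)%N -> rho_bounded rho G -> 1 <= rho.
Proof.
move=> k0 /(_ (Ordinal k0)) [_ /andP[h1 h2]].
have r0 : 0 < rho by apply: lt_le_trans h2; exact: std_gt0.
have h := le_trans h1 h2; rewrite leNgt; apply/negP => r1.
by move: h; rewrite leNgt (lt_trans r1) // invf_gt1.
Qed.

(** Adding 8 to the truncation of y = exp(c0) makes the base large enough to absorb numerical
    constants, and y + 8 <= 9 y <= y^3 as y >= 3. *)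
Lemma exp_grid (R : realType) (c0 : R) : 2 <= c0 -> exists K0 : nat,
  [/\ expR c0 <= K0%:R, (8 <= K0)%N & K0%:R <= expR (3 * c0)].
Proof.
move=> hc; set y := expR c0; have y3 : 3 <= y by apply: le_trans (expR_ge1Dx c0); lra.
have y0 : 0 <= y by apply: le_trans y3; rewrite ler0n.
have /andP[t1 t2] := truncn_itv y0; exists (Num.truncn y + 8)%N; split.
- by apply: le_trans (ltW t2) _; rewrite ler_nat -addn1 leq_add2l.
- exact: leq_addl.
rewrite natrD.
rewrite (expRM_natl 3) -/y.
have h1 : 3 * 3 <= y * y by apply: ler_pM => //; rewrite ler0n.
have h2 : 9 * y <= y * y * y by rewrite ler_wpM2r //; lra.
have -> : y ^+ 3 = y * y * y by rewrite !exprS expr0 mulr1 mulrA.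
by lra.
Qed.

Theorem theorem6p2 (R : realType) (c0 : R) (hc0 : 2 <= c0) :
  exists (p : prog R) (C : nat) (c : R), 0 < c /\
  forall (d k : nat) (rho w0 : R) (G : mixture R d k),
    (0 < d)%N -> (0 < k)%N ->
    rho_bounded rho G ->
    0 < w0 <= wmin G ->
    well_separated c0 G ->
    let eps0 : R := expR (- c0 * d%:R) in
    forall (dO : measure_display) (Omega : measurableType dO)
      (P : probability Omega R) (X : nat -> {RV P >-> d.-tuple R}),
      iid_samples G X ->
      exists E : set Omega,
        [/\ measurable E,
            ((1 - (d + k)%:R `^ (- c))%:E <= P E)%E &
            forall omega : Omega, exists (t : nat) (s : state R),
              [/\ exec (sample_tape (fun i => X i omega)) p
                    (init_state d k rho w0) t s,
                  t%:R <= C%:R * (rho * d%:R / eps0 ^+ 3) ^+ (C * d)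
                            * (1 / w0) ^+ C &
                  E omega -> accurate eps0 G s]].
Proof.
have [K0 [hK hK8 hK3]] := exp_grid hc0.
pose E2 : R := expR (- (2 * pi)).
have [A [D hlearn]] := learner_exec K0 E2.
have [C hC] := running_time A D hc0 hK3.
(* With c = 1 the failure probability is at most 1/(d + k). The execution is produced for every
   [omega]; the good event enters for the accuracy alone. *)
exists (learner K0 E2), C, 1; split => // d k rho w0 G d0 k0 hrho hw0 sep eps0 dO Omega P X iid.
have rho1 := rho_ge1 k0 hrho.
have /andP[w0p w0m] := hw0; have w01 := mixture_w0_le1 k0 w0m.
have iw0 : 0 < 1 / w0 by rewrite divr_gt0.
have iw1 : 1 <= 1 / w0 by rewrite ler_pdivlMr // mul1r.
have [nR [nR0 nR1 nR2 nR3]] := trunc_fraction_bounds (lt_le_trans ltr01 rho1).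
have [nW [nW0 nW1 nW2 nW3]] := trunc_fraction_bounds iw0.
have hW : 1 <= nW%:R * w0 by rewrite -ler_pdivrMr.
have hWm m : (m < nW)%N -> m%:R * w0 < 1 by move=> /nW2; rewrite ltr_pdivlMr.
have hn : nR%:R <= 2 * rho by apply: le_trans nR3 _; lra.
have hWn : nW%:R <= 2 * (1 / w0) by apply: le_trans nW3 _; lra.
set b := base d K0 nR; set M := (b ^ 20)%N; set N := (nW ^ 3 * (M ^ d) ^ 20)%N.
set FL := (nW * (M ^ d) ^ 2 * M)%N.
have M0 : (0 < M)%N := M_gt0 d0 hK8 nR0.
have T0 : (0 < M ^ d)%N by rewrite expn_gt0 M0.
have N0 : (0 < N)%N by rewrite muln_gt0; apply/andP; split; rewrite expn_gt0 ?nW0 ?T0.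
have tau0 : 0 < noise R d K0 nR nW by exact: (noise_gt0 d0 hK8 nR0 hW).
have [E [mE PE hE]] := @good_event R d k G dO Omega P X iid (M ^ 2) M N M0 N0 _ tau0.
exists E; split => //.
  apply: le_trans PE; rewrite lee_fin lerD2l lerN2 powR_inv1 ?ler0n //.
  exact: (check_fail hc0 d0 k0 hw0 hK hK8 nR1 nR0 hW).
move=> omega.
have [t [st [s1 [hexec ht hst hs1]]]] := hlearn (sample_tape (fun i => X i omega)) d k rho w0 nR nW
  d0 (K0_gt0 hK8) nR0 nW0 nR1 nR2 hW hWm.
exists t, st; split => //.
  by apply: (hC d nR nW t rho w0) => //; rewrite w0p.
move=> hEo.
have hF z : inner_cell (M ^ 2) z -> `|freq R M N (count X (M ^ 2) M N omega) z - cell_mass G M z| <= noise R d K0 nR nW.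
  exact: hE.
have hset := samples_setup (tape := sample_tape (fun i => X i omega)) hs1
  (F := count X (M ^ 2) M N omega) (fun g => erefl _).
have [sg [us all_in hs]] := @learn_ok R d k G c0 hc0 d0 k0 sep M N FL _ _ M0 N0
  (check_hM d0 hrho hK hK8 nR1 nR0) (check_htau hc0 d0 k0 hrho hw0 hK hK8 nR1 nR0 hW) hF
  (check_hrange d0 hrho hK8 nR1 nR0)
  (check_hQ d0 hrho hK8 nR1 nR0) (check_hfloor hc0 d0 k0 hrho hw0 hK hK8 nR1 nR0 hW)
  (check_hnoise hc0 d0 k0 hw0 hK hK8 nR1 nR0 hW)
  (sample_tape (fun i => X i omega)) _ hset.
apply: (accurate_of_slots d0 us all_in) => j.
by rewrite hst; exact: hs.
Qed.
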